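(* There is an injective algebra homomorphism $W(\pi)\hookrightarrow(L*\mathcal M)^G$ which restricts to the identification $\Gamma\subset\Lambda\subset L$ on $\Gamma$. With respect to this embedding, $W(\pi)$ is a Galois algebra over $\Gamma$.
   Context: Let $\Bbbk$ be algebraically closed of characteristic $0$, let $p_1\le\dots\le p_n$ be positive integers, and put $m=\sum p_i$. $W(\pi)$ is the finite $W$-algebra of $\mathfrak{gl}_m(\Bbbk)$ for the nilpotent of Jordan type $(p_1,\dots,p_n)$. It is realized (Brundan–Kleshchev) as the quotient of the shifted Yangian $Y_\pi(\mathfrak{gl}_n)$ by the ideal generated by $d_1^{(r)}$, $r>p_1$. $\Gamma\subset W(\pi)$ is the Gelfand–Tsetlin subalgebra, i.e. the polynomial algebra generated by the coefficients $a_r^{(k)}$ ($1\le r\le n$, $1\le k\le p_1+\dots+p_r$) of $$A_r(u)=u^{p_1}(u-1)^{p_2}\cdots(u-r+1)^{p_r}d_1(u)\cdots d_r(u-r+1),$$ with $d_i(u)=1+\sum_r d_i^{(r)}u^{-r}$. It is also generated by the centres of the subalgebras $W(p_1,\dots,p_k)$, $k=1,\dots,n$. Galois data. Let $\Lambda=\Bbbk[x_{ri}^k:1\le i\le r\le n,\ 1\le k\le p_i]$ and let $L$ be its fraction field. Identify $\Gamma$ with a subalgebra of $\Lambda$ by sending $a_r^{(k)}$ to the $k$-th elementary symmetric polynomial in the $p_1+\dots+p_r$ variables $x_{ri}^{k'}$ ($1\le i\le r$, $1\le k'\le p_i$). The group $G=S_{p_1}\times S_{p_1+p_2}\times\dots\times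 S_{p_1+\dots+p_n}$ acts on $\Lambda$, the factor $S_{p_1+\dots+p_r}$ permuting the variables with first index $r$. Then $\Gamma=\Lambda^G$, and $L/K$ is Galois with group $G$, where $K$ is the fraction field of $\Gamma$. $\mathcal M$ is the free abelian group on $\delta_{ri}^k$ ($1\le i\le r\le n-1$, $1\le k\le p_i$). It acts on $L$ by automorphisms, $\delta_{ri}^k$ shifting $x_{ri}^k\mapsto x_{ri}^k+1$ and fixing the other variables. $G$ normalizes $\mathcal M$ in $\operatorname{Aut}L$, and $\mathcal M\cap G=\{e\}$. $L*\mathcal M$ is the skew group algebra: the free left $L$-module with basis $\mathcal M$ and multiplication $(a\varphi)(b\psi)=a\varphi(b)\,\varphi\psi$. $G$ acts on it by $(a\varphi)^g=g(a)\,g\varphi g^{-1}$, and $(L*\mathcal M)^G$ is the invariant subalgebra. A subring $U\subset(L*\mathcal M)^G$ containing $\Gamma$ and finitely generated over $\Gamma$ is a Galois algebra (Galois ring) over $\Gamma$ if $KU=UK=(L*\mathcal M)^G$. *)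

(* Defs.v *)
From HB Require Import structures.
From mathcomp Require Import all_boot all_order all_algebra.
From mathcomp Require Import all_fingroup.
From mathcomp Require Import mpoly.
Set Implicit Arguments. Unset Strict Implicit. Unset Printing Implicit Defensive.
Import Order.TTheory GRing.Theory.
Local Open Scope ring_scope.
Notation "x %:F" := (@FracField.tofrac _ x) : ring_scope.

(* Indices are 0-based: row i of the paper (1 <= i <= n) is i-1 here.   *)
(* p : nat -> nat, p i = p_{i+1} for i < n.                             *)

Definition msum (p : nat -> nat) (r : nat) : nat := (\sum_(i < r.+1) p i)%N.

(* shift s_{i,i+1} = p_{i+1} - p_i of the (left-justified) pyramid; *)
(* s_{i+1,i} = 0.                                                   *)
Definition yshift (p : nat -> nat) (i : nat) : nat := (p i.+1 - p i)%N.

Section Yangian.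
Variables (k : fieldType) (n : nat) (p : nat -> nat) (A : algType k).
Variables (d e f : nat -> nat -> A).

Definition comm (x y : A) : A := x * y - y * x.

Definition Dc (i r : nat) : A := if r == 0%N then 1 else d i r.

(* D'_i^{(r)} : coefficients of D_i(u)^{-1}, via
   D'^{(0)} = 1, D'^{(r)} = - sum_{t=1}^r D^{(t)} D'^{(r-t)}. *)
Fixpoint Dinvs (i r : nat) : seq A :=
  match r with
  | 0 => [:: 1]
  | r'.+1 => let s := Dinvs i r' in
      rcons s (- \sum_(t < r'.+1) d i t.+1 * nth 0 s (r' - t))
  end.
Definition Dinv (i r : nat) : A := nth 0 (Dinvs i r) r.

(* Defining relations of the shifted Yangian Y_pi(gl_n) (Brundan-Kleshchev
   presentation, generators D_i^{(r)} (r>=1), E_i^{(r)} (r > s_{i,i+1}),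
   F_i^{(r)} (r >= 1)), together with D_1^{(r)} = 0 for r > p_1, i.e. the
   defining relations of W(pi). *)
Definition W_relations : Prop :=
      (forall i j r s, (i < n)%N -> (j < n)%N -> (0 < r)%N -> (0 < s)%N ->
         comm (d i r) (d j s) = 0) /\
      (forall i j r s, (i.+1 < n)%N -> (j.+1 < n)%N -> (yshift p i < r)%N -> (0 < s)%N ->
         comm (e i r) (f j s) =
           if i == j then - \sum_(t < (r + s)%N) Dinv i t * Dc i.+1 (r + s - 1 - t)%N else 0) /\
      (forall i j r s, (i < n)%N -> (j.+1 < n)%N -> (0 < r)%N -> (yshift p j < s)%N ->
         comm (d i r) (e j s) =
           ((i == j)%:R - (i == j.+1)%:R) * \sum_(t < r) Dc i t * e j (r + s - 1 - t)%N) /\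
      (forall i j r s, (i < n)%N -> (j.+1 < n)%N -> (0 < r)%N -> (0 < s)%N ->
         comm (d i r) (f j s) =
           ((i == j.+1)%:R - (i == j)%:R) * \sum_(t < r) f j (r + s - 1 - t)%N * Dc i t) /\
      (forall i r s, (i.+1 < n)%N -> (yshift p i < r)%N -> (yshift p i < s)%N ->
         comm (e i r) (e i s.+1) - comm (e i r.+1) (e i s) = e i r * e i s + e i s * e i r) /\
      (forall i r s, (i.+1 < n)%N -> (0 < r)%N -> (0 < s)%N ->
         comm (f i r.+1) (f i s) - comm (f i r) (f i s.+1) = f i r * f i s + f i s * f i r) /\
      (forall i r s, (i.+2 < n)%N -> (yshift p i < r)%N -> (yshift p i.+1 < s)%N ->
         comm (e i r) (e i.+1 s.+1) - comm (e i r.+1) (e i.+1 s) = - (e i r * e i.+1 s)) /\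
      (forall i r s, (i.+2 < n)%N -> (0 < r)%N -> (0 < s)%N ->
         comm (f i r.+1) (f i.+1 s) - comm (f i r) (f i.+1 s.+1) = - (f i.+1 s * f i r)) /\
      (forall i j r s, (i.+1 < n)%N -> (j.+1 < n)%N -> ((i.+1 < j)%N || (j.+1 < i)%N) ->
         (yshift p i < r)%N -> (yshift p j < s)%N -> comm (e i r) (e j s) = 0) /\
      (forall i j r s, (i.+1 < n)%N -> (j.+1 < n)%N -> ((i.+1 < j)%N || (j.+1 < i)%N) ->
         (0 < r)%N -> (0 < s)%N -> comm (f i r) (f j s) = 0) /\
      (forall i j r s t, (i.+1 < n)%N -> (j.+1 < n)%N -> ((j == i.+1) || (i == j.+1)) ->
         (yshift p i < r)%N -> (yshift p i < s)%N -> (yshift p j < t)%N ->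
         comm (e i r) (comm (e i s) (e j t)) + comm (e i s) (comm (e i r) (e j t)) = 0) /\
      (forall i j r s t, (i.+1 < n)%N -> (j.+1 < n)%N -> ((j == i.+1) || (i == j.+1)) ->
         (0 < r)%N -> (0 < s)%N -> (0 < t)%N ->
         comm (f i r) (comm (f i s) (f j t)) + comm (f i s) (comm (f i r) (f j t)) = 0) /\
      (forall r, (0 < n)%N -> (p 0%N < r)%N -> d 0%N r = 0).

(* Power series in u^{-1} : coefficient functions nat -> A. *)
Definition pmul (g h : nat -> A) : nat -> A :=
  fun j => \sum_(l < j.+1) g l * h (j - l)%N.

(* coefficient of u^{-j} in d_i(u - c) = 1 + sum_r d_i^{(r)} (u-c)^{-r} *)
Definition dshift (i c : nat) : nat -> A :=
  fun j => if j == 0%N then 1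
           else \sum_(r < j) ('C(j.-1, j - r.+1) * c ^ (j - r.+1))%N%:R * d i r.+1.

(* coefficient of u^{-j} in (1 - c u^{-1})^{q} d_i(u - c) *)
Definition Afactor (i c q : nat) : nat -> A :=
  pmul (fun j => 'C(q, j)%:R * (- (c%:R : A)) ^+ j) (dshift i c).

(* A_r(u) = u^{p_1} (u-1)^{p_2} ... (u-r+1)^{p_r} d_1(u) ... d_r(u-r+1)
          = u^{m_r} * prod_{i=1}^r (1-(i-1)u^{-1})^{p_i} d_i(u-i+1);
   acoef r j = a_{r+1}^{(j)} = coefficient of u^{m_r - j}. *)
Definition acoef (r j : nat) : A :=
  foldr pmul (fun l => (l == 0%N)%:R) [seq Afactor i i (p i) | i <- iota 0 r.+1] j.

End Yangian.

Definition is_alg_hom (k : fieldType) (A B : algType k) (h : A -> B) : Prop :=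
  [/\ forall (c : k) x y, h (c *: x + y) = c *: h x + h y,
      forall x y, h (x * y) = h x * h y & h 1 = 1].

(* W, with elements d e f, is (a model of) W(pi): it satisfies the relations
   and is initial among k-algebras with such elements (universal property of
   the algebra given by generators and relations). *)
Definition is_W_pi (k : fieldType) (n : nat) (p : nat -> nat) (W : algType k)
  (d e f : nat -> nat -> W) : Prop :=
  W_relations n p d e f /\
  forall (B : algType k) (d' e' f' : nat -> nat -> B),
    W_relations n p d' e' f' ->
    let P := fun h : W -> B =>
      [/\ is_alg_hom h,
          forall i r, (i < n)%N -> (0 < r)%N -> h (d i r) = d' i r,
          forall i r, (i.+1 < n)%N -> (yshift p i < r)%N -> h (e i r) = e' i r &
          forall i r, (i.+1 < n)%N -> (0 < r)%N -> h (f i r) = f' i r] in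
    exists h, P h /\ forall h', P h' -> h' =1 h.

Section Galois.
Variables (k : fieldType) (n : nat) (p : nat -> nat).

Definition maxp : nat := (\max_(i < n) p i)%N.
(* variable x_{ri}^k  <->  ((r, i), k) with i <= r < n, k < p i  (0-based) *)
Definition Vpred (v : 'I_n * 'I_n * 'I_maxp) : bool :=
  ((v.1.2 <= v.1.1)%N && (v.2 < p v.1.2)%N).
Definition Var : finType := {v : 'I_n * 'I_n * 'I_maxp | Vpred v}.
Definition rowv (v : Var) : nat := (sval v).1.1.

Definition NV : nat := #|Var|.
Definition Lam : Type := {mpoly k[NV]}.
Definition Lfld : Type := {fraction {mpoly k[NV]}}.
Definition xv (v : Var) : {mpoly k[NV]} := 'X_(enum_rank v).

Definition substL (g : Var -> {mpoly k[NV]}) (q : {mpoly k[NV]}) : {mpoly k[NV]} :=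
  q \mPo [tuple g (enum_val j) | j < NV].
Definition Lmap (h : {mpoly k[NV]} -> {mpoly k[NV]}) (x : Lfld) : Lfld :=
  (h \n_(generic_quotient.repr x))%:F / (h \d_(generic_quotient.repr x))%:F.

(* The group M: elements are integer vectors on the variables, supported on
   variables with r <= n-1 (1-based), i.e. rowv v < n-1. *)
Definition Mt : Type := {ffun Var -> int}.
Definition in_M (m : Mt) : Prop := forall v, rowv v = n.-1 -> m v = 0.
Definition actM (m : Mt) : Lfld -> Lfld :=
  Lmap (substL (fun v => xv v + ((m v)%:~R : k)%:MP)).

Definition inG (s : {perm Var}) : Prop := forall v, rowv (s v) = rowv v.
Definition permL (s : {perm Var}) : {mpoly k[NV]} -> {mpoly k[NV]} :=
  substL (fun v => xv (s v)).
Definition actG (s : {perm Var}) : Lfld -> Lfld := Lmap (permL s).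
(* conjugation g m g^{-1} on M *)
Definition conjM (s : {perm Var}) (m : Mt) : Mt := [ffun v => m ((s^-1)%g v)].

(* Skew group algebra L * M: finite formal sums  sum a_j m_j, compared
   through their coefficient functions. *)
Definition SA : Type := seq (Lfld * Mt).
Definition coef (x : SA) (m : Mt) : Lfld := \sum_(y <- x | y.2 == m) y.1.
Definition saeq (x y : SA) : Prop := forall m, coef x m = coef y m.
Definition in_LM (x : SA) : Prop := forall m, coef x m != 0 -> in_M m.
Definition samul (x y : SA) : SA :=
  [seq (a.1 * actM a.2 b.1, a.2 + b.2) | a <- x, b <- y].
Definition saone : SA := [:: (1, 0)].
Definition sacst (a : Lfld) : SA := [:: (a, 0)].
Definition sascale (c : k) (x : SA) : SA := [seq ((c%:MP)%:F * a.1, a.2) | a <- x].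
Definition saG (s : {perm Var}) (x : SA) : SA := [seq (actG s a.1, conjM s a.2) | a <- x].
Definition inv_G (x : SA) : Prop := forall s, inG s -> saeq (saG s x) x.

(* K = Frac Gamma, Gamma = Lambda^G *)
Definition inK (a : Lfld) : Prop :=
  exists q r : {mpoly k[NV]},
    [/\ forall s, inG s -> permL s q = q, forall s, inG s -> permL s r = r,
        r != 0 & a = q%:F / r%:F].

Definition esymr (r j : nat) : {mpoly k[NV]} :=
  \sum_(S : {set Var} | (S \subset [set v | rowv v == r]) && (#|S| == j))
     \prod_(v in S) xv v.

End Galois.

(* Main.v *)
(* Number rows from 0 and put z_v = - (row v + x_v), so that the shift T_v : x_v -> x_v - 1 raises z_v by one.  The generators
   E_i^(r), F_i^(r), D_i^(r) are sent to the Gelfand-Tsetlin operators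
     sum_v z_v^(r-1-shift) c_v T_v,   sum_v T_v^-1 z_v^(r-1) b_v,
     prod_(row i) (1 - z_v/u) / prod_(row i-1) (1 - (z_v - 1)/u),
   whose relations follow from exchange relations between the operators c_v T_v and, for [E, F], from
   a partial fraction expansion.  Since the coefficients in a row are a Vandermonde system in the
   distinct z_v, the left (or right) L-span of the image contains every T_v and T_v^-1, hence
   all of L * M; averaging over the finite group G gives K U = U K = (L * M)^G.
   Injectivity is a growth argument.  The loop filtration of W(pi), whose associated graded Lie
   algebra is a truncated shifted current algebra, shows that W(pi) is spanned by ordered monomials in
   N elements, where N is the number of x_v plus the rank of M; if the kernel were nonzero, one
   monomial and its multiples would be redundant, and the image would grow with degree at most N - 1.
   But the image contains Gamma, over which the x_v are integral, and words in the E's whose L-span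
   contains a box of M, so it grows with degree N. *)
Require Import Defs.
From HB Require Import structures.
From mathcomp Require Import all_boot all_order all_algebra all_fingroup.
From mathcomp Require Import boolp finmap monalg.
From mathcomp Require Import ring zify.
Set Implicit Arguments. Unset Strict Implicit. Unset Printing Implicit Defensive.
Import GRing.Theory.
Local Open Scope ring_scope.

(** * Roots of a filtered current algebra *)


(** [W] is available only through generators, relations and initiality. Such data show that ordered
    monomials span, but give no independence, and here the Gelfand-Tsetlin representation is the
    only source of it. Comparing growth avoids computing leading terms of the images of all
    monomials. The price is that the two growth exponents must agree exactly, so the truncation of
    every row has to be found: the relations give it only for d_1, and brackets must carry it to the
    other rows and to all root vectors. Division by 2 is what turns antisymmetry and the symmetrised
    Serre relations into vanishing of leading terms. Lowering operators keep their coefficients to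
    the right of the shift. In the opposite ring they then satisfy the same exchange relations as
    the raising operators, so one proof serves both families; the same device gives right spans from
    left spans. *)

Section FilteredBracket.
Variables (k : fieldType) (A : lmodType k) (br : A -> A -> A) (fil : nat -> A -> Prop).

(** Read [fil D x] as: x has degree less than D. An element of degree at most r lies in [fil r.+1],
    and congruence modulo [fil D] compares components of degree D. The asymmetric indices of
    [fil_br] say that degrees at most add under brackets, with one factor negligible. *)
Record filtered_bracket : Prop := FilteredBracket {
  brDl : forall x y z, br (x + y) z = br x z + br y z;
  brZl : forall c x z, br (c *: x) z = c *: br x z;
  brC : forall x y, br y x = - br x y;
  br_jac : forall x y z, br (br x y) z = br (br x z) y + br x (br y z);
  fil0 : forall D, fil D 0;
  filD : forall D x y, fil D x -> fil D y -> fil D (x + y);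
  filZ : forall D c x, fil D x -> fil D (c *: x);
  filS : forall D x, fil D x -> fil D.+1 x;
  fil_br : forall a b x y, fil a x -> fil b.+1 y -> fil (a + b) (br x y) }.

Definition fil_eq (D : nat) (x y : A) : Prop := fil D (x - y).

Hypothesis HF : filtered_bracket.
Local Notation eqm := fil_eq.

Lemma brNl x z : br (- x) z = - br x z.
Proof. by rewrite -scaleN1r (brZl HF) scaleN1r. Qed.
Lemma brBl x y z : br (x - y) z = br x z - br y z.
Proof. by rewrite (brDl HF) brNl. Qed.
Lemma brDr x y z : br z (x + y) = br z x + br z y.
Proof. by rewrite !(brC HF _ z) (brDl HF) opprD. Qed.
Lemma brNr x z : br z (- x) = - br z x.
Proof. by rewrite !(brC HF _ z) brNl. Qed.
Lemma brBr x y z : br z (x - y) = br z x - br z y.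
Proof. by rewrite brDr brNr. Qed.
Lemma brZr c x z : br z (c *: x) = c *: br z x.
Proof. by rewrite !(brC HF _ z) (brZl HF) scalerN. Qed.
Lemma br_jacr u x y : br u (br x y) = br (br u x) y - br (br u y) x.
Proof.
by rewrite (br_jac HF u x y) addrAC subrr add0r.
Qed.

Lemma filN D x : fil D x -> fil D (- x).
Proof. by move=> Hx; rewrite -scaleN1r; apply: (filZ HF). Qed.
Lemma filB D x y : fil D x -> fil D y -> fil D (x - y).
Proof. by move=> Hx Hy; apply: (filD HF) => //; apply: filN. Qed.
Lemma fil_le D E x : (D <= E)%N -> fil D x -> fil E x.
Proof.
move=> /subnK <-; elim: (E - D)%N => // m IH Hx.
by rewrite addSn; apply: (filS HF); apply: IH.
Qed.
Lemma fil_brr a b x y : fil a.+1 x -> fil b y -> fil (a + b) (br x y).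
Proof.
by move=> Hx Hy; rewrite (brC HF) addnC; apply: filN; apply: (fil_br HF).
Qed.

Lemma eqm_refl D x : eqm D x x.
Proof. by rewrite /fil_eq subrr; apply: (fil0 HF). Qed.
Lemma eqm_sym D x y : eqm D x y -> eqm D y x.
Proof. by move=> H; rewrite /fil_eq -opprB; apply: filN. Qed.
Lemma eqm_trans D y x z : eqm D x y -> eqm D y z -> eqm D x z.
Proof. by move=> H1 H2; rewrite /fil_eq -(subrKA y); apply: (filD HF). Qed.
Lemma eqmD D x y x' y' : eqm D x x' -> eqm D y y' -> eqm D (x + y) (x' + y').
Proof. by move=> H1 H2; rewrite /fil_eq opprD addrACA; apply: (filD HF). Qed.
Lemma eqmN D x x' : eqm D x x' -> eqm D (- x) (- x').
Proof. by move=> H1; rewrite /fil_eq -opprD; apply: filN. Qed.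
Lemma eqmB D x y x' y' : eqm D x x' -> eqm D y y' -> eqm D (x - y) (x' - y').
Proof. by move=> H1 H2; apply: eqmD => //; apply: eqmN. Qed.
Lemma eqmZ D c x x' : eqm D x x' -> eqm D (c *: x) (c *: x').
Proof. by move=> H1; rewrite /fil_eq -scalerBr; apply: (filZ HF). Qed.
Lemma eqm0 D x : eqm D x 0 <-> fil D x.
Proof. by rewrite /fil_eq subr0. Qed.
Lemma eqm_fil D x x' : eqm D x x' -> fil D x' -> fil D x.
Proof. by move=> H1 H2; rewrite -(subrK x' x); apply: (filD HF). Qed.
Lemma eqm_brl D a b x x' y :
  (a + b = D)%N -> eqm a x x' -> fil b.+1 y -> eqm D (br x y) (br x' y).
Proof. by move=> <- H1 H2; rewrite /fil_eq -brBl; apply: (fil_br HF). Qed.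
Lemma eqm_brr D a b x y y' :
  (a + b = D)%N -> fil a.+1 x -> eqm b y y' -> eqm D (br x y) (br x y').
Proof. by move=> <- H1 H2; rewrite /fil_eq -brBr; apply: fil_brr. Qed.
Lemma fil_brlE D a b x y : (a + b = D)%N -> fil a x -> fil b.+1 y -> fil D (br x y).
Proof. by move=> <-; apply: (fil_br HF). Qed.
Lemma fil_brrE D a b x y : (a + b = D)%N -> fil a.+1 x -> fil b y -> fil D (br x y).
Proof. by move=> <-; apply: fil_brr. Qed.
Lemma eqm_2 D x : (2%:R : k) != 0 -> eqm D x (- x) -> fil D x.
Proof.
move=> h2; rewrite /fil_eq opprK => H.
have -> : x = 2%:R^-1 *: (x + x).
  by rewrite -mulr2n -scaler_nat scalerA mulVf // scale1r.
exact: (filZ HF).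
Qed.

End FilteredBracket.

(* [x i r] plays the part of the class of E_i^{(r+1)} (or F_i^{(r+1)}) in the
   associated graded Lie algebra; the congruences [eqm] are the relations of a
   shifted current algebra of type A. *)
Section CurrentAlgebra.
Variables (k : fieldType) (A : lmodType k) (br : A -> A -> A) (fil : nat -> A -> Prop).
Variables (n : nat) (x h : nat -> nat -> A) (sg : nat -> nat) (eps : k).
Local Notation eqm := (fil_eq fil).

(** [sg i] is the lowest degree in which [x i] lives, and [eps] is the sign with which the Cartan
    elements act: 1 for the raising and -1 for the lowering generators. The other relations have the
    same form for both families. *)
Record current_relations : Prop := CurrentRelations {
  cur_fil : forall i r, (i.+1 < n)%N -> (sg i <= r)%N -> fil r.+1 (x i r);
  cur_same : forall i r s, (i.+1 < n)%N -> (sg i <= r)%N -> (sg i <= s)%N ->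
    eqm (r + s).+1 (br (x i r) (x i s.+1)) (br (x i r.+1) (x i s));
  cur_next : forall i r s, (i.+2 < n)%N -> (sg i <= r)%N -> (sg i.+1 <= s)%N ->
    eqm (r + s).+1 (br (x i r) (x i.+1 s.+1)) (br (x i r.+1) (x i.+1 s));
  cur_far : forall i j r s, (i.+1 < n)%N -> (j.+1 < n)%N ->
    (i.+1 < j)%N || (j.+1 < i)%N -> (sg i <= r)%N -> (sg j <= s)%N ->
    fil (r + s) (br (x i r) (x j s));
  cur_serre : forall i j r s t, (i.+1 < n)%N -> (j.+1 < n)%N ->
    (j == i.+1) || (i == j.+1) -> (sg i <= r)%N -> (sg i <= s)%N -> (sg j <= t)%N ->
    fil (r + s + t) (br (x i r) (br (x i s) (x j t)) + br (x i s) (br (x i r) (x j t)));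
  cur_hfil : forall i r, (i < n)%N -> fil r.+1 (h i r);
  cur_h : forall i j r s, (j < n)%N -> (i.+1 < n)%N -> (sg i <= s)%N ->
    eqm (r + s) (br (h j r) (x i s))
      ((eps * ((j == i)%:R - (j == i.+1)%:R)) *: x i (r + s)) }.

Hypothesis HF : filtered_bracket br fil.
Hypothesis two : (2%:R : k) != 0.
Hypothesis HX : current_relations.

(** The root vector of the simple roots i, ..., i + l in degree r. Every factor but the first sits
    in its lowest degree; by [root_step] another distribution of the degrees gives the same
    class. *)
Fixpoint root (i l r : nat) : A :=
  if l is l'.+1 then br (root i l' (r - sg (i + l'.+1))) (x (i + l'.+1) (sg (i + l'.+1)))
  else x i r.
Fixpoint rshift (i l : nat) : nat :=
  if l is l'.+1 then (rshift i l' + sg (i + l'.+1))%N else sg i.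

Lemma root_fil i l r : (i + l.+1 < n)%N -> (rshift i l <= r)%N -> fil r.+1 (root i l r).
Proof.
elim: l r => [|l IH] r Hn Hr /=; first by apply: (cur_fil HX) => //; lia.
rewrite /= in Hr.
rewrite -{1}(subnK (_ : sg (i + l.+1) <= r)%N); last lia.
rewrite -addSn; apply: (fil_br HF); first by apply: IH; lia.
by apply: (cur_fil HX) => //; lia.
Qed.

(** Moving the difference s - r from one factor to the other with [cur_same] gives [x_r, x_s] =
    [x_s, x_r] to leading order; antisymmetry and division by 2 finish. *)
Lemma cur_same0 i r s : (i.+1 < n)%N -> (sg i <= r)%N -> (sg i <= s)%N ->
  fil (r + s) (br (x i r) (x i s)).
Proof.
move=> Hn Hr Hs.
have key t a : (sg i <= a)%N -> eqm (a + (a + t)) (br (x i a) (x i (a + t)))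
                                 (br (x i (a + t)) (x i a)).
  have gen u b : (sg i <= b)%N -> (sg i <= a)%N ->
      eqm (b + (a + u)) (br (x i b) (x i (a + u))) (br (x i (b + u)) (x i a)).
    elim: u b => [|u IH] b Hb Ha; first by rewrite !addn0; apply: (eqm_refl HF).
    apply: (eqm_trans HF (y := br (x i b.+1) (x i (a + u)))).
      by rewrite !addnS; apply: (cur_same HX) => //; lia.
    by rewrite !addnS -!addSn; apply: IH => //; lia.
  by move=> Ha; apply: gen.
wlog le_rs : r s Hr Hs / (r <= s)%N.
  move=> W; case: (leqP r s) => H; first exact: W.
  by rewrite (brC HF) addnC; apply: (filN HF); apply: W => //; lia.
apply: (eqm_2 HF two); rewrite -(brC HF) -(subnKC le_rs); exact: key.
Qed.

(** The two halves of the symmetrised Serre relation differ by a bracket with [x_r, x_s], which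
    [cur_same0] makes negligible; so each half vanishes on its own. *)
Lemma serre0 i j r s t : (i.+1 < n)%N -> (j.+1 < n)%N -> (j == i.+1) || (i == j.+1) ->
  (sg i <= r)%N -> (sg i <= s)%N -> (sg j <= t)%N ->
  fil (r + s + t) (br (x i r) (br (x i s) (x j t))).
Proof.
move=> Hi Hj Hij Hr Hs Ht; apply: (eqm_2 HF two); rewrite /fil_eq opprK.
have H := cur_serre HX Hi Hj Hij Hr Hs Ht.
have E : br (x i r) (br (x i s) (x j t)) =
   br (br (x i r) (x i s)) (x j t) + br (x i s) (br (x i r) (x j t)).
  by rewrite (br_jac HF) (brC HF (x i s)) addrAC addNr add0r.
rewrite {2}E addrCA; apply: (filD HF) => //.
apply: (fil_br HF); [exact: cur_same0 | exact: (cur_fil HX)].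
Qed.


Ltac xfil := by [apply: (cur_fil HX); lia | apply: root_fil => /=; lia].

Lemma root_far i l j r s : (i + l.+1 < n)%N -> (j.+1 < n)%N ->
  (i + l.+1 < j)%N || (j.+1 < i)%N -> (rshift i l <= r)%N -> (sg j <= s)%N ->
  fil (r + s) (br (root i l r) (x j s)).
Proof.
move=> Hn Hj; elim: l r Hn => [|l IH] r Hn Hij /= Hr Hs.
  by apply: (cur_far HX) => //; lia.
rewrite (br_jac HF); apply: (filD HF).
  apply: (fil_brlE HF (a := r - sg (i + l.+1) + s) (b := sg (i + l.+1))); first lia; last xfil.
  by apply: IH => //; lia.
apply: (fil_brrE HF (a := r - sg (i + l.+1)) (b := sg (i + l.+1) + s)); first lia; first xfil.
by apply: (cur_far HX) => //; lia.
Qed.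

Lemma cur_next_eq i r t : (i.+2 < n)%N -> (sg i <= r)%N ->
  eqm (r + (sg i.+1 + t)) (br (x i r) (x i.+1 (sg i.+1 + t))) (br (x i (r + t)) (x i.+1 (sg i.+1))).
Proof.
move=> Hn; elim: t r => [|t IH] r Hr; first by rewrite !addn0; apply: (eqm_refl HF).
apply: (eqm_trans HF (y := br (x i r.+1) (x i.+1 (sg i.+1 + t)))).
  by rewrite !addnS; apply: (cur_next HX) => //; lia.
by rewrite !addnS -!addSn; apply: IH; lia.
Qed.

(** Jacobi regroups [[X, B], C] as [X, [B, C]], since X and C are far apart. Inside [B, C] the
    excess degree moves from C to B by [cur_next_eq], and regrouping back leaves a shorter root
    vector for the induction. *)
Lemma root_step i l r s : (i + l.+2 < n)%N -> (rshift i l <= r)%N ->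
  (sg (i + l.+1) <= s)%N ->
  eqm (r + s) (br (root i l r) (x (i + l.+1) s)) (root i l.+1 (r + s)).
Proof.
elim: l r s => [|l IH] r s Hn /= Hr Hs.
  rewrite addn1 in Hs *; rewrite -{1 2}(subnKC Hs) -addnBA //.
  by apply: cur_next_eq => //; lia.
set b := sg (i + l.+1) in Hr *; set c := sg (i + l.+2) in Hs *.
set X := root i l (r - b); set B := x (i + l.+1) b.
have ib : (i + l.+2 = (i + l.+1).+1)%N by lia.
have H1 : eqm (r + s) (br (br X B) (x (i + l.+2) s)) (br X (br B (x (i + l.+2) s))).
  rewrite (br_jac HF) /fil_eq addrK.
  apply: (fil_brlE HF (a := r - b + s) (b := b)); first lia; last xfil.
  by apply: root_far; lia.
have H2 : eqm (r + s) (br (br X (x (i + l.+1) (b + (s - c)))) (x (i + l.+2) c))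
                      (br X (br (x (i + l.+1) (b + (s - c))) (x (i + l.+2) c))).
  rewrite (br_jac HF) /fil_eq addrK.
  apply: (fil_brlE HF (a := r - b + c) (b := b + (s - c))); first lia; last xfil.
  by apply: root_far; rewrite -/c; lia.
have H3 : eqm (r + s) (br X (br B (x (i + l.+2) s)))
                      (br X (br (x (i + l.+1) (b + (s - c))) (x (i + l.+2) c))).
  apply: (eqm_brr HF (a := r - b) (b := b + s)); first lia; first xfil.
  have := @cur_next_eq (i + l.+1) b (s - c); rewrite -ib -/c subnKC //.
  by apply; lia.
apply: (eqm_trans HF H1); apply: (eqm_trans HF H3); apply: (eqm_trans HF (eqm_sym HF H2)).
apply: (eqm_brl HF (a := r + (s - c)) (b := c)); first lia; last xfil.
have := IH (r - b)%N (b + (s - c))%N; rewrite -/b -/X /=.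
have -> : (r - b + (b + (s - c)) = r + (s - c))%N by lia.
have -> : (r + s - c = r + (s - c))%N by lia.
by apply; lia.
Qed.

Lemma root_start i l r s : (i + l.+2 < n)%N -> (rshift i l.+1 <= r)%N -> (sg i <= s)%N ->
  fil (r + s) (br (root i l.+1 r) (x i s)).
Proof.
elim: l r => [|l IH] r Hn Hr Hs.
  rewrite /= addn1 in Hr *; rewrite (brC HF); apply: (filN HF).
  apply: (fil_le HF (D := s + (r - sg i.+1) + sg i.+1)); first lia.
  by apply: serre0 => //; lia.
rewrite [root _ _ _]/= -/(root i l.+1 _) (br_jac HF); rewrite /= in Hr.
apply: (filD HF).
  apply: (fil_brlE HF (a := r - sg (i + l.+2) + s) (b := sg (i + l.+2))); first lia; last xfil.
  by apply: IH => //=; lia.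
apply: (fil_brrE HF (a := r - sg (i + l.+2)) (b := sg (i + l.+2) + s)); first lia; first xfil.
by apply: (cur_far HX) => //; lia.
Qed.

(** For two factors this is Serre. A longer root vector is regrouped as [Y, [B, C]]; Jacobi then
    leaves [Y, C'], negligible by distance, and [[B, C], C'], negligible by Serre. *)
Lemma root_end i l r s : (i + l.+2 < n)%N -> (rshift i l.+1 <= r)%N ->
  (sg (i + l.+1) <= s)%N -> fil (r + s) (br (root i l.+1 r) (x (i + l.+1) s)).
Proof.
case: l => [|l] Hn Hr Hs.
  rewrite /= addn1 in Hr Hs *; rewrite (brC HF) (brC HF (x i.+1 _)) (brNr HF).
  rewrite opprK.
  apply: (fil_le HF (D := s + sg i.+1 + (r - sg i.+1))); first lia.
  by apply: serre0 => //; lia.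
rewrite /= in Hr *.
set b := sg (i + l.+1) in Hr *; set c := sg (i + l.+2) in Hs Hr *.
set Y := root i l _; set B := x (i + l.+1) b; set C := x (i + l.+2) c; set C' := x _ s.
have ib : (i + l.+2 = (i + l.+1).+1)%N by lia.
have FY : fil (r - c - b).+1 Y by xfil.
have YC t : (c <= t)%N -> fil (r - c - b + t) (br Y (x (i + l.+2) t)).
  by move=> Ht; apply: root_far => //; lia.
apply: (eqm_fil HF (x' := br (br Y (br B C)) C')).
  apply: (eqm_brl HF (a := r) (b := s)) => //; last xfil.
  rewrite (br_jac HF) /fil_eq addrK.
  apply: (fil_brlE HF (a := r - c - b + c) (b := b)); [lia | exact: YC | xfil].
rewrite (br_jac HF); apply: (filD HF).
  apply: (fil_brlE HF (a := r - c - b + s) (b := b + c)); [lia | exact: YC|].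
  by rewrite -addSn; apply: (fil_br HF); xfil.
apply: (fil_brrE HF (a := r - c - b) (b := s + c + b)); [lia | done |].
rewrite (brC HF C') (brC HF C B) (brNr HF) opprK.
by apply: serre0 => //; lia.
Qed.

(* Jacobi evaluates [[[Y,b],c],b'] in two ways, as [[Y,b'],[b,c]] and as
   -[[Y,b],[b',c]]; since the classes depend only on the sum of the degrees, twice
   the bracket vanishes. *)
Lemma root_mid i l r s : (i + l.+3 < n)%N -> (rshift i l.+2 <= r)%N ->
  (sg (i + l.+1) <= s)%N -> fil (r + s) (br (root i l.+2 r) (x (i + l.+1) s)).
Proof.
move=> Hn /= Hr Hs.
have ic : (i + l.+2 = (i + l.+1).+1)%N by lia.
rewrite ic in Hr *.
set b := sg (i + l.+1) in Hr Hs *; set c := sg (i + l.+1).+1 in Hr *.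
pose ib := (i + l.+1)%N; rewrite -/ib.
have Eib : ib = (i + l.+1)%N by [].
have Eb : sg ib = b by [].
have Ec : sg ib.+1 = c by [].
pose S := rshift i l; rewrite -/S in Hr.
pose Y := root i l; pose Q m := br (x ib (m - c)) (x ib.+1 c).
pose G m m' := br (root i l.+1 m) (Q m').
have Qeq be ga : (b <= be)%N -> (c <= ga)%N ->
    eqm (be + ga) (br (x ib be) (x ib.+1 ga)) (Q (be + ga)%N).
  move=> Hbe Hga; have := @cur_next_eq ib be (ga - c); rewrite -/c subnKC // /Q addnBA //.
  by apply; lia.
have hQ m : (b + c <= m)%N -> fil m.+1 (Q m).
  move=> Hm; rewrite -(subnK (_ : c <= m)%N); last lia.
  by rewrite /Q addnK -addSn; apply: (fil_br HF); apply: (cur_fil HX); lia.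
have hY al : (S <= al)%N -> fil al.+1 (Y al) by move=> Hal; apply: root_fil; lia.
have hb be : (b <= be)%N -> fil be.+1 (x ib be) by move=> ?; apply: (cur_fil HX); lia.
have hc ga : (c <= ga)%N -> fil ga.+1 (x ib.+1 ga) by move=> ?; apply: (cur_fil HX); lia.
pose V al be ga u := br (br (br (Y al) (x ib be)) (x ib.+1 ga)) (x ib u).
have way1 al be ga u : (S <= al)%N -> (b <= be)%N -> (b <= u)%N -> (c <= ga)%N ->
    eqm (al + be + ga + u) (V al be ga u) (G (al + u) (be + ga))%N.
  move=> Hal Hbe Hu Hga.
  have E1 : eqm (al + be + ga) (br (br (Y al) (x ib be)) (x ib.+1 ga))
                               (br (Y al) (br (x ib be) (x ib.+1 ga))).
    rewrite (br_jac HF) /fil_eq addrK.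
    apply: (fil_brlE HF (a := al + ga) (b := be)); [lia | | exact: hb].
    by apply: root_far; rewrite -?/c; lia.
  apply: (eqm_trans HF (eqm_brl HF (erefl _) E1 (hb _ Hu))).
  rewrite (br_jac HF) -[G _ _]addr0; apply: (eqmD HF).
    apply: (eqm_trans HF (y := br (root i l.+1 (al + u)) (br (x ib be) (x ib.+1 ga)))).
      apply: (eqm_brl HF (a := al + u) (b := be + ga)); first lia.
        by apply: root_step => //; lia.
      by rewrite -addSn; apply: (fil_br HF); [exact: hb | exact: hc].
    apply: (eqm_brr HF (a := al + u) (b := be + ga)); [lia | | exact: Qeq].
    by apply: root_fil => //=; rewrite -/S -?/b; lia.
  rewrite eqm0; apply: (fil_brrE HF (a := al) (b := u + be + ga)); [lia | exact: hY |].
  by rewrite (brC HF); apply: (filN HF); apply: serre0 => //; lia.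
have way2 al be ga u : (S <= al)%N -> (b <= be)%N -> (b <= u)%N -> (c <= ga)%N ->
    eqm (al + be + ga + u) (V al be ga u) (- G (al + be) (u + ga))%N.
  move=> Hal Hbe Hu Hga; rewrite /V (br_jac HF) -[- G _ _]add0r.
  have Yb : eqm (al + be) (br (Y al) (x ib be)) (root i l.+1 (al + be)).
    by apply: root_step => //; lia.
  have rt : fil (al + be).+1 (root i l.+1 (al + be)).
    by apply: root_fil => //=; rewrite -/S -?/b; lia.
  have fYb : fil (al + be).+1 (br (Y al) (x ib be)).
    by rewrite -addSn; apply: (fil_br HF); [exact: hY | exact: hb].
  apply: (eqmD HF).
    rewrite eqm0; apply: (fil_brlE HF (a := al + be + u) (b := ga)); [lia | | exact: hc].
    apply: (eqm_fil HF (eqm_brl HF (erefl _) Yb (hb _ Hu))).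
    by apply: root_end => //=; rewrite -?/S -?/b; lia.
  rewrite (brC HF (x ib u)) (brNr HF); apply: (eqmN HF).
  apply: (eqm_trans HF (y := br (root i l.+1 (al + be)) (br (x ib u) (x ib.+1 ga)))).
    apply: (eqm_brl HF (a := al + be) (b := u + ga)) => //; first lia.
    by rewrite -addSn; apply: (fil_br HF); [exact: hb | exact: hc].
  by apply: (eqm_brr HF (a := al + be) (b := u + ga)); [lia | | exact: Qeq].
(* Equal degrees in the two middle factors give G (m+1) m' = - G (m+1) m'; degrees differing by one
   give G (m+1) m' = - G m (m'+1). Together they move one unit between the arguments of [G]. *)
have shift1 m m' : (S + b <= m)%N -> (b + c <= m')%N ->
    eqm (m + m').+1 (G m.+1 m') (G m m'.+1).
  move=> Hm Hm'.
  have a1 := way1 (m - b).+1 b (m' - b)%N b.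
  have a2 := way2 (m - b).+1 b (m' - b)%N b.
  have b1 := way1 (m - b)%N b (m' - b)%N b.+1.
  have b2 := way2 (m - b)%N b (m' - b)%N b.+1.
  have H1 : eqm (m + m').+1 (G m.+1 m') (- G m.+1 m').
    have E : ((m - b).+1 + b + (m' - b) + b = (m + m').+1)%N by lia.
    have E' : ((m - b).+1 + b = m.+1)%N by lia.
    have E'' : (b + (m' - b) = m')%N by lia.
    rewrite E E' E'' in a1 a2.
    apply: (eqm_trans HF (eqm_sym HF (a1 _ _ _ _))); try lia.
    by apply: a2; lia.
  have H2 : eqm (m + m').+1 (G m.+1 m') (- G m m'.+1).
    have E : ((m - b) + b + (m' - b) + b.+1 = (m + m').+1)%N by lia.
    have E' : ((m - b) + b = m)%N by lia.
    have E1 : ((m - b) + b.+1 = m.+1)%N by lia.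
    have E'' : (b + (m' - b) = m')%N by lia.
    have E2 : (b.+1 + (m' - b) = m'.+1)%N by lia.
    rewrite E E' E1 E'' E2 in b1 b2.
    apply: (eqm_trans HF (eqm_sym HF (b1 _ _ _ _))); try lia.
    by apply: b2; lia.
  apply: (eqm_trans HF H1); rewrite -[G m m'.+1]opprK; apply: (eqmN HF).
  exact: H2.
have shift m m' t : (S + b <= m)%N -> (b + c <= m')%N ->
    eqm (m + m' + t) (G (m + t) m')%N (G m (m' + t))%N.
  elim: t m m' => [|t IH] m m' Hm Hm'; first by rewrite !addn0; apply: (eqm_refl HF).
  apply: (eqm_trans HF (y := G (m + t)%N m'.+1)).
    have -> : (m + m' + t.+1 = (m + t + m').+1)%N by lia.
    by rewrite addnS; apply: shift1; lia.
  have -> : (m + m' + t.+1 = m + m'.+1 + t)%N by lia.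
  have -> : (m' + t.+1 = m'.+1 + t)%N by lia.
  by apply: IH; lia.
rewrite -/(Y _) -/(V _ _ _ _).
have Er : (r + s = r - c - b + b + c + s)%N by lia.
have v2 := way2 (r - c - b)%N b c s; have v1 := way1 (r - c - b)%N b c s.
rewrite -Er in v1 v2.
have {}v1 : eqm (r + s) (V (r - c - b)%N b c s) (G (r - c - b + b) (s + c))%N.
  apply: (eqm_trans HF (v1 _ _ _ _)); try lia.
  have := shift (r - c - b + b)%N (b + c)%N (s - b)%N.
  have -> : (r - c - b + b + (b + c) + (s - b) = r + s)%N by lia.
  have -> : (r - c - b + b + (s - b) = r - c - b + s)%N by lia.
  have -> : (b + c + (s - b) = s + c)%N by lia.
  by apply; lia.
apply: (eqm_fil HF v1); apply: (eqm_2 HF two).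
apply: (eqm_trans HF (eqm_sym HF v1)); apply: v2; lia.
Qed.

Lemma root_inside i l j r s : (i + l.+1 < n)%N -> (rshift i l <= r)%N ->
  (i <= j <= i + l)%N -> (sg j <= s)%N -> fil (r + s) (br (root i l r) (x j s)).
Proof.
move=> Hn Hr Hij Hs; have [Eji|nij] := eqVneq j i.
  rewrite Eji in Hs *; case: l Hn Hr Hij => [|l] Hn Hr Hij; last exact: root_start.
  by apply: cur_same0 => //; lia.
elim: l r Hn Hr Hij => [|l IH] r Hn Hr Hij; first lia.
have [Ejl|njl] := eqVneq j (i + l.+1)%N; first by rewrite Ejl in Hs *; apply: root_end.
case: l IH Hn Hr Hij njl => [|l] IH Hn Hr Hij njl; first lia.
have [Ejl|njl2] := eqVneq j (i + l.+1)%N; first by rewrite Ejl in Hs *; apply: root_mid.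
rewrite [root _ _ _]/= -/(root i l.+1 _) (br_jac HF); rewrite /= in Hr.
apply: (filD HF).
  apply: (fil_brlE HF (a := r - sg (i + l.+2) + s) (b := sg (i + l.+2))); first lia; last xfil.
  by apply: IH => //=; lia.
apply: (fil_brrE HF (a := r - sg (i + l.+2)) (b := sg (i + l.+2) + s)); first lia; first xfil.
by apply: (cur_far HX) => //; lia.
Qed.

Lemma root_prev i l r s : (i + l.+2 < n)%N -> (rshift i.+1 l <= r)%N -> (sg i <= s)%N ->
  eqm (s + r) (br (x i s) (root i.+1 l r)) (root i l.+1 (s + r)).
Proof.
elim: l r => [|l IH] r Hn Hr Hs.
  have := @root_step i 0 s r; rewrite /= addn1; apply => //; move: Hr => /=; lia.
rewrite [root i.+1 _ _]/= (br_jacr HF); rewrite [rshift _ _]/= in Hr.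
rewrite addSnnS in Hr *.
set c := sg (i + l.+2) in Hr *.
rewrite -[root i _ _]subr0; apply: (eqmB HF).
  rewrite [root i l.+2 _]/= -/(root i l.+1 _) -/c.
  apply: (eqm_brl HF (a := s + r - c) (b := c)); [lia | | xfil].
  by rewrite -addnBA; last lia; apply: IH => //; lia.
rewrite eqm0; apply: (fil_brlE HF (a := s + c) (b := r - c)); [lia | | xfil].
by apply: (cur_far HX) => //; lia.
Qed.

Lemma root_h i l j r s : (i + l.+1 < n)%N -> (j < n)%N -> (rshift i l <= s)%N ->
  eqm (r + s) (br (h j r) (root i l s))
    ((eps * ((j == i)%:R - (j == i + l.+1)%N%:R)) *: root i l (r + s)).
Proof.
move=> Hn Hj; elim: l s Hn => [|l IH] s Hn /= Hs.
  by rewrite addn1 in Hn *; apply: (cur_h HX).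
set c := sg (i + l.+1) in Hs *; set C := x _ c.
rewrite (br_jacr HF) (brC HF _ (br (h j r) C)) opprK.
have -> : eps * ((j == i)%:R - (j == i + l.+2)%N%:R) = eps * ((j == i)%:R - (j == i + l.+1)%N%:R)
   + eps * ((j == i + l.+1)%N%:R - (j == i + l.+2)%N%:R) by rewrite -mulrDr subrKA.
rewrite scalerDl; apply: (eqmD HF).
  rewrite -(brZl HF).
  apply: (eqm_brl HF (a := r + (s - c)) (b := c)); [lia | | xfil].
  by rewrite -addnBA; last lia; apply: IH; lia.
have hC : eqm (r + c) (br (h j r) C)
     ((eps * ((j == i + l.+1)%N%:R - (j == i + l.+2)%N%:R)) *: x (i + l.+1) (r + c)).
  by rewrite [(i + l.+2)%N]addnS; apply: (cur_h HX) => //; lia.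
apply: (eqm_trans HF (eqm_brr HF _ (_ : fil (s - c).+1 _) hC)); [lia | xfil |].
rewrite (brZr HF); apply: (eqmZ HF).
have := @root_step i l (s - c) (r + c).
have -> : (s - c + (r + c) = r + s)%N by lia.
by rewrite /= -/c; apply; lia.
Qed.
End CurrentAlgebra.


(** * One Borel half of the current algebra *)

Section Borel.
Variables (k : fieldType) (A : lmodType k) (br : A -> A -> A) (fil : nat -> A -> Prop).
Variables (n : nat) (h y : nat -> nat -> A) (sg : nat -> nat) (eps : k).
Local Notation eqm := (fil_eq fil).
Hypothesis HF : filtered_bracket br fil.
Hypothesis two : (2%:R : k) != 0.
Hypothesis HY : current_relations br fil n y h sg eps.
Local Notation rooty := (root br y sg).

(** To leading order the root vector of degree r is the bracket of [h i P] with the one of degree r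
    - P, divided by [eps]. So a negligible Cartan element makes root vectors negligible. *)
Lemma root_trunc i l P r : eps != 0 -> (i + l.+1 < n)%N -> fil P (h i P) ->
  (rshift sg i l + P <= r)%N -> fil r (rooty i l r).
Proof.
move=> e0 Hn HP Hr.
have := @root_h _ _ _ _ _ _ _ _ _ HF two HY i l i P (r - P)%N.
rewrite subnKC; last lia.
rewrite eqxx (_ : (i == _)%N = false) ?subr0 ?mulr1; last lia.
move=> /(_ Hn) H; rewrite -(scale1r (rooty _ _ _)) -(mulVf e0) -scalerA.
apply: (filZ HF); apply: (eqm_fil HF (eqm_sym HF (H _ _))); try lia.
apply: (fil_brlE HF (a := P) (b := r - P)) => //; first lia.
by apply: (root_fil HF two HY) => //; lia.
Qed.

(** The component of degree D, taken modulo [fil D], of the span of the Cartan elements and the root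
    vectors of one sign. *)
Inductive borel (D : nat) : A -> Prop :=
| borel_fil u : fil D u -> borel D u
| borel_h i : (i < n)%N -> borel D (h i D)
| borel_root i l : (i + l.+1 < n)%N -> (rshift sg i l <= D)%N -> borel D (rooty i l D)
| borelD u v : borel D u -> borel D v -> borel D (u + v)
| borelZ c u : borel D u -> borel D (c *: u).

Lemma borel_eqm D u v : eqm D u v -> borel D v -> borel D u.
Proof. by move=> H Hv; rewrite -(subrK v u); apply: borelD => //; apply: borel_fil. Qed.
Lemma borelN D u : borel D u -> borel D (- u).
Proof. by move=> H; rewrite -scaleN1r; apply: borelZ. Qed.
Lemma borelB D u v : borel D u -> borel D v -> borel D (u - v).
Proof. by move=> H Hv; apply: borelD => //; apply: borelN. Qed.

Lemma borel_bry D u j s : (j.+1 < n)%N -> (sg j <= s)%N -> borel D u ->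
  borel (D + s) (br u (y j s)).
Proof.
move=> Hj Hs; elim=> {u} [u Hu|i Hi|i l Hn Hl|u v _ Hu _ Hv|c u _ Hu].
- by apply: borel_fil; apply: (fil_br HF) => //; apply: (cur_fil HY).
- apply: borel_eqm (cur_h HY _ Hi Hj Hs) _.
  apply: borelZ; apply: (@borel_root _ j 0); first by rewrite addn1.
  by rewrite /=; lia.
- have [Hij|Hij] := boolP (i <= j <= i + l)%N.
    by apply: borel_fil; apply: (root_inside HF two HY).
  have [Eji|nji] := eqVneq j (i + l.+1)%N.
    rewrite Eji in Hs *; apply: borel_eqm (root_step HF two HY _ Hl Hs) _; first lia.
    by apply: borel_root => /=; lia.
  have [Eji'|nji'] := eqVneq i j.+1.
    rewrite Eji' in Hn Hl *; rewrite (brC HF); apply: borelN.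
    apply: borel_eqm.
      by rewrite addnC; apply: (root_prev HF two HY); first lia.
    rewrite addnC; apply: borel_root; first lia.
    have rs i0 : rshift sg i0 l.+1 = (sg i0 + rshift sg i0.+1 l)%N.
      by elim: l {Hn Hl Hij nji} => [|l IH]; rewrite /= ?addn1 // addSnnS addnA -IH.
    rewrite rs; lia.
  by apply: borel_fil; apply: (root_far HF two HY) => //; lia.
- by rewrite (brDl HF); apply: borelD.
- by rewrite (brZl HF); apply: borelZ.
Qed.

Variables (x : nat -> nat -> A) (sx : nat -> nat).
Hypothesis Hyx : forall i j r s, (i.+1 < n)%N -> (j.+1 < n)%N -> (sg i <= r)%N ->
  (sx j <= s)%N -> borel (r + s) (br (y i r) (x j s)).

Lemma root_brx i l j r s : (i + l.+1 < n)%N -> (j.+1 < n)%N -> (rshift sg i l <= r)%N ->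
  (sx j <= s)%N -> borel (r + s) (br (rooty i l r) (x j s)).
Proof.
move=> Hn Hj; elim: l r Hn => [|l IH] r Hn /= Hr Hs; first by apply: Hyx => //; lia.
set c := sg (i + l.+1) in Hr *.
rewrite (br_jac HF); apply: borelD.
  have -> : (r + s = r - c + s + c)%N by lia.
  by apply: borel_bry => //; [lia | apply: IH => //; lia].
rewrite (brC HF); apply: borelN.
(* By Jacobi a bracket with a root vector is a combination of iterated brackets with simple
   generators. *)
have gen D u : borel D u -> borel (D + (r - c)) (br u (rooty i l (r - c))).
  have: (rshift sg i l <= r - c)%N by lia.
  have: (i + l.+1 < n)%N by lia.
  elim: (l) (r - c)%N D u => [|m IHm] t D u Hm /= Ht Hu.
    by apply: borel_bry => //; lia.
  rewrite (br_jacr HF); set e := sg (i + m.+1) in Ht *.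
  apply: borelB.
    have -> : (D + t = D + (t - e) + e)%N by lia.
    by apply: borel_bry; [lia | lia | apply: IHm => //; lia].
  have -> : (D + t = D + e + (t - e))%N by lia.
  by apply: IHm; [lia | lia | apply: borel_bry => //; lia].
have -> : (r + s = c + s + (r - c))%N by lia.
by apply: gen; apply: Hyx => //; lia.
Qed.
End Borel.

(** * Both Borel halves together: closure under brackets and truncation *)

Section Reductive.
Variables (k : fieldType) (A : lmodType k) (br : A -> A -> A) (fil : nat -> A -> Prop).
Variables (n : nat) (p : nat -> nat) (h x y : nat -> nat -> A) (sx sy : nat -> nat).
Local Notation eqm := (fil_eq fil).
Hypothesis HF : filtered_bracket br fil.
Hypothesis two : (2%:R : k) != 0.
Hypothesis HX : current_relations br fil n x h sx 1.
Hypothesis HY : current_relations br fil n y h sy (-1).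
Hypothesis Hxy : forall i j r s, (i.+1 < n)%N -> (j.+1 < n)%N -> (sx i <= r)%N ->
  (sy j <= s)%N ->
  eqm (r + s) (br (x i r) (y j s)) (if i == j then h i (r + s) - h i.+1 (r + s) else 0).
Local Notation rootx := (root br x sx).
Local Notation rooty := (root br y sy).
Local Notation lowx := (borel br fil n h x sx).
Local Notation lowy := (borel br fil n h y sy).

Lemma brxy_low i j r s : (i.+1 < n)%N -> (j.+1 < n)%N -> (sx i <= r)%N ->
  (sy j <= s)%N -> lowx (r + s) (br (x i r) (y j s)).
Proof.
move=> Hi Hj Hr Hs; apply: borel_eqm (Hxy Hi Hj Hr Hs) _; case: eqP => _.
  by apply: borelB; apply: borel_h; lia.
by apply: borel_fil; apply: (fil0 HF).
Qed.
Lemma bryx_low i j r s : (i.+1 < n)%N -> (j.+1 < n)%N -> (sy i <= r)%N ->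
  (sx j <= s)%N -> lowy (r + s) (br (y i r) (x j s)).
Proof.
move=> Hi Hj Hr Hs; rewrite (brC HF) addnC; apply: borelN.
apply: borel_eqm (Hxy Hj Hi Hs Hr) _; case: eqP => _.
  by apply: borelB; apply: borel_h; lia.
by apply: borel_fil; apply: (fil0 HF).
Qed.

(** The Cartan part occurs in both summands. This span is stable under brackets with simple
    generators of both signs, hence by Jacobi with all root vectors. *)
Definition lie_span (D : nat) (u : A) : Prop :=
  exists v w, [/\ lowx D v, lowy D w & u = v + w].

Lemma lie_spanx D u : lowx D u -> lie_span D u.
Proof.
by move=> H; exists u, 0; rewrite addr0; split => //; apply: borel_fil; apply: (fil0 HF).
Qed.
Lemma lie_spany D u : lowy D u -> lie_span D u.
Proof.
by move=> H; exists 0, u; rewrite add0r; split => //; apply: borel_fil; apply: (fil0 HF).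
Qed.
Lemma lie_spanD D u v : lie_span D u -> lie_span D v -> lie_span D (u + v).
Proof.
move=> [a [b [Ha Hb ->]]] [c [d [Hc Hd ->]]]; exists (a + c), (b + d).
by split; [apply: borelD | apply: borelD | rewrite addrACA].
Qed.
Lemma lie_spanZ D c u : lie_span D u -> lie_span D (c *: u).
Proof.
move=> [a [b [Ha Hb ->]]]; exists (c *: a), (c *: b).
by split; [apply: borelZ | apply: borelZ | rewrite scalerDr].
Qed.
Lemma lie_spanB D u v : lie_span D u -> lie_span D v -> lie_span D (u - v).
Proof. by move=> Hu Hv; apply: lie_spanD => //; rewrite -scaleN1r; apply: lie_spanZ. Qed.

Lemma lie_span_brx D u j s : (j.+1 < n)%N -> (sx j <= s)%N -> lie_span D u ->
  lie_span (D + s) (br u (x j s)).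
Proof.
move=> Hj Hs [v [w [Hv Hw ->]]]; rewrite (brDl HF); apply: lie_spanD.
  by apply: lie_spanx; apply: (borel_bry HF two HX).
elim: Hw => {w} [w Hw|i Hi|i l Hn Hl|a b _ Ha _ Hb|c a _ Ha].
- by apply: lie_spanx; apply: (borel_bry HF two HX) => //; apply: borel_fil.
- by apply: lie_spanx; apply: (borel_bry HF two HX) => //; apply: borel_h.
- by apply: lie_spany; apply: (root_brx HF two HY bryx_low).
- by rewrite (brDl HF); apply: lie_spanD.
- by rewrite (brZl HF); apply: lie_spanZ.
Qed.

Lemma lie_span_bry D u j s : (j.+1 < n)%N -> (sy j <= s)%N -> lie_span D u ->
  lie_span (D + s) (br u (y j s)).
Proof.
move=> Hj Hs [v [w [Hv Hw ->]]]; rewrite (brDl HF); apply: lie_spanD; last first.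
  by apply: lie_spany; apply: (borel_bry HF two HY).
elim: Hv => {v} [v Hv|i Hi|i l Hn Hl|a b _ Ha _ Hb|c a _ Ha].
- by apply: lie_spany; apply: (borel_bry HF two HY) => //; apply: borel_fil.
- by apply: lie_spany; apply: (borel_bry HF two HY) => //; apply: borel_h.
- by apply: lie_spanx; apply: (root_brx HF two HX brxy_low).
- by rewrite (brDl HF); apply: lie_spanD.
- by rewrite (brZl HF); apply: lie_spanZ.
Qed.

Lemma lie_span_rootx D u i l r : (i + l.+1 < n)%N -> (rshift sx i l <= r)%N ->
  lie_span D u -> lie_span (D + r) (br u (rootx i l r)).
Proof.
elim: l r D u => [|l IH] r D u Hn /= Hr Hu; first by apply: lie_span_brx => //; lia.
rewrite (br_jacr HF); set e := sx (i + l.+1) in Hr *; apply: lie_spanB.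
  have -> : (D + r = D + (r - e) + e)%N by lia.
  by apply: lie_span_brx; [lia | lia | apply: IH => //; lia].
have -> : (D + r = D + e + (r - e))%N by lia.
by apply: IH; [lia | lia | apply: lie_span_brx => //; lia].
Qed.

Lemma lie_span_rooty D u i l r : (i + l.+1 < n)%N -> (rshift sy i l <= r)%N ->
  lie_span D u -> lie_span (D + r) (br u (rooty i l r)).
Proof.
elim: l r D u => [|l IH] r D u Hn /= Hr Hu; first by apply: lie_span_bry => //; lia.
rewrite (br_jacr HF); set e := sy (i + l.+1) in Hr *; apply: lie_spanB.
  have -> : (D + r = D + (r - e) + e)%N by lia.
  by apply: lie_span_bry; [lia | lia | apply: IH => //; lia].
have -> : (D + r = D + e + (r - e))%N by lia.
by apply: IH; [lia | lia | apply: lie_span_bry => //; lia].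
Qed.

Hypothesis Hhh : forall i j r s, (i < n)%N -> (j < n)%N -> fil (r + s) (br (h i r) (h j s)).

Lemma lie_span_h D u i r : (i < n)%N -> lie_span D u -> lie_span (D + r) (br u (h i r)).
Proof.
have hfil v : fil D v -> (i < n)%N -> fil (D + r) (br v (h i r)).
  by move=> Hv Hi; apply: (fil_br HF) => //; apply: (cur_hfil HX).
have gen z s e (HZ : current_relations br fil n z h s e) v : (i < n)%N ->
    borel br fil n h z s D v -> borel br fil n h z s (D + r) (br v (h i r)).
  move=> Hi; elim=> {v} [v Hv|j Hj|j l Hn Hl|a b _ Ha _ Hb|c a _ Ha].
  - by apply: borel_fil; apply: hfil.
  - by apply: borel_fil; apply: Hhh.
  - rewrite (brC HF) addnC; apply: borelN.
    apply: borel_eqm (root_h HF two HZ _ Hn Hi Hl) _; apply: borelZ.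
    by apply: borel_root => //; lia.
  - by rewrite (brDl HF); apply: borelD.
  - by rewrite (brZl HF); apply: borelZ.
move=> Hi [v [w [Hv Hw ->]]]; rewrite (brDl HF); apply: lie_spanD.
  by apply: lie_spanx; apply: gen HX _ _ _.
by apply: lie_spany; apply: gen HY _ _ _.
Qed.

Hypothesis p_shift : forall i, (i.+1 < n)%N -> p i.+1 = (p i + sx i)%N.
Hypothesis sy0 : forall i, sy i = 0%N.
Hypothesis h_trunc0 : forall r, (0 < n)%N -> (p 0 <= r)%N -> fil r (h 0 r).

(** Only row 0 is truncated by hypothesis. If h_i^r is negligible for r >= p_i, then [root_trunc]
    makes x_i^r negligible for r >= p_i + sx i = p_{i+1}, and [x_i^r, y_i^0] = h_i^r - h_{i+1}^r
    carries this to row i + 1. *)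
Lemma h_trunc i r : (i < n)%N -> (p i <= r)%N -> fil r (h i r).
Proof.
elim: i r => [|i IH] r Hi Hr; first exact: h_trunc0.
rewrite p_shift // in Hr.
have Hx : fil r (x i r).
  have := @root_trunc _ _ _ _ _ _ _ _ _ HF two HX i 0 (p i) r; rewrite /=; apply; try lia.
    exact: oner_neq0.
  by apply: IH; lia.
have := @Hxy i i r 0; rewrite addn0 eqxx sy0 => H.
have Hb : fil r (br (x i r) (y i 0)).
  rewrite -(addn0 r); apply: (fil_br HF) => //; first by rewrite addn0.
  by apply: (cur_fil HY) => //; rewrite sy0.
have Hd : fil r (h i r - h i.+1 r).
  by apply: (eqm_fil HF (eqm_sym HF (H _ _ _ _))) => //; lia.
rewrite -[h i.+1 r](subKr (h i r)); apply: (filB HF) => //.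
by apply: IH; lia.
Qed.

Lemma rootx_trunc i l r : (i + l.+1 < n)%N -> (rshift sx i l + p i <= r)%N -> fil r (rootx i l r).
Proof.
move=> Hn; apply: (root_trunc HF two HX) => //; first exact: oner_neq0.
by apply: h_trunc => //; lia.
Qed.
Lemma rooty_trunc i l r : (i + l.+1 < n)%N -> (rshift sy i l + p i <= r)%N -> fil r (rooty i l r).
Proof.
move=> Hn; apply: (root_trunc HF two HY) => //; first by rewrite oppr_eq0 oner_neq0.
by apply: h_trunc => //; lia.
Qed.

Variables (I : finType) (Z : I -> A) (deg : I -> nat).
Hypothesis Zh : forall i D, (i < n)%N -> (D < p i)%N -> exists a, Z a = h i D /\ deg a = D.
Hypothesis Zx : forall i l D, (i + l.+1 < n)%N -> (rshift sx i l <= D < rshift sx i l + p i)%N ->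
  exists a, Z a = rootx i l D /\ deg a = D.
Hypothesis Zy : forall i l D, (i + l.+1 < n)%N -> (rshift sy i l <= D < rshift sy i l + p i)%N ->
  exists a, Z a = rooty i l D /\ deg a = D.
Hypothesis Zcases : forall a,
  [\/ exists2 i, (i < n)%N & Z a = h i (deg a),
      exists i l, [/\ (i + l.+1 < n)%N, (rshift sx i l <= deg a)%N & Z a = rootx i l (deg a)] |
      exists i l, [/\ (i + l.+1 < n)%N, (rshift sy i l <= deg a)%N & Z a = rooty i l (deg a)]].

Definition zcomb D u := exists c : I -> k, fil D (u - \sum_(a | deg a == D) c a *: Z a).

(** A Cartan element or root vector of degree D is either one of the finitely many [Z], or lies
    beyond its truncation bound and is negligible. *)
Lemma lie_span_zcomb D u : lie_span D u -> zcomb D u.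
Proof.
have zfil v : fil D v -> zcomb D v.
  move=> Hv; exists (fun=> 0); rewrite big1 ?subr0 // => a _; exact: scale0r.
have zZ a : deg a = D -> zcomb D (Z a).
  move=> Ha; exists (fun b => (b == a)%:R); rewrite (bigD1 a) ?Ha //= eqxx scale1r.
  rewrite big1 ?addr0 ?subrr; first exact: (fil0 HF).
  by move=> b /andP [_ /negbTE ->]; rewrite scale0r.
have zD v w : zcomb D v -> zcomb D w -> zcomb D (v + w).
  move=> [c Hc] [c' Hc']; exists (fun a => c a + c' a).
  rewrite (eq_bigr (fun a => c a *: Z a + c' a *: Z a)); last by move=> a _; rewrite scalerDl.
  by rewrite big_split /= opprD addrACA; apply: (filD HF).
have zsc t v : zcomb D v -> zcomb D (t *: v).
  move=> [c Hc]; exists (fun a => t * c a).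
  rewrite (eq_bigr (fun a => t *: (c a *: Z a))); last by move=> a _; rewrite scalerA.
  by rewrite -scaler_sumr -scalerBr; apply: (filZ HF).
move=> [v [w [Hv Hw ->]]]; apply: (zD _ _ _ _).
  elim: Hv => [u0 H|i Hi|i l Hn Hl|a b _ Ha _ Hb|c a _ Ha]; [exact: zfil| | |exact: zD|exact: zsc].
    case: (leqP (p i) D) => H; first by apply: zfil; apply: h_trunc.
    by have [a [<- /zZ]] := Zh Hi H.
  case: (leqP (rshift sx i l + p i) D) => H; first by apply: zfil; apply: rootx_trunc.
  by have [|a [<- /zZ]] := Zx (D := D) Hn; first by rewrite Hl H.
elim: Hw => [u0 H|i Hi|i l Hn Hl|a b _ Ha _ Hb|c a _ Ha]; [exact: zfil| | |exact: zD|exact: zsc].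
  case: (leqP (p i) D) => H; first by apply: zfil; apply: h_trunc.
  by have [a [<- /zZ]] := Zh Hi H.
case: (leqP (rshift sy i l + p i) D) => H; first by apply: zfil; apply: rooty_trunc.
by have [|a [<- /zZ]] := Zy (D := D) Hn; first by rewrite Hl H.
Qed.

Lemma Z_lie_span a : lie_span (deg a) (Z a).
Proof.
case: (Zcases a) => [[i Hi ->]|[i [l [Hn Hl ->]]]|[i [l [Hn Hl ->]]]].
- by apply: lie_spanx; apply: borel_h.
- by apply: lie_spanx; apply: borel_root.
- by apply: lie_spany; apply: borel_root.
Qed.

Lemma Z_br a b : zcomb (deg a + deg b) (br (Z a) (Z b)).
Proof.
apply: lie_span_zcomb.
case: (Zcases b) => [[i Hi ->]|[i [l [Hn Hl ->]]]|[i [l [Hn Hl ->]]]].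
- by apply: lie_span_h => //; apply: Z_lie_span.
- by apply: lie_span_rootx => //; apply: Z_lie_span.
- by apply: lie_span_rooty => //; apply: Z_lie_span.
Qed.

Lemma zcomb_h i D : (i < n)%N -> zcomb D (h i D).
Proof. by move=> Hi; apply: lie_span_zcomb; apply: lie_spanx; apply: borel_h. Qed.
Lemma zcomb_x i D : (i.+1 < n)%N -> (sx i <= D)%N -> zcomb D (x i D).
Proof.
move=> Hi HD; apply: lie_span_zcomb; apply: lie_spanx.
by apply: (@borel_root _ _ _ _ _ _ _ _ _ i 0) => //; lia.
Qed.
Lemma zcomb_y i D : (i.+1 < n)%N -> (sy i <= D)%N -> zcomb D (y i D).
Proof.
move=> Hi HD; apply: lie_span_zcomb; apply: lie_spany.
by apply: (@borel_root _ _ _ _ _ _ _ _ _ i 0) => //; lia.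
Qed.
End Reductive.

(** * Growth of filtered algebras *)


Section Span.
Variables (k : fieldType) (V : lmodType k) (T : Type) (F : T -> V).

Definition fspan (P : pred T) (x : V) : Prop :=
  exists l : seq (k * T), all (fun t => P t.2) l /\ x = \sum_(t <- l) t.1 *: F t.2.

Lemma fspan_in (P : pred T) t : P t -> fspan P (F t).
Proof. by move=> Ht; exists [:: (1, t)]; rewrite /= Ht big_seq1 scale1r. Qed.
Lemma fspan0 P : fspan P 0.
Proof. by exists [::]; rewrite big_nil. Qed.
Lemma fspanD P x y : fspan P x -> fspan P y -> fspan P (x + y).
Proof.
by move=> [l [Hl ->]] [m [Hm ->]]; exists (l ++ m); rewrite all_cat Hl Hm big_cat.
Qed.
Lemma fspanZ P c x : fspan P x -> fspan P (c *: x).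
Proof.
move=> [l [Hl ->]]; exists [seq (c * t.1, t.2) | t <- l]; split; first by rewrite all_map.
by rewrite scaler_sumr big_map; apply: eq_bigr => t _; rewrite scalerA.
Qed.
Lemma fspanN P x : fspan P x -> fspan P (- x).
Proof. by move=> H; rewrite -scaleN1r; apply: fspanZ. Qed.
Lemma fspan_sum P (J : Type) (r : seq J) (Q : pred J) (f : J -> V) :
  (forall t, Q t -> fspan P (f t)) -> fspan P (\sum_(t <- r | Q t) f t).
Proof. by move=> H; apply: big_ind => //; [apply: fspan0 | apply: fspanD]. Qed.
Lemma fspan_sub (P Q : pred T) x : (forall s, P s -> Q s) -> fspan P x -> fspan Q x.
Proof. by move=> H [l [Hl ->]]; exists l; split => //; apply: sub_all Hl => t; apply: H. Qed.
Lemma fspan_fin (P : pred T) m (y : 'I_m -> V) x : (forall t, P t -> exists j, F t = y j) ->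
  fspan P x -> exists c : 'I_m -> k, x = \sum_j c j *: y j.
Proof.
move=> H [l [Hl ->]]; elim: l Hl => [|t l IH] /= Hl.
  by exists (fun=> 0); rewrite big_nil big1 // => j _; rewrite scale0r.
case/andP: Hl => /H [j Hj] /IH [c Hc].
exists (fun i => (i == j)%:R * t.1 + c i).
rewrite big_cons Hc Hj; under [RHS]eq_bigr => i _ do rewrite scalerDl.
rewrite big_split /=; congr (_ + _); rewrite (bigD1 j) //= eqxx mul1r big1 ?addr0 //.
by move=> i /negbTE ->; rewrite mul0r scale0r.
Qed.
End Span.

Lemma fspan_trans (k : fieldType) (V : lmodType k) (T U : Type) (F : T -> V) (G : U -> V)
  (P : pred T) (Q : pred U) x :
  (forall t, P t -> fspan G Q (F t)) -> fspan F P x -> fspan G Q x.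
Proof.
move=> H [l [Hl ->]]; elim: l Hl => [|t l IH] /= Hl; first by rewrite big_nil; apply: fspan0.
case/andP: Hl => Ht Hl; rewrite big_cons; apply: fspanD; last exact: IH.
by apply: fspanZ; apply: H.
Qed.
Lemma fspan_linear (k : fieldType) (V W : lmodType k) (f : V -> W) (T : Type) (F : T -> V)
  (P : pred T) x : (forall c y z, f (c *: y + z) = c *: f y + f z) ->
  fspan F P x -> fspan (f \o F) P (f x).
Proof.
move=> Hf [l [Hl ->]]; exists l; split => //; elim: l {Hl} => [|t l IH].
  by have := Hf (-1) 0 0; rewrite !big_nil scaler0 addr0 scaleN1r addNr.
by rewrite !big_cons Hf IH.
Qed.

Section Words.
Variables (k : fieldType) (A : algType k) (I : finType) (Z : I -> A).

Definition wprod (s : seq I) : A := \prod_(a <- s) Z a.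

Local Notation wspan := (fspan wprod).

Lemma wprod_cat s t : wprod (s ++ t) = wprod s * wprod t.
Proof. exact: big_cat. Qed.
Lemma wprod_nil : wprod [::] = 1.
Proof. exact: big_nil. Qed.
Lemma wprod1 a : wprod [:: a] = Z a.
Proof. exact: big_seq1. Qed.
Lemma wspanM (P Q R : pred (seq I)) x y : (forall s t, P s -> Q t -> R (s ++ t)) ->
  wspan P x -> wspan Q y -> wspan R (x * y).
Proof.
move=> H [l [/allP Hl ->]] [m [/allP Hm ->]].
rewrite mulr_suml big_seq; apply: fspan_sum => s Hs.
rewrite mulr_sumr big_seq; apply: fspan_sum => t Ht.
rewrite -scalerAl -scalerAr -wprod_cat; do 2!apply: fspanZ.
by apply: fspan_in; apply: H; [apply: Hl | apply: Hm].
Qed.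
Lemma wspan_bound (P : pred (seq I)) x : wspan P x ->
  exists m, wspan (fun s => P s && (size s <= m))%N x.
Proof.
move=> [l [Hl ->]]; exists (\max_(t <- l) size t.2)%N, l; split => //.
apply/allP => t Ht; rewrite (allP Hl _ Ht) /=.
by rewrite (big_rem t) //= leq_maxl.
Qed.
End Words.
Notation wspan Z := (fspan (wprod Z)).

Section WordFiltration.
Variables (k : fieldType) (A : algType k) (gen : nat -> A -> Prop).

(** The smallest multiplicative filtration in which [gen r] has degree at most r. With the
    convention degree less than D, the unit enters at index 1, and index 0 contains only zero, which
    grounds inductions on D. *)
Inductive wfil : nat -> A -> Prop :=
| wfil0 D : wfil D 0
| wfil1 : wfil 1 1
| wfil_gen r x : gen r x -> wfil r.+1 x
| wfilD D x y : wfil D x -> wfil D y -> wfil D (x + y)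
| wfilZ D c x : wfil D x -> wfil D (c *: x)
| wfilM a b x y : wfil a.+1 x -> wfil b.+1 y -> wfil (a + b).+1 (x * y)
| wfilS D x : wfil D x -> wfil D.+1 x.

Lemma wfil_eq0 x : wfil 0 x -> x = 0.
Proof.
move E: 0%N => D H; elim: H E => // {D x}.
- by move=> D x y _ Hx _ Hy E; rewrite Hx // Hy // addr0.
- by move=> D c x _ Hx E; rewrite Hx // scaler0.
Qed.
Lemma wfil_le D E x : (D <= E)%N -> wfil D x -> wfil E x.
Proof.
move=> /subnK <-; elim: (E - D)%N => // m IH Hx.
by rewrite addSn; apply: wfilS; apply: IH.
Qed.
Lemma wfilN D x : wfil D x -> wfil D (- x).
Proof. by move=> H; rewrite -scaleN1r; apply: wfilZ. Qed.
Lemma wfilB D x y : wfil D x -> wfil D y -> wfil D (x - y).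
Proof. by move=> Hx Hy; apply: wfilD => //; apply: wfilN. Qed.
Lemma wfil_mull a b x y : wfil a x -> wfil b.+1 y -> wfil (a + b) (x * y).
Proof.
case: a => [|a] Hx Hy; last exact: wfilM.
by rewrite (wfil_eq0 Hx) mul0r; apply: wfil0.
Qed.
Lemma wfil_mulr a b x y : wfil a.+1 x -> wfil b y -> wfil (a + b) (x * y).
Proof.
case: b => [|b] Hx Hy; last by rewrite addnS; apply: wfilM.
by rewrite (wfil_eq0 Hy) mulr0; apply: wfil0.
Qed.

Lemma wfil_sum D (T : Type) (r : seq T) (Q : pred T) (F : T -> A) :
  (forall t, Q t -> wfil D (F t)) -> wfil D (\sum_(t <- r | Q t) F t).
Proof. by move=> H; apply: big_ind => //; [apply: wfil0 | apply: wfilD]. Qed.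

Lemma wfil_bracket : filtered_bracket (fun x y : A => x * y - y * x) wfil.
Proof.
split.
- by move=> x y z; rewrite mulrDl mulrDr opprD addrACA.
- by move=> c x z; rewrite -scalerAl -scalerAr -scalerBr.
- by move=> x y; rewrite opprB.
- move=> x y z; rewrite !mulrBl !mulrBr !mulrA !opprB.
  by rewrite [RHS](AC ((2*2)*(2*2)) (((((((5*4)*7)*2)*1)*6)*3)*8))%AC /= !addrK addrA.
- exact: wfil0.
- exact: wfilD.
- exact: wfilZ.
- exact: wfilS.
- move=> a b x y Hx Hy; apply: wfilD; first exact: wfil_mull.
  by apply: wfilN; rewrite addnC; apply: wfil_mulr.
Qed.
End WordFiltration.

Definition wsum (I : finType) (wt : I -> nat) (s : seq I) : nat := (\sum_(a <- s) wt a)%N.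

Lemma wsum_cat (I : finType) (wt : I -> nat) s t : wsum wt (s ++ t) = (wsum wt s + wsum wt t)%N.
Proof. exact: big_cat. Qed.

Lemma wsum_cons (I : finType) (wt : I -> nat) a s : wsum wt (a :: s) = (wt a + wsum wt s)%N.
Proof. exact: big_cons. Qed.
Lemma wsum_nil (I : finType) (wt : I -> nat) : wsum wt [::] = 0%N.
Proof. exact: big_nil. Qed.
Definition wsumE := (wsum_cat, wsum_cons, wsum_nil).

Section FiltrationSpan.
Variables (k : fieldType) (A : algType k) (gen : nat -> A -> Prop).
Variables (I : finType) (Z : I -> A) (deg : I -> nat).
Local Notation zc := (zcomb (wfil gen) Z deg).

Hypothesis Hgen : forall r g, gen r g -> zc r g.

(** Strong induction on D: a generator of degree r is a combination of the [Z] of degree r plus a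
    remainder in [wfil r], already treated. *)
Lemma wfil_wspan D x : wfil gen D x -> wspan Z (fun s => wsum deg s < D)%N x.
Proof.
elim/ltn_ind: D x => D IH x Hx.
suff H : forall E y, wfil gen E y -> (E <= D)%N -> wspan Z (fun s => wsum deg s < E)%N y.
  exact: H.
move=> {x Hx} E y; elim=> {E y}.
- by move=> E _; apply: fspan0.
- by move=> _; rewrite -(wprod_nil Z); apply: fspan_in; rewrite /wsum big_nil.
- move=> r g /Hgen [c Hc] Hr; rewrite -(subrK (\sum_(a | deg a == r) c a *: Z a) g).
  apply: fspanD; first by apply: fspan_sub (IH _ Hr _ Hc) => s; lia.
  apply: fspan_sum => a /eqP Ha; apply: fspanZ.
  rewrite -(wprod1 Z a); apply: fspan_in.
  by rewrite /wsum big_seq1 Ha.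
- by move=> E u v _ Hu _ Hv HE; apply: fspanD; [exact: Hu | exact: Hv].
- by move=> E c u _ Hu HE; apply: fspanZ; exact: Hu.
- move=> a b u v _ Hu _ Hv HE; apply: wspanM (Hu _) (Hv _); try lia.
  by move=> s t; rewrite wsum_cat; lia.
- by move=> E u _ Hu HE; apply: fspan_sub (Hu _); [move=> s; lia | lia].
Qed.

Hypothesis Hbr : forall a b, zc (deg a + deg b) (Z a * Z b - Z b * Z a).

(* A word of small filtration degree may be long; the weight [lam * deg + 1] with
   [lam] at least the length of all words occurring in the finitely many commutators
   makes the associated graded algebra commutative. *)
Lemma commuting_weights : exists wt : I -> nat, (forall a, 0 < wt a)%N /\
  forall a b, wspan Z (fun s => wsum wt s < wt a + wt b)%N (Z a * Z b - Z b * Z a).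
Proof.
have Hab : forall ab : I * I, exists m, exists c : I -> k,
    wspan Z (fun s => (wsum deg s < deg ab.1 + deg ab.2) && (size s <= m))%N
      (Z ab.1 * Z ab.2 - Z ab.2 * Z ab.1 - \sum_(a | deg a == (deg ab.1 + deg ab.2)%N) c a *: Z a).
  move=> [a b] /=; have [c /wfil_wspan /wspan_bound [m Hm]] := Hbr a b.
  by exists m, c.
have [mm Hmm] := fin_all_exists Hab.
pose lam := (\max_ab mm ab)%N.
have wtE s : wsum (fun a => lam * deg a + 1)%N s = (lam * wsum deg s + size s)%N.
  rewrite /wsum; elim: s => [|a s IHs]; first by rewrite !big_nil muln0.
  by rewrite !big_cons IHs /=; lia.
exists (fun a => lam * deg a + 1)%N; split; first by move=> a; lia.
move=> a b; have [c Hc] := Hmm (a, b); rewrite /= in Hc.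
rewrite -(subrK (\sum_(d | deg d == (deg a + deg b)%N) c d *: Z d) (Z a * _ - _)).
apply: fspanD.
  apply: fspan_sub Hc => s /andP [H1 H2]; rewrite wtE.
  have H3 : (mm (a, b) <= lam)%N by apply: leq_bigmax.
  have : (lam * (wsum deg s).+1 <= lam * (deg a + deg b))%N by rewrite leq_mul2l H1 orbT.
  by rewrite mulnS mulnDr; lia.
apply: fspan_sum => d /eqP Hd; apply: fspanZ.
rewrite -(wprod1 Z d); apply: fspan_in.
by rewrite wtE /wsum big_seq1 Hd /=; lia.
Qed.
End FiltrationSpan.

Lemma indep_span_le (k : fieldType) (B : lmodType k) (q m : nat) (u : 'I_q -> B) (y : 'I_m -> B) :
  (forall i, exists c : 'I_m -> k, u i = \sum_j c j *: y j) ->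
  (forall c : 'I_q -> k, \sum_i c i *: u i = 0 -> forall i, c i = 0) -> (q <= m)%N.
Proof.
move=> /fin_all_exists [c Hc] Hind; rewrite leqNgt; apply/negP => Hmq.
pose M := \matrix_(i < q, j < m) c i j.
have Hk : kermx M != 0.
  rewrite -mxrank_eq0 mxrank_ker; have := rank_leq_col M; lia.
have [i Hi] : exists i, row i (kermx M) != 0.
  apply/existsP; apply: contraNT Hk; rewrite negb_exists => /forallP H.
  by apply/eqP/row_matrixP => i; move: (H i); rewrite negbK row0 => /eqP.
have HM : row i (kermx M) *m M = 0 by rewrite -row_mul mulmx_ker row0.
case/eqP: Hi; apply/rowP => j; rewrite [RHS]mxE.
apply: (Hind (fun j => row i (kermx M) 0 j)).
under eq_bigr => i0 _ do rewrite Hc scaler_sumr.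
rewrite exchange_big /= big1 // => j0 _.
under eq_bigr => i0 _ do rewrite scalerA.
rewrite -scaler_suml.
transitivity ((row i (kermx M) *m M) 0 j0 *: y j0); last by rewrite HM mxE scale0r.
by congr (_ *: _); rewrite [RHS]mxE; apply: eq_bigr => i0 _; rewrite [M _ _]mxE.
Qed.


Lemma seq_argmax (T : eqType) (f : T -> nat) (s : seq T) : s != [::] ->
  exists2 x, x \in s & forall y, y \in s -> (f y <= f x)%N.
Proof.
elim: s => // x s IH _; have [->|/IH [y ys Hy]] := eqVneq s [::].
  by exists x; rewrite ?mem_head // => y; rewrite inE => /eqP ->.
case: (leqP (f x) (f y)) => Hxy.
  by exists y; rewrite ?inE ?ys ?orbT // => z; rewrite inE => /orP [/eqP ->|/Hy].
exists x; rewrite ?mem_head // => z; rewrite inE => /orP [/eqP ->|/Hy] //.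
lia.
Qed.

(** * Exponent vectors: an additive order and a count *)

Section Exponents.
Variables (I : finType) (M : nat).

Definition expnt : choiceType := {ffun I -> nat}.
Definition eadd (al be : expnt) : expnt := [ffun a => al a + be a]%N.
Definition ele (al be : expnt) : bool := [forall a, al a <= be a]%N.
(** The exponents read as digits in base M. The value is additive on all exponents and injective on
    those with entries below M, so it breaks ties in an order compatible with multiplication of
    monomials. *)
Definition base (al : expnt) : nat := foldr (fun a acc => al a + M * acc)%N 0%N (enum I).

Lemma base_add al be : base (eadd al be) = (base al + base be)%N.
Proof. by rewrite /base; elim: (enum I) => //= a s ->; rewrite /eadd ffunE mulnDr addnACA. Qed.

Lemma base_inj (al be : expnt) : (forall a, al a < M)%N -> (forall a, be a < M)%N ->
  base al = base be -> al = be.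
Proof.
move=> Ha Hb H; apply/ffunP => a.
have : a \in enum I by rewrite mem_enum.
move: H; rewrite /base; elim: (enum I) => //= b s IH H.
have E : al b = be b.
  have := congr1 (modn^~ M) H.
  by rewrite ![(_ + M * _)%N]addnC !(mulnC M) !modnMDl !modn_small.
rewrite inE => /orP [/eqP ->|]; first exact: E.
apply: IH; move: H; rewrite E => /eqP; rewrite eqn_add2l eqn_mul2l => /orP [/eqP M0|/eqP //].
by have := Ha b; rewrite M0.
Qed.

Lemma card_coord_eq D (a : I) (j : nat) :
  (#|[set g : {ffun I -> 'I_D.+1} | g a == j :> nat]| <= D.+1 ^ #|I|.-1)%N.
Proof.
pose F (b : I) : {pred 'I_D.+1} := fun z => (b != a) || (z == j :> nat).
have -> : #|[set g : {ffun I -> 'I_D.+1} | g a == j :> nat]| = #|family F|.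
  apply: eq_card => g; rewrite inE; apply/idP/familyP => [H b|/(_ a)].
    by rewrite unfold_in; have [->|//] := eqVneq b a; rewrite H orbT.
  by rewrite unfold_in eqxx.
rewrite card_family foldrE big_map big_enum /= (bigD1 a) //=.
have H1 : (#|F a| <= 1)%N.
  apply/card_le1_eqP => x y; rewrite !unfold_in eqxx /= => /eqP Hx /eqP Hy.
  by apply: val_inj; rewrite /= Hx Hy.
apply: leq_trans (leq_mul H1 (leqnn _)) _; rewrite mul1n.
rewrite (eq_bigr (fun=> D.+1)); last first.
  move=> b Hb; rewrite -[RHS](card_ord D.+1); apply: eq_card => z.
  by rewrite unfold_in Hb.
by rewrite prod_nat_const cardC1.
Qed.

(** If g is not above [al], some coordinate g a equals a j < [al a]; there are [\sum_a al a] such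
    slices of the box, each of one dimension less. *)
Lemma card_not_ge D (al : expnt) :
  (#|[set g : {ffun I -> 'I_D.+1} | ~~ [forall a, al a <= g a]]| <=
   (\sum_a al a) * D.+1 ^ #|I|.-1)%N.
Proof.
apply: leq_trans (_ : (\sum_a \sum_(j < al a)
    #|[set g : {ffun I -> 'I_D.+1} | g a == j :> nat]| <= _)%N); last first.
  rewrite big_distrl /=; apply: leq_sum => a _.
  rewrite -[X in (_ <= X * _)%N]card_ord -sum_nat_const.
  by apply: leq_sum => j _; apply: card_coord_eq.
apply: leq_trans (_ : (#|\bigcup_a \bigcup_(j < al a)
   [set g : {ffun I -> 'I_D.+1} | g a == j :> nat]| <= _)%N).
  apply/subset_leq_card/subsetP => g; rewrite inE negb_forall => /existsP [a].
  rewrite -ltnNge => Hg; apply/bigcupP; exists a => //.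
  by apply/bigcupP; exists (Ordinal Hg) => //; rewrite inE.
have big_le (J : finType) (G : J -> {set {ffun I -> 'I_D.+1}}) :
    (#|\bigcup_j G j| <= \sum_j #|G j|)%N.
  elim/big_ind2: _ => [|x1 x2 y1 y2 H1 H2|//]; first by rewrite cards0.
  apply: leq_trans (leq_add H1 H2); rewrite cardsU; exact: leq_subr.
by apply: leq_trans (big_le _ _) _; apply: leq_sum => a _; apply: big_le.
Qed.
End Exponents.

(** * Injectivity by comparison of growth *)

Section Growth.
Variables (k : fieldType) (A : algType k) (I : finType) (Z : I -> A) (wt : I -> nat).
Hypothesis wt_gt0 : forall a, (0 < wt a)%N.
Local Notation ws := (wsum wt).
Local Notation V D := (wspan Z (fun s => wsum wt s < D)%N).
Hypothesis Hcomm : forall a b, V (wt a + wt b) (Z a * Z b - Z b * Z a).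
Hypothesis Hspan : forall x, exists D, V D x.

Definition cword (al : expnt I) : seq I := flatten [seq nseq (al a) a | a <- enum I].
Definition mon (al : expnt I) : A := wprod Z (cword al).
Definition mwt (al : expnt I) : nat := (\sum_a wt a * al a)%N.
Definition cnt (s : seq I) : expnt I := [ffun a => count_mem a s].

Lemma count_cword al a : count_mem a (cword al) = al a.
Proof.
rewrite /cword count_flatten -map_comp sumnE big_map big_enum /= (bigD1 a) //=.
rewrite count_nseq /= eqxx mul1n big1 ?addn0 // => b Hb.
by rewrite count_nseq /= (negbTE Hb).
Qed.
Lemma cnt_cword al : cnt (cword al) = al.
Proof. by apply/ffunP => a; rewrite ffunE count_cword. Qed.
Lemma perm_cword s : perm_eq s (cword (cnt s)).
Proof. by apply/allP => a _ /=; rewrite count_cword ffunE. Qed.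
Lemma wsum_cnt s : ws s = mwt (cnt s).
Proof.
rewrite /wsum /mwt; elim: s => [|b s IH].
  by rewrite big_nil big1 // => a _; rewrite ffunE muln0.
rewrite big_cons IH [RHS](eq_bigr (fun a => wt a * (b == a) + wt a * cnt s a)%N).
  rewrite big_split /=; congr (_ + _)%N; rewrite (bigD1 b) //= eqxx muln1 big1 ?addn0 //.
  by move=> a; rewrite eq_sym => /negbTE ->; rewrite muln0.
by move=> a _; rewrite !ffunE /= mulnDr.
Qed.
Lemma wsum_cword al : ws (cword al) = mwt al.
Proof. by rewrite wsum_cnt cnt_cword. Qed.
Lemma wsum_perm s t : perm_eq s t -> ws s = ws t.
Proof. exact: perm_big. Qed.
Lemma mwt_eadd al be : mwt (eadd al be) = (mwt al + mwt be)%N.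
Proof. by rewrite /mwt -big_split; apply: eq_bigr => a _; rewrite ffunE mulnDr. Qed.
Lemma leq_mwt (al : expnt I) a : (al a <= mwt al)%N.
Proof.
rewrite /mwt (bigD1 a) //=; apply: leq_trans (leq_addr _ _).
by rewrite leq_pmull.
Qed.

Lemma V_mul s D x t : V D x -> V (ws s + D + ws t) (wprod Z s * x * wprod Z t).
Proof.
move=> Hx.
apply: (wspanM (P := fun u => (ws u < ws s + D)%N) (Q := pred1 t)).
- by move=> u v H /eqP ->; rewrite wsum_cat; lia.
- apply: (wspanM (P := pred1 s) (Q := fun u => (ws u < D)%N)) => //.
    by move=> u v /eqP -> H; rewrite wsum_cat; lia.
  by apply: fspan_in => /=.
- by apply: fspan_in => /=.
Qed.

Lemma V_move s1 a s2 : V (ws (s1 ++ a :: s2)) (wprod Z (s1 ++ a :: s2) - wprod Z (a :: s1 ++ s2)).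
Proof.
elim: s1 => [|b s1 IH]; first by rewrite subrr; apply: fspan0.
rewrite -(subrKA (wprod Z (b :: a :: s1 ++ s2))); apply: fspanD.
  have := @V_mul [:: b] _ _ [::] IH; rewrite wprod_nil mulr1 mulrBr -!wprod_cat.
  by apply: fspan_sub => s; rewrite !wsumE; lia.
have := @V_mul [::] _ _ (s1 ++ s2) (Hcomm b a); rewrite wprod_nil mul1r mulrBl.
rewrite -!(wprod1 Z) -!wprod_cat; by apply: fspan_sub => s; rewrite !wsumE; lia.
Qed.

Lemma V_perm s t : perm_eq s t -> V (ws s) (wprod Z s - wprod Z t).
Proof.
elim: t s => [|a t IH] s Hst.
  by move/perm_nilP: Hst => ->; rewrite subrr; apply: fspan0.
have ain : a \in s by rewrite (perm_mem Hst) mem_head.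
case/splitPr: ain Hst => s1 s2 Hst.
have Hp : perm_eq (s1 ++ s2) t.
  by rewrite -(perm_cons a); apply: perm_trans Hst; rewrite perm_sym -cat1s perm_catCA.
rewrite -(subrKA (wprod Z (a :: s1 ++ s2))); apply: fspanD; first exact: V_move.
have := @V_mul [:: a] _ _ [::] (IH _ Hp); rewrite wprod_nil mulr1 mulrBr -!wprod_cat.
by apply: fspan_sub => u; rewrite !wsumE; lia.
Qed.

Lemma mon_span D x : V D x -> fspan mon (fun al => mwt al < D)%N x.
Proof.
elim/ltn_ind: D x => D IH x; apply: fspan_trans => s Hs.
rewrite -(subrK (mon (cnt s)) (wprod Z s)); apply: fspanD; last first.
  by apply: fspan_in; rewrite -wsum_cnt.
apply: fspan_sub (IH _ Hs _ (V_perm (perm_cword s))) => al; lia.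
Qed.

Lemma mon_mul al be : V (mwt (eadd al be)) (mon al * mon be - mon (eadd al be)).
Proof.
rewrite /mon -wprod_cat.
have H : perm_eq (cword al ++ cword be) (cword (eadd al be)).
  by apply/allP => a _ /=; rewrite count_cat !count_cword ffunE.
by have := V_perm H; rewrite (wsum_perm H) wsum_cword.
Qed.

Variables (B : lmodType k) (phi : A -> B).
Hypothesis phi_lin : forall c x y, phi (c *: x + y) = c *: phi x + phi y.
Hypothesis phi_ker : forall x w, phi w = 0 -> phi (x * w) = 0.
(** Growth is expressed by the size of spanning families, which avoids dimensions of subspaces. One
    D for each C suffices, because the upper bound for a map with kernel holds for all D with one
    C. *)
Hypothesis phi_grow : forall C, exists D, forall m (y : 'I_m -> B),
  (forall x, V D.+1 x -> exists c : 'I_m -> k, phi x = \sum_j c j *: y j) ->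
  (C * D.+1 ^ #|I|.-1 < m)%N.

Local Notation pmon := (phi \o mon).

(* A relation [phi w = 0] with leading exponent [al0] makes every monomial whose
   exponent dominates [al0] redundant, so the image of [V D] grows one degree
   slower than the polynomial ring in [#|I|] variables. *)
Theorem growth_injective w : phi w = 0 -> w = 0.
Proof.
move=> Hw; apply/eqP; apply/negPn/negP => w0.
have [D0 /mon_span [l [_ El]]] := Hspan w.
pose E := undup [seq t.2 | t <- l].
pose c al := \sum_(t <- l | t.2 == al) t.1.
have wE : w = \sum_(al <- E) c al *: mon al.
  under eq_bigr => al _ do rewrite scaler_suml.
  rewrite (exchange_big_dep predT) //= El big_seq [RHS]big_seq; apply: eq_bigr => t Ht.
  rewrite (eq_bigl (pred1 t.2)); last by move=> al; rewrite /= eq_sym.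
  by rewrite -[RHS]big_filter filter_pred1_uniq ?undup_uniq ?mem_undup ?map_f // big_seq1.
pose S := [seq al <- E | c al != 0].
have wS : w = \sum_(al <- S) c al *: mon al.
  rewrite wE big_filter [RHS]big_mkcond /=; apply: eq_bigr => al _.
  by case: eqP => //= ->; rewrite scale0r.
have S0 : S != [::] by apply: contra_neq w0 => H; rewrite wS H big_nil.
pose M := (\max_(al <- S) mwt al).+1.
have HM al a : al \in S -> (al a < M)%N.
  move=> Hal; apply: leq_trans (_ : (mwt al).+1 <= M)%N; first by rewrite ltnS leq_mwt.
  by rewrite ltnS (big_rem al) //= leq_maxl.
pose th := @base I M.
(* [BIG] exceeds every [th] on the support, so a maximum of [mwt al * BIG + th al] is a
   lexicographic maximum of the pair (weight, base value). *)
pose BIG := (\max_(al <- S) th al).+1.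
have [al0 Hal0 Hmax] := seq_argmax (fun al => mwt al * BIG + th al)%N S0.
pose lt al be := (mwt al < mwt be)%N || (mwt al == mwt be) && (th al < th be)%N.
have Hlt al : al \in S -> al != al0 -> lt al al0.
  move=> Hal Hne; have := Hmax _ Hal.
  have Hth be : be \in S -> (th be < BIG)%N.
    by move=> Hbe; rewrite ltnS (big_rem be) //= leq_maxl.
  have := Hth _ Hal; have := Hth _ Hal0; rewrite /lt => h1 h2 h3.
  case: (ltngtP (mwt al) (mwt al0)) => //= h4.
    by move: h3; nia.
  rewrite h4 leq_add2l in h3; rewrite ltn_neqAle h3 andbT.
  apply: contra Hne => /eqP H; apply/eqP; apply: (base_inj _ _ H) => a; exact: HM.
(* The relation is multiplied by the monomial with exponent ga - al0. Its leading term becomes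
   [mon ga] up to lower weight, and the other terms stay below since [lt] is compatible with
   addition of exponents. *)
have red1 ga : ele al0 ga -> fspan pmon (lt^~ ga) (phi (mon ga)).
  move=> /forallP Hga.
  pose be : expnt I := [ffun a => ga a - al0 a]%N.
  have Ega : eadd be al0 = ga by apply/ffunP => a; rewrite !ffunE subnK.
  have c0 : c al0 != 0 by move: Hal0; rewrite mem_filter => /andP [].
  have := phi_ker (mon be) Hw; rewrite wS mulr_sumr (big_rem al0) //= => H0.
  have phiD x y : phi (x + y) = phi x + phi y by rewrite -[x]scale1r phi_lin !scale1r.
  have phi0 : phi 0 = 0 by apply: (addrI (phi 0)); rewrite -phiD !addr0.
  have phiZ t x : phi (t *: x) = t *: phi x by rewrite -[t *: x]addr0 phi_lin phi0 addr0.
  have phiN x : phi (- x) = - phi x by rewrite -[- x]scaleN1r phiZ scaleN1r.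
  have low D x : V D x -> (D <= mwt ga)%N -> fspan pmon (lt^~ ga) (phi x).
    move=> Hx HD; apply: fspan_linear => //.
    by apply: fspan_sub (mon_span Hx) => al Hal; rewrite /lt (leq_trans Hal HD).
  have lowm al : V (mwt (eadd be al)) (mon be * mon al - mon (eadd be al)) by apply: mon_mul.
  have -> : phi (mon ga) = - phi (mon be * mon al0 - mon ga) + phi (mon be * mon al0).
    by rewrite -phiN -phiD opprB addrNK.
  apply: fspanD.
    by apply: fspanN; have := lowm al0; rewrite Ega => /low; apply.
  have -> : phi (mon be * mon al0) = (c al0)^-1 *: (c al0 *: phi (mon be * mon al0)).
    by rewrite scalerA mulVf // scale1r.
  apply: fspanZ; rewrite -phiZ scalerAr.
  move: H0; rewrite phiD => /eqP; rewrite addr_eq0 => /eqP ->; apply: fspanN.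
  have phi_sum (r : seq (expnt I)) F : phi (\sum_(i <- r) F i) = \sum_(i <- r) phi (F i).
    by elim: r => [|i r IH]; rewrite ?big_nil // !big_cons phiD IH.
  rewrite phi_sum big_seq; apply: fspan_sum => al Hal.
  have uS : uniq S by apply: filter_uniq; apply: undup_uniq.
  rewrite mem_rem_uniq // inE in Hal; case/andP: Hal => Hne Hal.
  rewrite -scalerAr phiZ; apply: fspanZ.
  have ltal : lt (eadd be al) ga.
    move: (Hlt _ Hal Hne); rewrite -Ega /lt /th !mwt_eadd !base_add !ltn_add2l eqn_add2l.
    done.
  rewrite -(subrK (mon (eadd be al)) (mon be * mon al)) phiD; apply: fspanD.
    by apply: low (lowm al) _; move: ltal; rewrite /lt; lia.
  exact: (fspan_in pmon).
(* Iterating [red1] terminates by induction on the weight and, for equal weight, on the base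
   value. *)
have red : forall ga, fspan pmon (fun de => (mwt de <= mwt ga)%N && ~~ ele al0 de) (pmon ga).
  move=> ga; have [m] := ubnP (mwt ga); elim: m ga => // m IHm ga Hm.
  have [t] := ubnP (th ga); elim: t ga Hm => // t IHt ga Hm Ht.
  case: (boolP (ele al0 ga)) => Hle; last first.
    by apply: (fspan_in pmon); rewrite leqnn.
  apply: (fspan_trans _ (red1 _ Hle)) => de /orP [Hde|/andP [/eqP Hde Hth]].
    by apply: fspan_sub (IHm de _) => [be|]; [case/andP => H ->; rewrite andbT|]; lia.
  by rewrite -Hde; apply: IHt; [rewrite Hde | lia].
(* The constant is the one of [card_not_ge]. Since all weights are positive, exponents of weight at
   most D lie in the box with entries at most D. *)
have [D HD] := phi_grow (\sum_a al0 a)%N.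
pose X := [set g : {ffun I -> 'I_D.+1} | ~~ [forall a, al0 a <= g a]]%N.
pose y (j : 'I_#|X|) := pmon [ffun a => nat_of_ord ((enum_val j : {ffun I -> 'I_D.+1}) a)].
suff /HD : forall x, V D.+1 x -> exists c : 'I_#|X| -> k, phi x = \sum_j c j *: y j.
  by rewrite ltnNge card_not_ge.
move=> x Hx.
apply: (@fspan_fin _ _ _ pmon (fun de => (mwt de <= D)%N && ~~ ele al0 de)).
  move=> de /andP [Hde Hle].
  have HdeD a : (de a < D.+1)%N by rewrite ltnS (leq_trans (leq_mwt _ _) Hde).
  pose g := [ffun a => Ordinal (HdeD a)].
  have Hg : g \in X.
    rewrite inE; apply: contra Hle => /forallP H; apply/forallP => a.
    by have := H a; rewrite ffunE.
  exists (enum_rank_in Hg g); rewrite /y; congr pmon.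
  by apply/ffunP => a; rewrite ffunE enum_rankK_in // ffunE.
apply: fspan_trans (fspan_linear phi_lin (mon_span Hx)) => ga Hga.
by apply: fspan_sub (red ga) => de /andP [H ->]; rewrite andbT; lia.
Qed.
End Growth.

(** * Skew group algebras *)


Record skew_data (k L : fieldType) (M : zmodType) := SkewData {
  act : M -> {rmorphism L -> L};
  cst : {rmorphism k -> L};
  act0 : forall x, act 0 x = x;
  actD : forall m m' x, act (m + m') x = act m (act m' x);
  act_cst : forall m c, act m (cst c) = cst c }.

Lemma malg_additive_ind (G M : zmodType) (P : {malg G[M]} -> Prop) :
  (forall a m, P << a *g m >>) -> (forall x y, P x -> P y -> P (x + y)) -> forall x, P x.
Proof.
move=> HU HD x; rewrite [x]monalgE; apply: big_ind => //.
by have := HU 0 0; rewrite monalgU0.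
Qed.

(** [D] tags the type of finitely supported functions, so that the product twisted by its action can
    become the ring structure of the type, in place of the untwisted one. *)
Definition skew_alg (k L : fieldType) (M : zmodType) (D : skew_data k L M) : Type := {malg L[M]}.

Section SkewAlgebra.
Variables (k L : fieldType) (M : zmodType) (D : skew_data k L M).

Local Notation SK := (skew_alg D).
HB.instance Definition _ := GRing.Zmodule.on SK.

Definition sk (a : L) (m : M) : SK := << a *g m >>.
Definition skc (x : SK) (m : M) : L := mcoeff m x.

Lemma skewP (x y : SK) : (forall m, skc x m = skc y m) -> x = y.
Proof. by move/malgP. Qed.
Lemma skcD x y m : skc (x + y) m = skc x m + skc y m.
Proof. exact: mcoeffD. Qed.
Lemma skc0 m : skc 0 m = 0.
Proof. exact: mcoeff0. Qed.
Lemma skc_sk a m m' : skc (sk a m) m' = if m == m' then a else 0.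
Proof. by rewrite /skc mcoeffU; case: eqP. Qed.
Lemma skD a b m : sk (a + b) m = sk a m + sk b m.
Proof. exact: monalgUD. Qed.
Lemma sk0 m : sk 0 m = 0.
Proof. exact: monalgU0. Qed.
Lemma skew_ind (P : SK -> Prop) :
  (forall a m, P (sk a m)) -> (forall x y, P x -> P y -> P (x + y)) -> forall x, P x.
Proof. exact: malg_additive_ind. Qed.

Definition skmul (x y : SK) : SK :=
  \sum_(a <- msupp x) \sum_(b <- msupp y) sk (skc x a * act D a (skc y b)) (a + b).

Lemma skmulw (d1 d2 : {fset M}) x y : (msupp x `<=` d1)%fset -> (msupp y `<=` d2)%fset ->
  skmul x y = \sum_(a <- d1) \sum_(b <- d2) sk (skc x a * act D a (skc y b)) (a + b).
Proof.
move=> le_d1 le_d2; rewrite /skmul (big_fset_incl _ le_d1) /=.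
  apply/eq_bigr=> k1 _; apply/big_fset_incl => // m _ Hm.
  by rewrite /skc [X in act D k1 X]mcoeff_outdom // rmorph0 mulr0 sk0.
move=> m _ Hm; rewrite big1 // => b _.
by rewrite /skc [X in X * _]mcoeff_outdom // mul0r sk0.
Qed.

Lemma skmulDl : left_distributive skmul +%R.
Proof.
move=> x y z; have Hz := fsubset_refl (msupp z).
rewrite (skmulw (msuppD_le _ _) Hz) (skmulw (fsubsetUl _ (msupp y)) Hz).
rewrite (skmulw (fsubsetUr (msupp x) _) Hz).
rewrite -big_split /=; apply/eq_bigr=> k1 _.
rewrite -big_split /=; apply/eq_bigr=> k2 _.
by rewrite skcD mulrDl skD.
Qed.
Lemma skmulDr : right_distributive skmul +%R.
Proof.
move=> z x y; have Hz := fsubset_refl (msupp z).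
rewrite (skmulw Hz (msuppD_le _ _)) (skmulw Hz (fsubsetUl _ (msupp y))).
rewrite (skmulw Hz (fsubsetUr (msupp x) _)).
rewrite -big_split /=; apply/eq_bigr=> k1 _.
rewrite -big_split /=; apply/eq_bigr=> k2 _.
by rewrite skcD rmorphD mulrDr skD.
Qed.
Lemma skmulUU a m b m' : skmul (sk a m) (sk b m') = sk (a * act D m b) (m + m').
Proof.
rewrite (skmulw msuppU_le msuppU_le) !big_seq_fset1.
by rewrite !skc_sk !eqxx.
Qed.

Lemma skmulA : associative skmul.
Proof.
move=> x y z; elim/skew_ind: x => [a m|x x' Hx Hx']; last by rewrite !skmulDl Hx Hx'.
elim/skew_ind: y => [b m'|y y' Hy Hy']; last by rewrite !(skmulDl, skmulDr) Hy Hy'.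
elim/skew_ind: z => [c m''|z z' Hz Hz']; last by rewrite !skmulDr Hz Hz'.
by rewrite !skmulUU rmorphM mulrA actD addrA.
Qed.
Lemma skmul1l : left_id (sk 1 0) skmul.
Proof.
elim/skew_ind => [a m|x y Hx Hy]; last by rewrite skmulDr Hx Hy.
by rewrite skmulUU act0 mul1r add0r.
Qed.
Lemma skmul1r : right_id (sk 1 0) skmul.
Proof.
elim/skew_ind => [a m|x y Hx Hy]; last by rewrite skmulDl Hx Hy.
by rewrite skmulUU rmorph1 mulr1 addr0.
Qed.
Lemma skone_neq0 : sk 1 0 != 0.
Proof.
apply/eqP => /(congr1 (skc ^~ 0)); rewrite skc_sk eqxx skc0.
by apply/eqP; apply: oner_neq0.
Qed.

HB.instance Definition _ := GRing.Zmodule_isNzRing.Build SK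
  skmulA skmul1l skmul1r skmulDl skmulDr skone_neq0.

Lemma skM a m b m' : sk a m * sk b m' = sk (a * act D m b) (m + m').
Proof. exact: skmulUU. Qed.
Lemma sk1 : sk 1 0 = 1.
Proof. by []. Qed.

Definition skscale (c : k) (x : SK) : SK := sk (cst D c) 0 * x.
Lemma skscaleA a b v : skscale a (skscale b v) = skscale (a * b) v.
Proof. by rewrite /skscale mulrA skM act_cst addr0 rmorphM. Qed.
Lemma skscale1 : left_id 1 skscale.
Proof. by move=> v; rewrite /skscale rmorph1 sk1 mul1r. Qed.
Lemma skscaleDr : right_distributive skscale +%R.
Proof. by move=> a u v; rewrite /skscale mulrDr. Qed.
Lemma skscaleDl v : {morph skscale^~ v : a b / a + b}.
Proof. by move=> a b; rewrite /skscale rmorphD skD mulrDl. Qed.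
HB.instance Definition _ := GRing.Zmodule_isLmodule.Build k SK
  skscaleA skscale1 skscaleDr skscaleDl.
Lemma skscaleAl (a : k) (u v : SK) : a *: (u * v) = (a *: u) * v.
Proof. exact: mulrA. Qed.
HB.instance Definition _ := GRing.Lmodule_isLalgebra.Build k SK skscaleAl.
Lemma skscaleAr (a : k) (u v : SK) : a *: (u * v) = u * (a *: v).
Proof.
rewrite [LHS]mulrA [RHS]mulrA; congr (_ * _).
elim/skew_ind: u => [b m|x y Hx Hy]; last by rewrite mulrDl mulrDr Hx Hy.
by rewrite !skM act0 act_cst mulrC addrC.
Qed.
HB.instance Definition _ := GRing.Lalgebra_isAlgebra.Build k SK skscaleAr.

Lemma skZ (c : k) (x : SK) : c *: x = sk (cst D c) 0 * x.
Proof. by []. Qed.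
Lemma skc_mulL a (x : SK) m : skc (sk a 0 * x) m = a * skc x m.
Proof.
elim/skew_ind: x => [b m'|x y Hx Hy]; last by rewrite mulrDr !skcD Hx Hy mulrDr.
by rewrite skM act0 add0r !skc_sk; case: eqP; rewrite ?mulr0.
Qed.
Lemma skcZ (c : k) (x : SK) m : skc (c *: x) m = cst D c * skc x m.
Proof. exact: skc_mulL. Qed.

Definition skc_supp (x : SK) : seq M := msupp x.
Lemma skewE (x : SK) : x = \sum_(m <- skc_supp x) sk (skc x m) m.
Proof. exact: monalgE. Qed.
Lemma skc_suppP (x : SK) m : (m \in skc_supp x) = (skc x m != 0).
Proof. by rewrite mcoeff_neq0. Qed.
Lemma skc_supp_uniq (x : SK) : uniq (skc_supp x).
Proof. exact: fset_uniq. Qed.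
Lemma skc_sum (T : Type) (r : seq T) (P : pred T) (F : T -> SK) m :
  skc (\sum_(i <- r | P i) F i) m = \sum_(i <- r | P i) skc (F i) m.
Proof. exact: (big_morph (skc^~ m) (fun x y => skcD x y m) (skc0 m)). Qed.

End SkewAlgebra.
Arguments sk [k L M D] a m.


Section SkewSupport.
Variables (k L : fieldType) (M : zmodType) (D : skew_data k L M) (Q : M -> Prop).
Local Notation SK := (skew_alg D).
Implicit Types (X Y : SK).
Hypothesis Q0 : Q 0.
Hypothesis QD : forall m m', Q m -> Q m' -> Q (m + m').

Definition supported X : Prop := forall m, skc X m != 0 -> Q m.

Lemma supported_sk a m : Q m -> supported (sk a m).
Proof. by move=> Hm m'; rewrite skc_sk; case: (m =P m') => [<-|]; rewrite ?eqxx. Qed.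
Lemma supported0 : supported 0.
Proof. by move=> m; rewrite skc0 eqxx. Qed.
Lemma supportedD X Y : supported X -> supported Y -> supported (X + Y).
Proof.
move=> HX HY m; rewrite skcD; have [X0|/HX //] := eqVneq (skc X m) 0.
by rewrite X0 add0r; apply: HY.
Qed.
Lemma supported_sum (T : Type) (r : seq T) (P : pred T) (F : T -> SK) :
  (forall t, P t -> supported (F t)) -> supported (\sum_(t <- r | P t) F t).
Proof. by move=> H; apply: (big_ind supported) => //; [apply: supported0 | apply: supportedD]. Qed.
Lemma supportedM X Y : supported X -> supported Y -> supported (X * Y).
Proof.
move=> HX HY; rewrite (skewE X) (skewE Y) mulr_suml big_seq; apply: supported_sum => m.
rewrite skc_suppP => /HX Hm; rewrite mulr_sumr big_seq; apply: supported_sum => m'.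
by rewrite skc_suppP => /HY Hm'; rewrite skM; apply: supported_sk; apply: QD.
Qed.
Lemma supportedZ (c : k) X : supported X -> supported (c *: X).
Proof. by move=> H; rewrite skZ; apply: supportedM => //; apply/supported_sk/Q0. Qed.
End SkewSupport.

Section SkewAutomorphism.
Variables (k L : fieldType) (M : zmodType) (D : skew_data k L M).
Local Notation SK := (skew_alg D).
Variables (g : {rmorphism L -> L}) (c c' : M -> M).
Hypothesis cK : cancel c c'.
Hypothesis cK' : cancel c' c.
Hypothesis cD : forall m m', c (m + m') = c m + c m'.
Hypothesis g_act : forall m x, g (act D m x) = act D (c m) (g x).
Hypothesis g_cst : forall a, g (cst D a) = cst D a.
Implicit Types (X Y : SK).

Definition skmap X : SK := \sum_(m <- skc_supp X) sk (g (skc X m)) (c m).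

Lemma skc_map X m : skc (skmap X) m = g (skc X (c' m)).
Proof.
rewrite /skmap skc_sum; under eq_bigr => m' _ do rewrite skc_sk (can2_eq cK cK').
have [H|H] := boolP (c' m \in skc_supp X).
  rewrite (bigD1_seq (c' m)) ?skc_supp_uniq //= eqxx big1 ?addr0 // => m' /negbTE nm.
  by rewrite nm.
rewrite skc_suppP negbK in H; rewrite (eqP H) rmorph0 big1 // => m' _.
by case: eqP => // ->; rewrite (eqP H) rmorph0.
Qed.
Lemma skmapD X Y : skmap (X + Y) = skmap X + skmap Y.
Proof. by apply: skewP => m; rewrite skcD !skc_map skcD rmorphD. Qed.
Lemma skmap0 : skmap 0 = 0.
Proof. by apply: skewP => m; rewrite skc_map !skc0 rmorph0. Qed.
Lemma skmap_sum (T : Type) (r : seq T) (P : pred T) (F : T -> SK) :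
  skmap (\sum_(t <- r | P t) F t) = \sum_(t <- r | P t) skmap (F t).
Proof. exact: (big_morph skmap skmapD skmap0). Qed.
Lemma skmap_sk a m : skmap (sk a m) = sk (g a) (c m).
Proof.
apply: skewP => m'; rewrite skc_map !skc_sk.
by rewrite -(can2_eq cK cK'); case: eqP; rewrite ?rmorph0.
Qed.
Lemma skmapM X Y : skmap (X * Y) = skmap X * skmap Y.
Proof.
elim/skew_ind: X => [a m|X X' HX HX']; last by rewrite mulrDl !skmapD mulrDl HX HX'.
elim/skew_ind: Y => [b m'|Y Y' HY HY']; last by rewrite mulrDr !skmapD mulrDr HY HY'.
by rewrite skM !skmap_sk skM rmorphM cD g_act.
Qed.
Lemma additive0 : c 0 = 0.
Proof. by apply: (addrI (c 0)); rewrite -cD !addr0. Qed.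
Lemma skmap_iota a : skmap (sk a 0) = sk (g a) 0.
Proof. by rewrite skmap_sk additive0. Qed.
Lemma skmapZ (a : k) X : skmap (a *: X) = a *: skmap X.
Proof. by rewrite !skZ skmapM skmap_iota g_cst. Qed.
End SkewAutomorphism.

Arguments skmap_iota [k L M D g c c'] cK cK' cD a.
Arguments skmap_sk [k L M D g c c'] cK cK' a m.
Arguments skmap_sum [k L M D g c c'] cK cK' [T] r P F.
Arguments skmapD [k L M D g c c'] cK cK' X Y.
Arguments skc_map [k L M D g c c'] cK cK' X m.

(** * Relations between sums of exchange operators *)


Section Exchange.
Variables (L : fieldType) (B : nzRingType) (iota : L -> B).
Variables (V : finType) (row : V -> nat) (z : V -> L) (tau : V -> {rmorphism L -> L}).
Variable X : V -> B.

(** [X v] abstracts a shift with a rational coefficient, and the exchange relations are cleared of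
    denominators. The ring [B] is arbitrary, so that its opposite can be used for the lowering
    operators. *)
Record exchange : Prop := Exchange {
  xiD : forall a b, iota (a + b) = iota a + iota b;
  xiM : forall a b, iota (a * b) = iota a * iota b;
  xi1 : iota 1 = 1;
  xtau : forall v w, tau v (z w) = z w + (v == w)%:R;
  xz0 : forall v w, v != w -> z v - z w != 0;
  xz1 : forall v w, v != w -> z v - z w + 1 != 0;
  xX : forall v a, X v * iota a = iota (tau v a) * X v;
  xsame : forall v w, row v = row w -> v != w ->
    iota (z v - z w + 1) * (X v * X w) = iota (z v - z w - 1) * (X w * X v);
  xnext : forall v w, row w = (row v).+1 ->
    iota (z v - z w - 1) * (X v * X w) = iota (z v - z w) * (X w * X v);
  xfar : forall v w, ((row v).+1 < row w)%N || ((row w).+1 < row v)%N -> X v * X w = X w * X v }.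

Hypothesis HE : exchange.
Hypothesis two : (2%:R : L) != 0.

Definition gsum (i a : nat) : B := \sum_(v | row v == i) iota (z v ^+ a) * X v.

Let iD := xiD HE.
Let iM := xiM HE.
Let i0 : iota 0 = 0.
Proof. by apply: (addrI (iota 0)); rewrite -iD !addr0. Qed.
Let iN a : iota (- a) = - iota a.
Proof. by apply/eqP; rewrite -addr_eq0 -iD addNr i0. Qed.
Let iB a b : iota (a - b) = iota a - iota b.
Proof. by rewrite iD iN. Qed.

Let e v a : B := iota (z v ^+ a) * X v.

Let word2 a1 a2 v w : (iota a1 * X v) * (iota a2 * X w) = iota (a1 * tau v a2) * (X v * X w).
Proof. by rewrite mulrA -[iota a1 * X v * iota a2]mulrA (xX HE) iM !mulrA. Qed.

Let tauzn v w a : v != w -> tau v (z w ^+ a) = z w ^+ a.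
Proof. by move=> /negbTE H; rewrite rmorphXn /= (xtau HE) H addr0. Qed.
Let tauzz v a : tau v (z v ^+ a) = (z v + 1) ^+ a.
Proof. by rewrite rmorphXn /= (xtau HE) eqxx. Qed.

Let cancel_iota a (x : B) : a != 0 -> iota a * x = 0 -> x = 0.
Proof.
by move=> a0 H; rewrite -[x]mul1r -(xi1 HE) -(mulVf a0) iM -mulrA H mulr0.
Qed.

Let sum_antisym (P : pred V) (T : V -> V -> B) :
  (forall v w, P v -> P w -> T v w + T w v = 0) -> \sum_(v | P v) \sum_(w | P w) T v w = 0.
Proof.
move=> H; apply: (cancel_iota two).
rewrite -[2%:R]/(1 + 1) iD (xi1 HE) mulrDl mul1r {2}exchange_big /= -big_split /=.
rewrite big1 // => v Hv; rewrite -big_split /= big1 // => w Hw; exact: H.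
Qed.

Let br_sum (P Q : pred V) (F G : V -> B) :
  (\sum_(v | P v) F v) * (\sum_(w | Q w) G w) = \sum_(v | P v) \sum_(w | Q w) F v * G w.
Proof. by rewrite mulr_suml; apply: eq_bigr => v _; rewrite mulr_sumr. Qed.

(** With scalars moved to the left, the coefficient of X_v X_w contains the factor tau_v(z_w) - z_v
    - 1. It is zero for v = w, and for v != w the terms (v, w) and (w, v) cancel by [xsame]. *)
Lemma gsum_same i a b :
  (gsum i a * gsum i b.+1 - gsum i b.+1 * gsum i a)
  - (gsum i a.+1 * gsum i b - gsum i b * gsum i a.+1) =
  gsum i a * gsum i b + gsum i b * gsum i a.
Proof.
apply/eqP; rewrite -subr_eq0; apply/eqP.
rewrite /gsum !br_sum -!sumrB -big_split /= -sumrB.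
under eq_bigr => v _ do rewrite -!sumrB -big_split /= -sumrB.
apply: sum_antisym => v w /eqP Hv /eqP Hw.
have red u t : e u a * e t b.+1 - e u b.+1 * e t a - (e u a.+1 * e t b - e u b * e t a.+1)
   - (e u a * e t b + e u b * e t a) =
   iota (z u ^+ a * tau u (z t ^+ b) * (tau u (z t) - z u - 1)
       + z u ^+ b * tau u (z t ^+ a) * (tau u (z t) - z u - 1)) * (X u * X t).
  rewrite /e !word2 -!mulrBl -mulrDl -mulrBl -!(iB, iD).
  by congr (iota _ * _); rewrite !exprS !rmorphM /=; ring.
rewrite -!/(e _ _) !red.
have [<-|nvw] := eqVneq v w.
  have -> : tau v (z v) - z v - 1 = 0 by rewrite (xtau HE) eqxx [true%:R]mulr1n; ring.
  by rewrite !mulr0 addr0 i0 mul0r addr0.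
have nwv : w != v by rewrite eq_sym.
rewrite !tauzn // !(xtau HE) (negbTE nvw) (negbTE nwv) !addr0.
set S := z v ^+ a * z w ^+ b + z v ^+ b * z w ^+ a.
have -> : z v ^+ a * z w ^+ b * (z w - z v - 1) + z v ^+ b * z w ^+ a * (z w - z v - 1)
  = - S * (z v - z w + 1) by rewrite /S; ring.
have -> : z w ^+ a * z v ^+ b * (z v - z w - 1) + z w ^+ b * z v ^+ a * (z v - z w - 1)
  = S * (z v - z w - 1) by rewrite /S; ring.
by rewrite !iM -!mulrA (xsame HE) ?Hv ?Hw // iN mulNr addNr.
Qed.

Lemma gsum_next i a b :
  (gsum i a * gsum i.+1 b.+1 - gsum i.+1 b.+1 * gsum i a)
  - (gsum i a.+1 * gsum i.+1 b - gsum i.+1 b * gsum i a.+1) =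
  - (gsum i a * gsum i.+1 b).
Proof.
apply/eqP; rewrite -subr_eq0 opprK; apply/eqP.
rewrite /gsum !br_sum.
rewrite [X in _ - X - _ + _]exchange_big [X in _ - (_ - X) + _]exchange_big /=.
rewrite -!sumrB -big_split /=; apply: big1 => v /eqP Hv.
rewrite -!sumrB -big_split /=; apply: big1 => w /eqP Hw.
have nvw : v != w by apply/eqP => E; move: Hw; rewrite -E Hv => /eqP; rewrite eqn_leq ltnn andbF.
have nwv : w != v by rewrite eq_sym.
rewrite !word2 !tauzn //.
have -> : z w ^+ b.+1 * z v ^+ a = z v ^+ a * z w ^+ b * z w by rewrite exprS; ring.
have -> : z w ^+ b * z v ^+ a.+1 = z v ^+ a * z w ^+ b * z v by rewrite exprS; ring.
have -> : z v ^+ a * z w ^+ b.+1 = z v ^+ a * z w ^+ b * z w by rewrite exprS; ring.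
have -> : z v ^+ a.+1 * z w ^+ b = z v ^+ a * z w ^+ b * z v by rewrite exprS; ring.
rewrite !iM -!(mulrA (iota (z v ^+ a) * _)) -!mulrBr -mulrDr.
rewrite -mulrBl -iB [_ * (_ - _)]mulrBr addrAC -[X in _ + X - _]mul1r -(xi1 HE) -mulrDl -iD.
have -> : z w - z v + 1 = - (z v - z w - 1) by ring.
have -> : z w - z v = - (z v - z w) by ring.
by rewrite !iN !mulNr (xnext HE) ?Hv ?Hw // opprK addNr mulr0.
Qed.

Lemma gsum_far i j a b : (i.+1 < j)%N || (j.+1 < i)%N -> gsum i a * gsum j b = gsum j b * gsum i a.
Proof.
move=> Hij; rewrite /gsum !br_sum [RHS]exchange_big /=.
apply: eq_bigr => v /eqP Hv; apply: eq_bigr => w /eqP Hw.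
have nvw : v != w by apply/eqP => E; move: Hij; rewrite -Hv -Hw E ltnNge leqnSn.
have nwv : w != v by rewrite eq_sym.
rewrite !word2 !tauzn // [z w ^+ b * _]mulrC; congr (_ * _).
by apply: (xfar HE); rewrite Hv Hw.
Qed.

Let word3 a1 a2 a3 u v w : (iota a1 * X u) * ((iota a2 * X v) * (iota a3 * X w)) =
  iota (a1 * tau u (a2 * tau v a3)) * (X u * X v * X w).
Proof.
by rewrite word2 mulrA -(mulrA (iota a1)) (xX HE) iM !mulrA.
Qed.

Let word3' a1 a2 a3 u v w : (iota a1 * X u) * (iota a2 * X v) * (iota a3 * X w) =
  iota (a1 * tau u (a2 * tau v a3)) * (X u * X v * X w).
Proof. by rewrite -mulrA word3. Qed.

Let XI v a x : X v * (iota a * x) = iota (tau v a) * (X v * x).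
Proof. by rewrite mulrA (xX HE) mulrA. Qed.

(** Exchanging v and v' in the second double bracket gives both the same powers of z. For fixed v,
    v', w every ordering of the three operators is then a rational multiple of X_v X_v' X_w, and the
    relation becomes an identity of rational functions. *)
Lemma gsum_serre i j a b c : (j == i.+1) || (i == j.+1) ->
  let br x y := x * y - y * x in
  br (gsum i a) (br (gsum i b) (gsum j c)) + br (gsum i b) (br (gsum i a) (gsum j c)) = 0.
Proof.
move=> Hij /=.
pose br (x y : B) := x * y - y * x.
have brs (P Q : pred V) (F G : V -> B) : br (\sum_(v | P v) F v) (\sum_(w | Q w) G w) =
   \sum_(v | P v) \sum_(w | Q w) br (F v) (G w).
  by rewrite /br !br_sum [X in _ - X]exchange_big -sumrB; apply: eq_bigr => v _; rewrite -sumrB.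
have brs1 (P : pred V) x (G : V -> B) : br x (\sum_(w | P w) G w) = \sum_(w | P w) br x (G w).
  by rewrite /br mulr_sumr mulr_suml -sumrB.
have exp (a' b' : nat) : br (gsum i a') (br (gsum i b') (gsum j c)) =
  \sum_(v | row v == i) \sum_(v' | row v' == i) \sum_(w | row w == j)
     br (e v a') (br (e v' b') (e w c)).
  rewrite /gsum brs brs; apply: eq_bigr => v _; apply: eq_bigr => v' _.
  by rewrite brs1.
rewrite -![_ - _]/(br _ _) !exp [X in _ + X]exchange_big -big_split /=.
apply: big1 => v /eqP Hv; rewrite -big_split /=; apply: big1 => v' /eqP Hv'.
rewrite -big_split /=; apply: big1 => w /eqP Hw.
have nij : i != j by move: Hij; lia.
have nv : v != w by apply: contraNneq nij => E; rewrite -Hv -Hw E.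
have nv' : v' != w by apply: contraNneq nij => E; rewrite -Hv' -Hw E.
(* [s] absorbs the difference between the two adjacencies: in both cases X_w X_u = ((y_u - 1) / y_u)
   X_u X_w. *)
pose s : L := (i == j.+1)%:R.
pose y u := z u - z w + s.
have y0 u : u != w -> y u != 0.
  by move=> H; rewrite /y /s; case: (i == _); [apply: (xz1 HE) | rewrite addr0; apply: (xz0 HE)].
have Xw u : row u = i -> u != w -> X w * X u = iota ((y u - 1) / y u) * (X u * X w).
  move=> Hu nu; have yu := y0 _ nu.
  have cy x x' : iota (y u) * x = iota (y u) * x' -> x = x'.
    move=> H; apply/eqP; rewrite -subr_eq0; apply/eqP; apply: (cancel_iota yu).
    by rewrite mulrBr H subrr.
  apply: cy; rewrite [RHS]mulrA -iM mulrCA mulfV // mulr1.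
  case/orP: Hij => /eqP Eij.
    have s0 : s = 0 by rewrite /s Eij eqn_leq ltnNge leqnSn andbF.
    by rewrite /y s0 addr0 -(xnext HE) ?Hu ?Hw.
  have s1 : s = 1 by rewrite /s Eij eqxx.
  have := xnext HE (v := w) (w := u); rewrite Hu Hw => /(_ Eij).
  rewrite /y s1 addrK.
  have -> : z u - z w + 1 = - (z w - z u - 1) by ring.
  have -> : z u - z w = - (z w - z u) by ring.
  by move=> H; rewrite !iN !mulNr H.
have tphi u u' : u' != w -> tau u' ((y u - 1) / y u) =
    (y u + (u' == u)%:R - 1) / (y u + (u' == u)%:R).
  move=> nu'; have ty : tau u' (y u) = y u + (u' == u)%:R.
    rewrite /y rmorphD rmorphB /= !(xtau HE) (negbTE nu') addr0 rmorph_nat; ring.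
  by rewrite rmorphM fmorphV rmorphB rmorph1 ty.
have nw u : u != w -> w != u by rewrite eq_sym.
rewrite /br !mulrBr !mulrBl /e !word3 !word3'.
have T1 : tau v (z w ^+ c) = z w ^+ c by rewrite tauzn.
have T1' : tau v' (z w ^+ c) = z w ^+ c by rewrite tauzn.
have T2 m : tau w (z v ^+ m) = z v ^+ m by rewrite tauzn ?nw.
have T2' m : tau w (z v' ^+ m) = z v' ^+ m by rewrite tauzn ?nw.
have yv := y0 _ nv; have yv' := y0 _ nv'.
have tau_y u : u != w -> tau u (y u) = y u + 1.
  move=> nu; rewrite /y rmorphD rmorphB /= !(xtau HE) eqxx (negbTE nu) addr0 rmorph_nat.
  by rewrite [true%:R]mulr1n; ring.
have mulii a1 a2 x : iota a1 * (iota a2 * x) = iota (a1 * a2) * x by rewrite mulrA -iM.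
(* The case v = v' is separate because tau_v then shifts y_v itself when scalars move past X_v. *)
have [Evv|nvv] := eqVneq v v'.
  rewrite -{}Evv in Hv' nv' yv' T1' T2' *.
  have T3 m : tau w ((z v + 1) ^+ m) = (z v + 1) ^+ m.
    by rewrite rmorphXn rmorphD rmorph1 /= (xtau HE) (negbTE (nw _ nv)) addr0.
  rewrite !(rmorphM, tauzz, T1, T2, T3) /=.
  have y1 : y v + 1 != 0 by rewrite -tau_y // fmorph_eq0.
  set m := X v * X v * X w.
  have E1 : X v * X w * X v = iota (y v / (y v + 1)) * m.
    by rewrite -mulrA Xw // XI tphi // eqxx [true%:R]mulr1n addrK /m !mulrA.
  have E2 : X w * X v * X v = iota ((y v - 1) / (y v + 1)) * m.
    rewrite Xw // -!mulrA (mulrA (X v)) E1 mulii; congr (iota _ * _).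
    by field; rewrite yv y1.
  rewrite E1 E2 !mulii -!mulrBl -!mulrDl -!(iB, iD).
  rewrite [X in iota X](_ : _ = 0) ?i0 ?mul0r //.
  by field.
have nvv' : v' != v by rewrite eq_sym.
have S1 m : tau v (z v' ^+ m) = z v' ^+ m by rewrite tauzn.
have S2 m : tau v' (z v ^+ m) = z v ^+ m by rewrite tauzn.
rewrite !(rmorphM, T1, T1', T2, T2', S1, S2) /=.
set m := X v * X v' * X w.
have R0 : z v - z v' - 1 != 0.
  by rewrite (_ : _ - 1 = - (z v' - z v + 1)) ?oppr_eq0 ?(xz1 HE) //; ring.
pose R := (z v - z v' + 1) / (z v - z v' - 1).
have Xv : X v' * X v = iota R * (X v * X v').
  rewrite /R mulrC iM -mulrA (xsame HE) ?Hv ?Hv' // -[in LHS](mul1r (X v' * X v)).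
  by rewrite mulii mulVf // (xi1 HE).
have F1 : X v' * X v * X w = iota R * m by rewrite Xv /m !mulrA.
have F2 : X v * X w * X v' = iota ((y v' - 1) / y v') * m.
  by rewrite -mulrA Xw // XI tphi // (negbTE nvv) !addr0 /m !mulrA.
have F3 : X v' * X w * X v = iota ((y v - 1) / y v * R) * m.
  by rewrite -mulrA Xw // XI tphi // (negbTE nvv') !addr0 mulrA -mulrA -/(X v' * _) (mulrA (X v')) F1 mulii.
have F4 : X w * X v * X v' = iota ((y v - 1) / y v * ((y v' - 1) / y v')) * m.
  by rewrite Xw // -mulrA F2 mulii.
have F5 : X w * X v' * X v = iota ((y v' - 1) / y v' * ((y v - 1) / y v * R)) * m.
  by rewrite Xw // -mulrA F3 mulii.
rewrite F1 F2 F3 F4 F5 !mulii -!mulrBl -!mulrDl -!(iB, iD).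
rewrite [X in iota X](_ : _ = 0) ?i0 ?mul0r //.
have Ey : z v - z v' = y v - y v' by rewrite /y; ring.
rewrite /R Ey in R0 *.
by field; rewrite yv yv' R0.
Qed.
End Exchange.

(** * Power series *)


Record series (L : nzRingType) := Series { ser : nat -> L }.
HB.instance Definition _ (L : nzRingType) := gen_eqMixin (series L).
HB.instance Definition _ (L : nzRingType) := gen_choiceMixin (series L).

Lemma serP (L : nzRingType) (f g : series L) : (forall j, ser f j = ser g j) -> f = g.
Proof. by case: f g => [f] [g] /= H; congr Series; apply: funext. Qed.

Section SeriesRing.
Variable L : comNzRingType.
Local Notation S := (series L).

Definition sadd (f g : S) : S := Series (fun j => ser f j + ser g j).
Definition sopp (f : S) : S := Series (fun j => - ser f j).
Fact saddA : associative sadd.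
Proof. by move=> f g h; apply: serP => j /=; rewrite addrA. Qed.
Fact saddC : commutative sadd.
Proof. by move=> f g; apply: serP => j /=; rewrite addrC. Qed.
Fact sadd0 : left_id (Series (fun=> 0)) sadd.
Proof. by move=> f; apply: serP => j /=; rewrite add0r. Qed.
Fact saddN : left_inverse (Series (fun=> 0)) sopp sadd.
Proof. by move=> f; apply: serP => j /=; rewrite addNr. Qed.
HB.instance Definition _ := GRing.isZmodule.Build S saddA saddC sadd0 saddN.

Definition trunc N (f : S) : {poly L} := \poly_(i < N) ser f i.
Definition smul (f g : S) : S := Series (fun j => \sum_(i < j.+1) ser f i * ser g (j - i)%N).

(** Each coefficient of a product of series is a coefficient of a product of truncations, so
    associativity and commutativity are inherited from polynomials. *)
Lemma smul_poly N (f g : S) (p q : {poly L}) j : (j < N)%N ->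
  (forall i, (i < N)%N -> p`_i = ser f i) -> (forall i, (i < N)%N -> q`_i = ser g i) ->
  ser (smul f g) j = (p * q)`_j.
Proof.
move=> Hj Hp Hq; rewrite coefM /=; apply: eq_bigr => i _.
by have Hi := ltn_ord i; rewrite Hp ?Hq //; lia.
Qed.
Lemma coef_trunc N (f : S) i : (i < N)%N -> (trunc N f)`_i = ser f i.
Proof. by move=> H; rewrite coef_poly H. Qed.

Fact smulA : associative smul.
Proof.
move=> f g h; apply: serP => j.
pose P := trunc j.+1; have HP := @coef_trunc j.+1.
have HM (a b : S) i : (i < j.+1)%N -> (P a * P b)`_i = ser (smul a b) i.
  by move=> Hi; rewrite (smul_poly Hi (HP a) (HP b)).
rewrite (smul_poly (ltnSn j) (HP f) (HM g h)) mulrA.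
by rewrite -(smul_poly (ltnSn j) (HM f g) (HP h)).
Qed.
Fact smulC : commutative smul.
Proof.
move=> f g; apply: serP => j; have HP := @coef_trunc j.+1.
by rewrite (smul_poly (ltnSn j) (HP f) (HP g)) mulrC -(smul_poly (ltnSn j) (HP g) (HP f)).
Qed.
Definition sone : S := Series (fun j => (j == 0%N)%:R).
Fact smul1 : left_id sone smul.
Proof.
move=> f; apply: serP => j /=; rewrite big_ord_recl /= mul1r subn0 big1 ?addr0 //.
by move=> i _; rewrite mul0r.
Qed.
Fact smulD : left_distributive smul sadd.
Proof.
move=> f g h; apply: serP => j /=; rewrite -big_split /=.
by apply: eq_bigr => i _; rewrite mulrDl.
Qed.
Fact sone_neq0 : sone != 0.
Proof.
apply/eqP => /(congr1 (fun f => ser f 0)) /= H.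
by have := oner_neq0 L; rewrite -[1]mulr1n H eqxx.
Qed.
HB.instance Definition _ := GRing.Zmodule_isComNzRing.Build S smulA smulC smul1 smulD sone_neq0.

Lemma serD f g j : ser (f + g : S) j = ser f j + ser g j. Proof. by []. Qed.
Lemma serB f g j : ser (f - g : S) j = ser f j - ser g j. Proof. by []. Qed.
Lemma ser0 j : ser (0 : S) j = 0. Proof. by []. Qed.
Lemma ser1 j : ser (1 : S) j = (j == 0%N)%:R. Proof. by []. Qed.
Lemma serM f g j : ser (f * g : S) j = \sum_(i < j.+1) ser f i * ser g (j - i)%N.
Proof. by []. Qed.
Lemma serM0 f g : ser (f * g : S) 0 = ser f 0 * ser g 0.
Proof. by rewrite serM big_ord1. Qed.
Lemma ser_prod0 (I : finType) (P : pred I) (F : I -> S) :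
  (forall i, P i -> ser (F i) 0 = 1) -> ser (\prod_(i | P i) F i) 0 = 1.
Proof.
move=> H; apply: (big_rec (fun x : S => ser x 0 = 1)) => // i x Hi Hx.
by rewrite serM0 H // Hx mulr1.
Qed.
Lemma ser_sum (T : Type) (r : seq T) (P : pred T) (F : T -> S) j :
  ser (\sum_(i <- r | P i) F i) j = \sum_(i <- r | P i) ser (F i) j.
Proof. exact: (big_morph (fun f : S => ser f j) (fun f g => serD f g j) (ser0 j)). Qed.

Definition pser (p : {poly L}) : S := Series (fun j => p`_j).
Lemma pserD p q : pser (p + q) = pser p + pser q.
Proof. by apply: serP => j /=; rewrite coefD. Qed.
Lemma pserM p q : pser (p * q) = pser p * pser q.
Proof. by apply: serP => j; rewrite /= coefM. Qed.
Lemma pser1 : pser 1 = 1.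
Proof. by apply: serP => j; rewrite /= coef1. Qed.
Lemma pser0 : pser 0 = 0.
Proof. by apply: serP => j; rewrite /= coef0. Qed.
Lemma pser_prod (I : Type) (r : seq I) (P : pred I) (F : I -> {poly L}) :
  pser (\prod_(i <- r | P i) F i) = \prod_(i <- r | P i) pser (F i).
Proof. exact: (big_morph pser pserM pser1). Qed.
Lemma pser_sum (I : Type) (r : seq I) (P : pred I) (F : I -> {poly L}) :
  pser (\sum_(i <- r | P i) F i) = \sum_(i <- r | P i) pser (F i).
Proof. exact: (big_morph pser pserD pser0). Qed.

Definition st : S := Series (fun j => (j == 1%N)%:R).
Definition sC (c : L) : S := Series (fun j => if j == 0%N then c else 0).
Lemma serCM c f j : ser (sC c * f) j = c * ser f j.
Proof.
rewrite serM big_ord_recl /= subn0 big1 ?addr0 // => i _; by rewrite mul0r.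
Qed.
Lemma sCD a b : sC (a + b) = sC a + sC b.
Proof. by apply: serP => -[|j] /=; rewrite ?addr0. Qed.
Lemma sCB a b : sC (a - b) = sC a - sC b.
Proof. by apply: serP => -[|j] /=; rewrite ?subr0. Qed.
Lemma sC1 : sC 1 = 1.
Proof. by apply: serP => -[|j] /=. Qed.
Lemma sCM a b : sC (a * b) = sC a * sC b.
Proof. by apply: serP => j; rewrite serCM; case: j => [|j] /=; rewrite ?mulr0. Qed.
Lemma serXM f j : ser (st * f) j.+1 = ser f j.
Proof.
rewrite serM !big_ord_recl /= mul0r add0r mul1r subn1 /= big1 ?addr0 // => i _.
by rewrite mul0r.
Qed.
Lemma serXM0 f : ser (st * f) 0 = 0.
Proof. by rewrite serM0 mul0r. Qed.
Lemma pserX : pser 'X = st.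
Proof. by apply: serP => j /=; rewrite coefX. Qed.
Lemma pserC c : pser c%:P = sC c.
Proof. by apply: serP => j /=; rewrite coefC. Qed.
Lemma serXnM n f j : ser (st ^+ n * f) j = if (j < n)%N then 0 else ser f (j - n).
Proof.
elim: n j => [|n IH] j; first by rewrite expr0 mul1r subn0.
by rewrite exprS -mulrA; case: j => [|j]; rewrite ?serXM0 // serXM IH.
Qed.

Definition lin (a : L) : S := 1 - sC a * st.
Definition geo (a : L) : S := Series (fun j => a ^+ j).
Lemma lin_geo a : lin a * geo a = 1.
Proof.
apply: serP => j; rewrite /lin mulrBl mul1r serB -mulrA serCM ser1.
by case: j => [|j]; rewrite ?serXM0 ?serXM /= ?mulr0 ?subr0 // -exprS subrr.
Qed.
Lemma lin0 a : ser (lin a) 0 = 1.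
Proof. by rewrite /lin serB serCM /= mulr0 subr0. Qed.
Lemma pser_lin a : pser (1 - a *: 'X) = lin a.
Proof. by apply: serP => j; rewrite /lin serB serCM /= coefB coefZ coefX coef1. Qed.
Lemma lin_cancel a f g : lin a * f = lin a * g -> f = g.
Proof. by move=> H; rewrite -[f]mul1r -[g]mul1r -(lin_geo a) [lin a * _]mulrC -!mulrA H. Qed.
Lemma lin_prod_geo (I : finType) (P : pred I) (a : I -> L) :
  (\prod_(i | P i) lin (a i)) * (\prod_(i | P i) geo (a i)) = 1.
Proof. by rewrite -big_split /= big1 // => i _; rewrite lin_geo. Qed.
End SeriesRing.

Section SeriesMap.
Variables (L L' : comNzRingType) (f : {rmorphism L -> L'}).
Definition smap (s : series L) : series L' := Series (fun j => f (ser s j)).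
Lemma smapM a b : smap (a * b) = smap a * smap b.
Proof.
by apply: serP => j; rewrite /= rmorph_sum; apply: eq_bigr => i _; rewrite rmorphM.
Qed.
Lemma smap1 : smap 1 = 1.
Proof. by apply: serP => j; rewrite /= rmorph_nat. Qed.
Lemma smap_prod (I : Type) (r : seq I) (P : pred I) (F : I -> series L) :
  smap (\prod_(i <- r | P i) F i) = \prod_(i <- r | P i) smap (F i).
Proof. exact: (big_morph smap smapM smap1). Qed.
Lemma smap_lin a : smap (lin a) = lin (f a).
Proof.
apply: serP => j; rewrite -[LHS]/(f (ser (lin a) j)) /lin !serB !serCM /=.
by rewrite rmorphB rmorphM !rmorph_nat.
Qed.
Lemma smap_geo a : smap (geo a) = geo (f a).
Proof. by apply: serP => j; rewrite /= rmorphXn. Qed.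
End SeriesMap.

(** * Partial fractions in the variable 1/u *)

Section PartialFractions.
Variables (L : fieldType) (J : finType) (PJ : pred J) (ze : J -> L).
Hypothesis ze0 : forall j, PJ j -> ze j != 0.
Hypothesis ze_inj : forall i j, PJ i -> PJ j -> i != j -> ze i != ze j.

Let q := #|PJ|.
Let w j : L := (\prod_(i | PJ i && (i != j)) (ze j - ze i))^-1.

Let wprod0 j : PJ j -> \prod_(i | PJ i && (i != j)) (ze j - ze i) != 0.
Proof.
move=> Hj; apply/prodf_neq0 => i /andP [Hi Hij].
by rewrite subr_eq0 eq_sym; apply: ze_inj.
Qed.

Let card_q j : PJ j -> q = #|[pred i | PJ i && (i != j)]|.+1.
Proof.
move=> Hj; rewrite /q (cardD1 j) [j \in _]Hj add1n; congr _.+1; apply: eq_card => i.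
by rewrite !inE andbC.
Qed.

(** Both sides have degree below q and agree at the q distinct points 1 / ze_j. Division by the
    product of all factors 1 - ze_j X gives the partial fraction expansion of the quotient with
    numerator X^(q-1). *)
Lemma lagrange_rev : (0 < q)%N ->
  \sum_(j | PJ j) w j *: \prod_(i | PJ i && (i != j)) (1 - ze i *: 'X) = 'X^(q.-1) :> {poly L}.
Proof.
move=> q0; apply/eqP; rewrite -subr_eq0; apply/eqP.
set Q := _ - _.
have szQ : (size Q <= q)%N.
  apply: leq_trans (size_polyD _ _) _; rewrite size_polyN size_polyXn prednK // geq_max leqnn andbT.
  apply: leq_trans (size_sum _ _ _) _; apply/bigmax_leqP => j Hj.
  apply: leq_trans (size_scale_leq _ _) _.
  apply: leq_trans (size_prod_leq _ _) _.
  have H1 : (\sum_(i | PJ i && (i != j)) size (1 - ze i *: 'X)%R <= \sum_(i | PJ i && (i != j)) 2)%N.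
    apply: leq_sum => i _; apply: leq_trans (size_polyD _ _) _.
    rewrite size_poly1 size_polyN geq_max /=.
    by apply: leq_trans (size_scale_leq _ _) _; rewrite size_polyX.
  rewrite sum_nat_const in H1.
  have H2 := card_q Hj.
  by rewrite H2; move: H1; rewrite -[#|_|]/(#|[pred i | PJ i && (i != j)]|); lia.
pose rs := [seq (ze j)^-1 | j <- enum PJ].
apply: (@roots_geq_poly_eq0 _ _ rs).
- apply/allP => x /mapP [j]; rewrite mem_enum => Hj ->.
  rewrite rootE /Q hornerD hornerN hornerXn horner_sum (bigD1 j) //= [X in _ + X - _]big1 ?addr0.
    rewrite hornerZ horner_prod subr_eq0; apply/eqP.
    rewrite (eq_bigr (fun i => (ze j)^-1 * (ze j - ze i))); last first.
      move=> i _; rewrite !hornerE /= mulrBr mulVf ?ze0 // [_ * ze i]mulrC.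
      done.
    rewrite big_split /= prodr_const mulrCA mulVf ?wprod0 // mulr1.
    by rewrite (card_q Hj).
  move=> i /andP [Hi nij]; rewrite hornerZ horner_prod (bigD1 j) /=; last by rewrite [PJ j]Hj eq_sym.
  by rewrite !hornerE /= mulfV ?ze0 // subrr mulr0 mul0r.
- rewrite map_inj_in_uniq ?enum_uniq // => i j; rewrite !mem_enum => Hi Hj /invr_inj E.
  by apply/eqP; apply/negPn/negP => /(ze_inj Hi Hj); rewrite E eqxx.
- by rewrite size_map -cardE.
Qed.

Let phi (s : seq L) m : L := \sum_(j | PJ j) (\prod_(e <- s) (ze j - e)) * w j * ze j ^+ m.
Let G : series L := \prod_(j | PJ j) geo (ze j).

Let phi_nil m : phi [::] m = if (m < q.-1)%N then 0 else if q == 0%N then 0 else ser G (m - q.-1).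
Proof.
have [q0|q0] := posnP q.
  rewrite q0 /phi /=; have H : PJ =1 pred0 by move=> j; have /card0_eq := q0; apply.
  by rewrite big_pred0.
have E : st L ^+ q.-1 * G = \sum_(j | PJ j) sC (w j) * geo (ze j).
  rewrite -pserX; have -> : pser 'X ^+ q.-1 = pser ('X^(q.-1) : {poly L}).
    by elim: q.-1 => [|n IH]; rewrite ?expr0 ?pser1 // !exprS pserM IH.
  rewrite -lagrange_rev // pser_sum mulr_suml; apply: eq_bigr => j Hj.
  rewrite -mul_polyC pserM pserC pser_prod -mulrA; congr (_ * _).
  rewrite [G](bigD1 j) //= mulrCA; under eq_bigr => i _ do rewrite pser_lin.
  by rewrite lin_prod_geo mulr1.
have H : ser (st L ^+ q.-1 * G) m = ser (\sum_(j | PJ j) sC (w j) * geo (ze j)) m by rewrite E.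
rewrite serXnM ser_sum in H.
rewrite /phi; under eq_bigr => j _ do rewrite big_nil mul1r.
rewrite /= H.
by apply: eq_bigr => j _; rewrite serCM.
Qed.

(** Induction on s: a further factor 1 - e t subtracts e times the preceding coefficient, and on the
    residue side inserts the factor ze_j - e = ze_j * 1 - e * 1. The relation between r and m keeps
    track of the degrees. *)
Lemma partial_fractions (s : seq L) m r : (r + q = m + 1 + size s)%N ->
  ser (\prod_(e <- s) lin e * G) r = phi s m.
Proof.
have phi_cons e s' m' : phi (e :: s') m' = phi s' m'.+1 - e * phi s' m'.
  rewrite /phi mulr_sumr -sumrB; apply: eq_bigr => j _; rewrite big_cons exprS; ring.
(* The second clause supplies the case r = 0, where the preceding coefficient does not exist and the
   matching residue sum must vanish. *)
suff H : (forall m r, (r + q = m + 1 + size s)%N -> ser (\prod_(e <- s) lin e * G) r = phi s m)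
       /\ (forall m, (m + 1 + size s < q)%N -> phi s m = 0).
  by case: H => H _; apply: H.
elim: s {m r} => [|e s [IH1 IH2]]; split.
- move=> m r; rewrite [size _]/= addn0 big_nil mul1r phi_nil => E.
  case: (q =P 0%N) => q0.
    have -> : r = m.+1 by lia.
    rewrite (_ : (m < q.-1)%N = false); last by lia.
    rewrite /G big_pred0 //; move=> j; have /card0_eq := q0; apply.
  by rewrite (_ : (m < q.-1)%N = false); [congr (ser _ _) | ]; lia.
- by move=> m; rewrite /= addn0 phi_nil => H; rewrite (_ : (m < q.-1)%N = true) //; lia.
- move=> m r; rewrite [size _]/= => E; rewrite big_cons phi_cons -(IH1 m.+1 r); last by lia.
  rewrite /lin mulrBl mul1r mulrBl serB -mulrA -mulrA serCM; congr (_ - _ * _).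
  case: r E => [|r] E; first by rewrite serXM0 IH2 //; lia.
  by rewrite serXM; apply: IH1; lia.
- by move=> m /= H; rewrite phi_cons !IH2 ?mulr0 ?subr0 //; lia.
Qed.
End PartialFractions.

(** * The Gelfand-Tsetlin operators *)


Section DiagonalBracket.
Variables (L : fieldType) (B : nzRingType) (iota : L -> B).
Variables (V : finType) (row : V -> nat) (z : V -> L) (tau : V -> {rmorphism L -> L}).
Variable X : V -> B.
Hypothesis HE : exchange iota row z tau X.

Lemma gsum_diag j a r (ep : L) (dd : nat -> L) :
  (forall v, row v = j -> dd r.+1 - tau v (dd r.+1) =
     ep * \sum_(t < r.+1) dd t * z v ^+ (r - t)) ->
  iota (dd r.+1) * gsum iota row z X j a - gsum iota row z X j a * iota (dd r.+1) =
  iota ep * \sum_(t < r.+1) iota (dd t) * gsum iota row z X j (a + (r - t))%N.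
Proof.
move=> H; rewrite /gsum mulr_sumr mulr_suml -sumrB.
have iN x : iota (- x) = - iota x.
  apply/eqP; rewrite -addr_eq0 -(xiD HE) addNr; apply/eqP.
  by apply: (addrI (iota 0)); rewrite -(xiD HE) !addr0.
under [X in _ * X]eq_bigr => t _ do rewrite mulr_sumr.
rewrite [in RHS]exchange_big mulr_sumr /=; apply: eq_bigr => v /eqP Hv.
have isum (F : 'I_r.+1 -> L) : iota (\sum_t F t) = \sum_t iota (F t).
  by apply: (big_morph iota (xiD HE)); apply: (addrI (iota 0)); rewrite -(xiD HE) !addr0.
rewrite -[_ * X v * _]mulrA (xX HE) !mulrA -!(xiM HE) -mulrBl -iN -(xiD HE).
rewrite [z v ^+ a * _]mulrC -mulrBl (H v Hv) -mulrA (xiM HE) -mulrA; congr (_ * _).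
rewrite mulr_suml isum mulr_suml; apply: eq_bigr => t _.
by rewrite mulrA -(xiM HE) -mulrA -exprD addnC.
Qed.
End DiagonalBracket.

Section GelfandTsetlin.
Variables (k L : fieldType) (M : zmodType) (D : skew_data k L M).
Variables (V : finType) (row : V -> nat) (z : V -> L) (mu : V -> M).
Local Notation SK := (skew_alg D).
Local Notation tau v := (act D (mu v)).
Local Notation iota := (fun a : L => sk a 0 : SK).

Record gt_data : Prop := GTData {
  gt_tau : forall v w, tau v (z w) = z w + (v == w)%:R;
  gt_ne0 : forall v w, v != w -> z v - z w != 0;
  gt_ne1 : forall v w, v != w -> z v - z w + 1 != 0;
  gt_z0 : forall v, z v != 0;
  gt_z1 : forall v, z v - 1 != 0;
  gt_two : (2%:R : L) != 0 }.
Hypothesis HG : gt_data.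

Definition gt_pr (P : pred V) (s : nat) (v : V) : L := \prod_(u | P u) (z v - z u + s%:R).
Definition gt_same v : pred V := fun u => (row u == row v) && (u != v).
Definition gt_next v : pred V := fun u => row u == (row v).+1.
Definition gt_prev v : pred V := fun u => (row u).+1 == row v.
(** The Gelfand-Tsetlin coefficients are split so that the factors of the next row go to the raising
    and those of the previous row to the lowering operators. Their product is the residue which
    [E, F] has to produce; its sign is put into [gt_b]. *)
Definition gt_c v : L := gt_pr (gt_next v) 0 v / gt_pr (gt_same v) 0 v.
Definition gt_b v : L := - (gt_pr (gt_prev v) 1 v / gt_pr (gt_same v) 1 v).

Lemma gt_ne2 v w : v != w -> z v - z w - 1 != 0.
Proof.
move=> H; rewrite (_ : _ - 1 = - (z w - z v + 1)) ?oppr_eq0 ?(gt_ne1 HG) 1?eq_sym //.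
ring.
Qed.
Lemma gt_pr_neq0 (P : pred V) s v : ~~ P v -> (s < 2)%N -> gt_pr P s v != 0.
Proof.
move=> Pv Hs; apply/prodf_neq0 => u Pu.
have nuv : v != u by apply: contraNneq Pv => ->.
by case: s Hs => [|[|//]] _; rewrite ?addr0 ?(gt_ne0 HG) ?(gt_ne1 HG).
Qed.
Lemma gt_same_neq0 s v : (s < 2)%N -> gt_pr (gt_same v) s v != 0.
Proof. by apply: gt_pr_neq0; rewrite /gt_same !eqxx. Qed.

Lemma tau_pr_out (P : pred V) s v w : w != v -> ~~ P w -> tau w (gt_pr P s v) = gt_pr P s v.
Proof.
move=> nwv Pw; rewrite rmorph_prod; apply: eq_bigr => u Pu.
have nwu : w != u by apply: contraNneq Pw => ->.
by rewrite rmorphD rmorphB /= !(gt_tau HG) (negbTE nwv) (negbTE nwu) !addr0 rmorph_nat.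
Qed.
Lemma tau_pr_in (P : pred V) s v w : w != v -> P w ->
  tau w (gt_pr P s v) * (z v - z w + s%:R) = gt_pr P s v * (z v - z w - 1 + s%:R).
Proof.
move=> nwv Pw; rewrite /gt_pr (bigD1 w) //= rmorphM.
have := @tau_pr_out (fun u => P u && (u != w)) s v w nwv; rewrite /= eqxx andbF => /(_ isT).
rewrite /gt_pr => ->; rewrite rmorphD rmorphB /= !(gt_tau HG) (negbTE nwv) eqxx rmorph_nat.
by rewrite [true%:R]mulr1n addr0; ring.
Qed.

Lemma tau_c_same v w : w != v -> row w = row v ->
  tau w (gt_c v) = gt_c v * ((z v - z w) / (z v - z w - 1)).
Proof.
move=> nwv E; rewrite /gt_c rmorphM fmorphV tau_pr_out //; last first.
  by rewrite /gt_next E; lia.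
have nvw : v != w by rewrite eq_sym.
have Hw : gt_same v w by rewrite /gt_same E eqxx.
have := tau_pr_in 0 nwv Hw; rewrite !addr0 => H.
have h1 := gt_ne0 HG nvw; have h2 := gt_ne2 nvw; have h3 := gt_same_neq0 v (isT : 0 < 2)%N.
have -> : tau w (gt_pr (gt_same v) 0 v) = gt_pr (gt_same v) 0 v * (z v - z w - 1) / (z v - z w).
  by rewrite -H mulfK.
by field; rewrite h1 h2 h3.
Qed.
Lemma tau_c_next v w : row w = (row v).+1 ->
  tau w (gt_c v) = gt_c v * ((z v - z w - 1) / (z v - z w)).
Proof.
move=> E; have nwv : w != v by apply: contra_eqN E => /eqP ->; lia.
rewrite /gt_c rmorphM fmorphV (tau_pr_out 0 (P := gt_same v)) //; last first.
  by rewrite /gt_same E; lia.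
have nvw : v != w by rewrite eq_sym.
have Hw : gt_next v w by rewrite /gt_next E.
have := tau_pr_in 0 nwv Hw; rewrite !addr0 => H.
have h1 := gt_ne0 HG nvw; have h3 := gt_same_neq0 v (isT : 0 < 2)%N.
have -> : tau w (gt_pr (gt_next v) 0 v) = gt_pr (gt_next v) 0 v * (z v - z w - 1) / (z v - z w).
  by rewrite -H mulfK.
by field; rewrite h1 h3.
Qed.
Lemma tau_c_far v w : row w != row v -> row w != (row v).+1 -> tau w (gt_c v) = gt_c v.
Proof.
move=> E E'; have nwv : w != v by apply: contraNneq E => ->.
by rewrite /gt_c rmorphM fmorphV !tau_pr_out // /gt_same ?(negbTE E).
Qed.

Lemma tau_b_same v w : w != v -> row w = row v ->
  tau w (gt_b v) = gt_b v * ((z v - z w + 1) / (z v - z w)).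
Proof.
move=> nwv E; rewrite /gt_b rmorphN rmorphM fmorphV (tau_pr_out 1 (P := gt_prev v)) //; last first.
  by rewrite /gt_prev E; lia.
have nvw : v != w by rewrite eq_sym.
have Hw : gt_same v w by rewrite /gt_same E eqxx.
have := tau_pr_in 1 nwv Hw; rewrite subrK => H.
have h1 := gt_ne0 HG nvw; have h2 := gt_ne1 HG nvw; have h3 := gt_same_neq0 v (isT : 1 < 2)%N.
have -> : tau w (gt_pr (gt_same v) 1 v) = gt_pr (gt_same v) 1 v * (z v - z w) / (z v - z w + 1).
  by rewrite -H mulfK.
by field; rewrite h1 h2 h3.
Qed.
Lemma tau_b_prev v w : row v = (row w).+1 ->
  tau w (gt_b v) = gt_b v * ((z v - z w) / (z v - z w + 1)).
Proof.
move=> E; have nwv : w != v by apply: contra_eqN E => /eqP ->; lia.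
rewrite /gt_b rmorphN rmorphM fmorphV (tau_pr_out 1 (P := gt_same v)) //; last first.
  by rewrite /gt_same E; lia.
have nvw : v != w by rewrite eq_sym.
have Hw : gt_prev v w by rewrite /gt_prev E.
have := tau_pr_in 1 nwv Hw; rewrite subrK => H.
have h1 := gt_ne1 HG nvw; have h3 := gt_same_neq0 v (isT : 1 < 2)%N.
have -> : tau w (gt_pr (gt_prev v) 1 v) = gt_pr (gt_prev v) 1 v * (z v - z w) / (z v - z w + 1).
  by rewrite -H mulfK.
by field; rewrite h1 h3.
Qed.
Lemma tau_b_far v w : row w != row v -> row v != (row w).+1 -> tau w (gt_b v) = gt_b v.
Proof.
move=> E E'; have nwv : w != v by apply: contraNneq E => ->.
by rewrite /gt_b rmorphN rmorphM fmorphV !tau_pr_out // /gt_same /gt_prev ?(negbTE E) // eq_sym.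
Qed.

Definition gt_X v : SK := sk (gt_c v) (mu v).
Definition gt_Y v : SK := sk 1 (- mu v) * sk (gt_b v) 0.

Lemma iotaM a b : sk (a * b) 0 = sk a 0 * sk b 0 :> SK.
Proof. by rewrite skM act0 addr0. Qed.
Lemma XX v w : gt_X v * gt_X w = iota (gt_c v * tau v (gt_c w)) * sk 1 (mu v + mu w).
Proof. by rewrite !skM act0 add0r mulr1. Qed.
Lemma YY v w : gt_Y v * gt_Y w = sk 1 (- (mu v + mu w)) * iota (tau w (gt_b v) * gt_b w).
Proof.
have h : sk (gt_b v) 0 * sk 1 (- mu w) = sk 1 (- mu w) * sk (tau w (gt_b v)) 0 :> SK.
  by rewrite !skM rmorph1 mulr1 mul1r -actD addNr act0 addrC.
rewrite /gt_Y -mulrA [sk (gt_b v) 0 * _]mulrA h iotaM !mulrA skM rmorph1 mulr1 opprD.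
done.
Qed.

Lemma YY_iota v w x : gt_Y v * gt_Y w * sk x 0 =
  sk 1 (- (mu v + mu w)) * iota (tau w (gt_b v) * gt_b w * x).
Proof. by rewrite YY -mulrA -iotaM. Qed.

Lemma exchangeX : exchange iota row z (fun v => tau v) gt_X.
Proof.
split.
- by move=> a b; exact: skD.
- by move=> a b; exact: iotaM.
- by [].
- exact: (gt_tau HG).
- exact: (gt_ne0 HG).
- exact: (gt_ne1 HG).
- by move=> v a; rewrite !skM act0 addr0 add0r mulrC.
- move=> v w E nvw; rewrite !XX [mu w + _]addrC !mulrA -!iotaM; congr (sk _ 0 * _).
  have nwv : w != v by rewrite eq_sym.
  rewrite !tau_c_same // ?E //.
  have := gt_ne2 nvw; have := gt_ne2 nwv => h1 h2; have h3 := gt_ne1 HG nvw.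
  by field; rewrite h1 h2.
- move=> v w E; rewrite !XX [mu w + _]addrC !mulrA -!iotaM; congr (sk _ 0 * _).
  have nvw : v != w by apply: contra_eqN E => /eqP ->; lia.
  rewrite (tau_c_next E) tau_c_far ?E; try lia.
  by have h := gt_ne0 HG nvw; field.
- move=> v w E; rewrite !XX [mu w + _]addrC; congr (sk _ 0 * _).
  rewrite !tau_c_far; try lia.
  by rewrite mulrC.
Qed.

Lemma exchangeY : @exchange L (SK^c) iota V row z (fun v => tau v) gt_Y.
Proof.
split.
- by move=> a b; exact: skD.
- by move=> a b; rewrite mulrC; apply: iotaM.
- by [].
- exact: (gt_tau HG).
- exact: (gt_ne0 HG).
- exact: (gt_ne1 HG).
- move=> v a; rewrite -[LHS]/(sk a 0 * gt_Y v : SK) -[RHS]/(gt_Y v * sk (tau v a) 0 : SK).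
  rewrite /gt_Y -[RHS]mulrA -iotaM [gt_b v * _]mulrC iotaM !mulrA; congr (_ * _).
  by rewrite !skM rmorph1 mulr1 mul1r add0r addr0 -actD addNr act0.
- move=> v w E nvw.
  rewrite -[LHS]/(gt_Y w * gt_Y v * sk (z v - z w + 1) 0 : SK).
  rewrite -[RHS]/(gt_Y v * gt_Y w * sk (z v - z w - 1) 0 : SK).
  apply: etrans (YY_iota w v _) _; apply: etrans _ (esym (YY_iota v w _)).
  rewrite [mu w + _]addrC; congr (_ * sk _ 0).
  have nwv : w != v by rewrite eq_sym.
  rewrite !tau_b_same // ?E //.
  have h1 := gt_ne0 HG nvw; have h2 := gt_ne0 HG nwv.
  by field; rewrite h1 h2.
- move=> v w E.
  rewrite -[LHS]/(gt_Y w * gt_Y v * sk (z v - z w - 1) 0 : SK).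
  rewrite -[RHS]/(gt_Y v * gt_Y w * sk (z v - z w) 0 : SK).
  apply: etrans (YY_iota w v _) _; apply: etrans _ (esym (YY_iota v w _)).
  rewrite [mu w + _]addrC; congr (_ * sk _ 0).
  have nvw : v != w by apply: contra_eqN E => /eqP ->; lia.
  have nwv : w != v by rewrite eq_sym.
  rewrite (tau_b_prev E) tau_b_far ?E; try lia.
  by have h := gt_ne1 HG nwv; field.
- move=> v w E.
  rewrite -[LHS]/(gt_Y w * gt_Y v : SK) -[RHS]/(gt_Y v * gt_Y w : SK).
  rewrite !YY [mu w + _]addrC; congr (_ * sk _ 0).
  by rewrite !tau_b_far; try lia; rewrite mulrC.
Qed.
End GelfandTsetlin.


Section DinvRecursion.
Variables (k : fieldType) (A : algType k) (d : nat -> nat -> A).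
Lemma size_Dinvs i r : size (Dinvs d i r) = r.+1.
Proof. by elim: r => //= r IH; rewrite size_rcons IH. Qed.
Lemma nth_Dinvs i r t : (t <= r)%N -> nth 0 (Dinvs d i r) t = Dinv d i t.
Proof.
elim: r => [|r IH]; first by rewrite leqn0 => /eqP ->.
rewrite leq_eqVlt => /orP [/eqP -> //|]; rewrite ltnS => H.
by rewrite /= nth_rcons size_Dinvs ltnS H IH.
Qed.
Lemma Dinv0 i : Dinv d i 0 = 1.
Proof. by []. Qed.
Lemma DinvS i r : Dinv d i r.+1 = - \sum_(t < r.+1) d i t.+1 * Dinv d i (r - t)%N.
Proof.
rewrite /Dinv /= nth_rcons size_Dinvs ltnn eqxx; congr (- _).
by apply: eq_bigr => t _; rewrite nth_Dinvs // leq_subr.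
Qed.
End DinvRecursion.

(** * Commutators of diagonal, raising and lowering operators *)

Section GTRelations.
Variables (k L : fieldType) (M : zmodType) (D : skew_data k L M).
Variables (V : finType) (row : V -> nat) (z : V -> L) (mu : V -> M).
Local Notation SK := (skew_alg D).
Local Notation tau v := (act D (mu v)).
Local Notation iota := (fun a : L => sk a 0 : SK).
Hypothesis HG : gt_data D z mu.
Variables (n : nat) (p : nat -> nat).
Hypothesis p_sorted : forall i, (i.+1 < n)%N -> (p i <= p i.+1)%N.
Hypothesis card_row : forall i, (i < n)%N -> #|[pred v | row v == i]| = msum p i.

Local Notation X := (gt_X D row z mu).
Local Notation Y := (gt_Y D row z mu).

Definition gt_dser i : series L :=
  \prod_(w | row w == i) lin (z w) * \prod_(w | (row w).+1 == i) geo (z w - 1).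
Definition gt_dinv i : series L :=
  \prod_(w | row w == i) geo (z w) * \prod_(w | (row w).+1 == i) lin (z w - 1).
Definition gt_d i r : SK := sk (ser (gt_dser i) r) 0.
Definition gt_E i a : SK := \sum_(v | row v == i) sk (z v ^+ a) 0 * X v.
Definition gt_F i a : SK := \sum_(v | row v == i) Y v * sk (z v ^+ a) 0.
Definition gt_e i r : SK := gt_E i (r - 1 - yshift p i).
Definition gt_f i r : SK := gt_F i (r - 1).

Lemma dser0 i : ser (gt_dser i) 0 = 1.
Proof.
rewrite /gt_dser serM0 !ser_prod0 ?mulr1 // => w _; exact: lin0.
Qed.
Lemma dinv_dser i : gt_dinv i * gt_dser i = 1.
Proof.
by rewrite /gt_dinv /gt_dser mulrACA [X in X * _]mulrC !lin_prod_geo mulr1.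
Qed.

(** As series, the difference is ep t D_i / (1 - z_v t): the shift changes only the factor of v,
    which is in the numerator for i = row v, in the denominator for i = row v + 1, and absent
    otherwise. *)
Lemma dser_tau v i r : ser (gt_dser i) r.+1 - tau v (ser (gt_dser i) r.+1) =
  ((i == row v)%:R - (i == (row v).+1)%:R) *
  \sum_(t < r.+1) ser (gt_dser i) t * z v ^+ (r - t).
Proof.
set ep := _ - (i == _)%:R.
suff H : gt_dser i - smap (tau v) (gt_dser i) = sC ep * (st L * (gt_dser i * geo (z v))).
  have : ser (gt_dser i - smap (tau v) (gt_dser i)) r.+1 =
         ser (sC ep * (st L * (gt_dser i * geo (z v)))) r.+1 by rewrite H.
  by rewrite serB serCM serXM serM.
rewrite /gt_dser smapM !smap_prod.
under [X in _ - X * _]eq_bigr => w _ do rewrite smap_lin (gt_tau HG).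
under [X in _ - _ * X]eq_bigr => w _ do rewrite smap_geo rmorphB rmorph1 /= (gt_tau HG).
have tv w : w != v -> z w + (v == w)%:R = z w by rewrite eq_sym => /negbTE ->; rewrite addr0.
have lg := @lin_geo L.
have [Ei|nei] := eqVneq i (row v).
  have -> : ep = 1 by rewrite /ep Ei eqxx (_ : (_ == _.+1) = false) ?subr0 //; lia.
  rewrite sC1 mul1r.
  rewrite [X in X * _ - _](bigD1 v) ?Ei //= [X in _ - X * _](bigD1 v) //=.
  rewrite [X in _ = _ * (X * _ * _)](bigD1 v) //=.
  rewrite [X in _ - _ * X](eq_bigr (fun w => geo (z w - 1))); last first.
    by move=> w Hw; rewrite tv //; apply: contraTneq Hw => ->; lia.
  rewrite [X in _ - (_ * X) * _](eq_bigr (fun w => lin (z w))); last first.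
    by move=> w /andP [_ Hw]; rewrite tv.
  set P := \prod_(_ | _ && _) _; set Q := \prod_(_ | _) _.
  have -> : st L * (lin (z v) * P * Q * geo (z v)) = st L * P * Q * (lin (z v) * geo (z v)) by ring.
  rewrite lg eqxx /lin sCD [true%:R]mulr1n sC1; ring.
have [Ei'|nei'] := eqVneq i (row v).+1.
  have -> : ep = -1 by rewrite /ep (negbTE nei) Ei' eqxx [true%:R]mulr1n add0r.
  rewrite [X in _ * X - _](bigD1 v) ?Ei' //= [X in _ - _ * X](bigD1 v) //=.
  rewrite [X in _ = _ * (_ * (_ * X * _))](bigD1 v) //=.
  rewrite [X in _ - X * _](eq_bigr (fun w => lin (z w))); last first.
    by move=> w Hw; rewrite tv //; apply: contraTneq Hw => ->; lia.
  rewrite [X in _ - _ * (_ * X)](eq_bigr (fun w => geo (z w - 1))); last first.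
    by move=> w /andP [_ Hw]; rewrite tv.
  set P := \prod_(_ | row _ == _) _; set Q := \prod_(_ | _ && _) _.
  have -> : z v + (v == v)%:R - 1 = z v by rewrite eqxx addrK.
  have h1 := lg (z v); have h2 := lg (z v - 1).
  set g := geo (z v) in h1 *; set g' := geo (z v - 1) in h2 *.
  have E : g' - g = - (st L * (g' * g)).
    have -> : g' - g = g' * (lin (z v) * g) - g * (lin (z v - 1) * g') by rewrite h1 h2 !mulr1.
    rewrite /lin sCB sC1; ring.
  have -> : sC (-1 : L) = -1.
    by rewrite -[-1]sub0r sCB sC1 (_ : sC 0 = 0) ?sub0r //; apply: serP => -[].
  have -> : P * (g' * Q) - P * (g * Q) = P * Q * (g' - g) by ring.
  rewrite E; ring.
have -> : ep = 0 by rewrite /ep (negbTE nei) (negbTE nei') subr0.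
have -> : sC (0 : L) = 0 by apply: serP => -[].
rewrite mul0r [X in _ - X * _](eq_bigr (fun w => lin (z w))); last first.
  by move=> w Hw; rewrite tv //; apply: contraTneq Hw => ->; rewrite eq_sym.
rewrite [X in _ - _ * X](eq_bigr (fun w => geo (z w - 1))) ?subrr //.
by move=> w Hw; rewrite tv //; apply: contraTneq Hw => ->; rewrite eq_sym.
Qed.

Lemma iota_sum (T : Type) (r : seq T) (P : pred T) (F : T -> L) :
  sk (\sum_(i <- r | P i) F i) 0 = \sum_(i <- r | P i) sk (F i) 0 :> SK.
Proof. by apply: (big_morph (fun a : L => (sk a 0 : SK))) => [a b|]; [exact: skD|exact: sk0]. Qed.
Lemma iotaN a : sk (- a) 0 = - sk a 0 :> SK.
Proof. by apply/eqP; rewrite -addr_eq0 -skD addNr sk0. Qed.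
Lemma iotaB a b : sk (a - b) 0 = sk a 0 - sk b 0 :> SK.
Proof. by rewrite skD iotaN. Qed.
Lemma iota_nat m : sk m%:R 0 = m%:R :> SK.
Proof. by elim: m => [|m IH]; rewrite ?sk0 // -addn1 !natrD skD IH. Qed.

Lemma Dc_gt i r : Dc gt_d i r = sk (ser (gt_dser i) r) 0.
Proof. by rewrite /Dc; case: eqP => // ->; rewrite dser0. Qed.

Lemma Dinv_gt i r : Dinv gt_d i r = sk (ser (gt_dinv i) r) 0.
Proof.
elim/ltn_ind: r => -[|r] IH.
  by rewrite Dinv0 /gt_dinv serM0 !ser_prod0 ?mulr1 // => w _; exact: lin0.
rewrite DinvS.
have H : ser (gt_dser i * gt_dinv i) r.+1 = 0 by rewrite mulrC dinv_dser.
rewrite serM big_ord_recl dser0 mul1r subn0 in H.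
move/eqP: H; rewrite addr_eq0 => /eqP ->; rewrite iotaN iota_sum; congr (- _).
apply: eq_bigr => t _; rewrite IH ?ltnS ?leq_subr // -iotaM.
by congr (sk _ _); rewrite /bump add1n subSS.
Qed.

Lemma iota_int_mul (ep : L) (x : SK) b b' : ep = b%:R - b'%:R -> sk ep 0 * x = (b%:R - b'%:R) * x.
Proof. by move=> ->; rewrite iotaB !iota_nat. Qed.

Lemma comm_d_E i j r a : sk (ser (gt_dser i) r.+1) 0 * gt_E j a - gt_E j a * sk (ser (gt_dser i) r.+1) 0
  = ((i == j)%:R - (i == j.+1)%:R) *
    \sum_(t < r.+1) sk (ser (gt_dser i) t) 0 * gt_E j (a + (r - t))%N.
Proof.
rewrite -(@iota_int_mul ((i == j)%:R - (i == j.+1)%:R)) //.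
apply: (gsum_diag (exchangeX row HG)) => v Hv.
by rewrite dser_tau Hv.
Qed.

Lemma comm_d_F i j r a : sk (ser (gt_dser i) r.+1) 0 * gt_F j a - gt_F j a * sk (ser (gt_dser i) r.+1) 0
  = ((i == j.+1)%:R - (i == j)%:R) *
    \sum_(t < r.+1) gt_F j (a + (r - t))%N * sk (ser (gt_dser i) t) 0.
Proof.
rewrite -opprB; apply: (canLR opprK).
have H := gsum_diag (exchangeY row HG) (j := j) a (r := r)
   (ep := (i == j)%:R - (i == j.+1)%:R) (dd := ser (gt_dser i)).
have -> : gt_F j a * sk (ser (gt_dser i) r.+1) 0 - sk (ser (gt_dser i) r.+1) 0 * gt_F j a =
   (\sum_(t < r.+1) gt_F j (a + (r - t))%N * sk (ser (gt_dser i) t) 0) *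
     sk ((i == j)%:R - (i == j.+1)%:R) 0.
  by apply: H => v Hv; rewrite dser_tau Hv.
rewrite iotaB !iota_nat -mulNr opprB mulrBl mulrBr.
by rewrite !mulr_natl !mulr_natr.
Qed.

Definition gt_h v : L := gt_c row z v * gt_b row z v.
Local Notation sigma v := (act D (- mu v)).

(** Once the shifts are moved together, the claim is tau_w(c_v) tau_v(b_w) = c_v b_w. The two
    correction factors are reciprocal for equal and for adjacent rows, and equal to 1 in the other
    cases. *)
Lemma E_F_ne v w a b : v != w ->
  (sk (z v ^+ a) 0 * X v) * (Y w * sk (z w ^+ b) 0) = (Y w * sk (z w ^+ b) 0) * (sk (z v ^+ a) 0 * X v).
Proof.
move=> nvw; have nwv : w != v by rewrite eq_sym.
have tz u t c : u != t -> tau u (z t ^+ c) = z t ^+ c.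
  by move=> /negbTE H; rewrite rmorphXn /= (gt_tau HG) H addr0.
have XE : sk (z v ^+ a) 0 * X v = sk (z v ^+ a * gt_c row z v) (mu v).
  by rewrite skM act0 add0r.
have YE : Y w * sk (z w ^+ b) 0 = sk 1 (- mu w) * sk (gt_b row z w * z w ^+ b) 0.
  by rewrite /gt_Y -mulrA -iotaM.
have sw x m : sk x m * sk 1 (- mu w) = sk 1 (- mu w) * sk (tau w x) m :> SK.
  by rewrite !skM rmorph1 mulr1 mul1r -actD addNr act0 addrC.
rewrite XE YE mulrA sw -!mulrA; congr (_ * _).
rewrite !skM act0 addr0 add0r; congr (sk _ _).
rewrite [act D (mu w) (_ * _)]rmorphM [act D (mu v) (_ * _)]rmorphM /= !tz //.
suff E : tau w (gt_c row z v) * tau v (gt_b row z w) = gt_c row z v * gt_b row z w.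
  transitivity (z v ^+ a * z w ^+ b * (tau w (gt_c row z v) * tau v (gt_b row z w))); first ring.
  rewrite E; ring.
have h1 := gt_ne0 HG nvw; have h2 := gt_ne2 HG nvw; have h3 := gt_ne0 HG nwv.
have h4 := gt_ne1 HG nwv.
have [E|ne] := eqVneq (row v) (row w).
  rewrite (tau_c_same HG) // ?(tau_b_same HG) //.
  by field; rewrite h2 h3.
have [E|ne'] := eqVneq (row w) (row v).+1.
  rewrite (tau_c_next HG) // (tau_b_prev HG) //.
  by field; rewrite h1 h4.
by rewrite (tau_c_far HG) ?(tau_b_far HG) // eq_sym.
Qed.

Lemma E_F_eq v a b :
  (sk (z v ^+ a) 0 * X v) * (Y v * sk (z v ^+ b) 0) - (Y v * sk (z v ^+ b) 0) * (sk (z v ^+ a) 0 * X v)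
  = sk (gt_h v * z v ^+ (a + b) - sigma v (gt_h v * z v ^+ (a + b))) 0.
Proof.
have XE : sk (z v ^+ a) 0 * X v = sk (z v ^+ a * gt_c row z v) (mu v).
  by rewrite skM act0 add0r.
have YE : Y v * sk (z v ^+ b) 0 = sk 1 (- mu v) * sk (gt_b row z v * z v ^+ b) 0.
  by rewrite /gt_Y -mulrA -iotaM.
rewrite XE YE [X in X - _]mulrA iotaB; congr (_ - _).
  by rewrite !skM rmorph1 mulr1 subrr act0 addr0 /gt_h exprD; congr (sk _ 0); ring.
by rewrite !skM !mul1r addr0 addNr /gt_h exprD -rmorphM; congr (sk (act _ _ _) 0); ring.
Qed.

Lemma comm_E_F i j a b : gt_E i a * gt_F j b - gt_F j b * gt_E i a =
  if i == j then sk (\sum_(v | row v == i)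
     (gt_h v * z v ^+ (a + b) - sigma v (gt_h v * z v ^+ (a + b)))) 0 else 0.
Proof.
rewrite /gt_E /gt_F !big_distrlr /= [X in _ - X]exchange_big /= -sumrB.
have [<-|nij] := eqVneq i j.
  rewrite iota_sum; apply: eq_bigr => v Hv; rewrite -sumrB (bigD1 v) //= [X in _ + X]big1.
    by rewrite addr0; exact: E_F_eq.
  by move=> w /andP [_ Hw]; apply/eqP; rewrite subr_eq0 E_F_ne // eq_sym.
apply: big1 => v /eqP Hv; rewrite -sumrB; apply: big1 => w /eqP Hw.
by apply/eqP; rewrite subr_eq0 E_F_ne //; apply: contraNneq nij => E; rewrite -Hv -Hw E.
Qed.

Lemma card_prev i : (i < n)%N -> (#|[pred u | (row u).+1 == i]| + p i = msum p i)%N.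
Proof.
case: i => [|i] Hi; first by rewrite /msum big_ord1 eq_card0.
rewrite /msum big_ord_recr /= -/(msum p i) -card_row; last lia.
by congr (_ + _)%N; apply: eq_card => u; rewrite !inE.
Qed.

(** The poles are indexed by pairs (v, b) with value z_v - b. The pole z_v contributes -h_v z_v^m
    and the pole z_v - 1 its shifted negative. The numerator has p_{i+1} - p_i more factors than
    there are poles, which is where the shift in r comes from. *)
Lemma residues i m r : (i.+1 < n)%N -> (r = m + 1 + yshift p i)%N ->
  ser (gt_dinv i * gt_dser i.+1) r =
  - \sum_(v | row v == i) (gt_h v * z v ^+ m - sigma v (gt_h v * z v ^+ m)).
Proof.
move=> Hi Hr.
pose ze (j : V * bool) : L := z j.1 - j.2%:R.
pose PJ (j : V * bool) := row j.1 == i.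
pose s : seq L := [seq z u | u <- enum [pred u | row u == i.+1]]
               ++ [seq z u - 1 | u <- enum [pred u | (row u).+1 == i]].
have ze0 j : PJ j -> ze j != 0.
  by case: j => v [] _; rewrite /ze /= ?subr0 ?(gt_z0 HG) ?(gt_z1 HG).
have ze_inj j j' : PJ j -> PJ j' -> j != j' -> ze j != ze j'.
  case: j j' => v b [v' b'] _ _; rewrite -subr_eq0 /ze /=.
  have [<-|nvv] := eqVneq v v'.
    have -> : z v - b%:R - (z v - b'%:R) = b'%:R - b%:R by ring.
    by case: b b' => [] [] //=; rewrite ?eqxx // ?subr0 ?sub0r ?oppr_eq0 oner_neq0.
  move=> _; have nv' : v' != v by rewrite eq_sym.
  have -> : z v - b%:R - (z v' - b'%:R) = z v - z v' + (b'%:R - b%:R) by ring.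
  case: b b' => [] []; rewrite ?subrr ?addr0 ?subr0 ?sub0r ?(gt_ne0 HG) ?(gt_ne1 HG) //.
  exact: gt_ne2 HG _ _ nvv.
have HS : gt_dinv i * gt_dser i.+1 = \prod_(e <- s) lin e * \prod_(j | PJ j) geo (ze j).
  have -> : \prod_(j | PJ j) geo (ze j) = \prod_(v | row v == i) (geo (z v - 1) * geo (z v)).
    rewrite (eq_bigl (fun j : V * bool => (row j.1 == i) && predT j.2)); last first.
      by move=> j; rewrite andbT.
    rewrite (eq_bigr (fun j : V * bool => geo (z j.1 - j.2%:R))) //.
    rewrite -(pair_big (fun v => row v == i) predT (fun v (b : bool) => geo (z v - b%:R))) /=.
    by apply: eq_bigr => v _; rewrite big_bool /= subr0.
  rewrite big_cat !big_map !big_enum /= big_split /= /gt_dinv /gt_dser.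
  have -> : \prod_(w | (row w).+1 == i.+1) geo (z w - 1) = \prod_(w | row w == i) geo (z w - 1).
    by apply: eq_bigl => w.
  ring.
rewrite HS (partial_fractions ze0 ze_inj (m := m)); last first.
  rewrite size_cat !size_map -!cardE card_row //.
  have -> : #|PJ| = (msum p i + msum p i)%N.
    rewrite -card_row; last lia.
    have -> : #|PJ| = #|predX [pred v | row v == i] (predT : pred bool)|.
      by apply: eq_card => j; rewrite !inE andbT.
    by rewrite cardX card_bool muln2 addnn.
  have h2 := card_prev (ltnW Hi).
  have h1 : msum p i.+1 = (msum p i + p i.+1)%N by rewrite /msum big_ord_recr.
  move: Hr (p_sorted Hi); rewrite h1 -h2 /yshift; move: #|_| => c; lia.
rewrite (eq_bigl (fun j : V * bool => (row j.1 == i) && predT j.2)); last first.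
  by move=> j; rewrite andbT.
pose T v (b : bool) := \prod_(e <- s) (ze (v, b) - e) *
  (\prod_(j | PJ j && (j != (v, b))) (ze (v, b) - ze j))^-1 * ze (v, b) ^+ m.
rewrite (eq_bigr (fun j => T j.1 j.2)); last by case.
rewrite -(pair_big (fun v => row v == i) predT T) /= -sumrN.
apply: eq_bigr => v /eqP Hv; rewrite big_bool /= addrC opprB addrC -[RHS]addrC.
have num (x : L) : \prod_(e <- s) (x - e) =
    (\prod_(u | row u == i.+1) (x - z u)) * \prod_(u | (row u).+1 == i) (x - (z u - 1)).
  by rewrite /s big_cat !big_map !big_enum.
have den b : \prod_(j | PJ j && (j != (v, b))) (ze (v, b) - ze j) =
    (\prod_(u | (row u == i) && (u != v)) (z v - z u)) *
    (\prod_(u | row u == i) (z v - b%:R - (z u - (~~ b)%:R))).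
  rewrite (eq_bigr (fun j : V * bool => z v - b%:R - (z j.1 - j.2%:R))) //.
  rewrite -(pair_big_dep (fun u => row u == i) (fun u b' => (u, b') != (v, b))
     (fun u b' => z v - b%:R - (z u - b'%:R))) /=.
  transitivity (\prod_(u | row u == i)
     ((if u != v then z v - z u else 1) * (z v - b%:R - (z u - (~~ b)%:R)))).
    apply: eq_bigr => u _; rewrite big_mkcond big_bool /= !xpair_eqE.
    case: (b); case: eqP => //= _; rewrite ?mul1r ?mulr1 //.
      by congr (_ * _); ring.
    by rewrite mulrC; congr (_ * _); ring.
  by rewrite big_split /= -big_mkcondr.
have sz u : sigma v (z u) = z u - (v == u)%:R.
  have := gt_tau HG v u => /(congr1 (sigma v)); rewrite -actD addNr act0 rmorphD /= rmorph_nat.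
  by move=> H; rewrite [in RHS]H addrK.
have spr (P : pred V) t : ~~ P v -> sigma v (gt_pr z P t v) = \prod_(u | P u) (z v - 1 - z u + t%:R).
  move=> Pv; rewrite rmorph_prod; apply: eq_bigr => u Pu.
  have nuv : v != u by apply: contraNneq Pv => ->.
  by rewrite rmorphD rmorphB /= !sz eqxx (negbTE nuv) subr0 rmorph_nat.
have sameE (F : V -> L) : \prod_(u | (row u == i) && (u != v)) F u = \prod_(u | gt_same row v u) F u.
  by apply: eq_bigl => u; rewrite /gt_same Hv.
have nextE (F : V -> L) : \prod_(u | row u == i.+1) F u = \prod_(u | gt_next row v u) F u.
  by apply: eq_bigl => u; rewrite /gt_next Hv.
have prevE (F : V -> L) : \prod_(u | (row u).+1 == i) F u = \prod_(u | gt_prev row v u) F u.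
  by apply: eq_bigl => u; rewrite /gt_prev Hv.
have s0 := gt_same_neq0 row HG v (isT : 0 < 2)%N.
have s1 := gt_same_neq0 row HG v (isT : 1 < 2)%N.
have nn : ~~ gt_next row v v by rewrite /gt_next; lia.
have np : ~~ gt_prev row v v by rewrite /gt_prev; lia.
have ns : ~~ gt_same row v v by rewrite /gt_same !eqxx.
have Tf : T v false = - (gt_h v * z v ^+ m).
  rewrite /T num den /ze /= !subr0.
  rewrite [X in (_ * X)^-1](bigD1 v) ?Hv //= !sameE nextE prevE.
  have -> : \prod_(u | gt_next row v u) (z v - z u) = gt_pr z (gt_next row v) 0 v.
    by apply: eq_bigr => u _; rewrite addr0.
  have -> : \prod_(u | gt_prev row v u) (z v - (z u - 1)) = gt_pr z (gt_prev row v) 1 v.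
    by apply: eq_bigr => u _; rewrite opprB addrCA addrC.
  have -> : \prod_(u | gt_same row v u) (z v - z u) = gt_pr z (gt_same row v) 0 v.
    by apply: eq_bigr => u _; rewrite addr0.
  have -> : \prod_(u | gt_same row v u) (z v - (z u - 1)) = gt_pr z (gt_same row v) 1 v.
    by apply: eq_bigr => u _; rewrite opprB addrCA addrC.
  rewrite opprB subrKC mul1r /gt_h /gt_c /gt_b.
  by field; rewrite s0 s1.
have Tt : T v true = sigma v (gt_h v * z v ^+ m).
  rewrite /T num den /ze /=.
  rewrite [X in (_ * X)^-1](bigD1 v) ?Hv //= !sameE nextE prevE.
  have s0' : sigma v (gt_pr z (gt_same row v) 0 v) != 0 by rewrite fmorph_eq0.
  have s1' : sigma v (gt_pr z (gt_same row v) 1 v) != 0 by rewrite fmorph_eq0.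
  rewrite rmorphM rmorphXn /= sz eqxx /gt_h /gt_c /gt_b.
  rewrite rmorphM rmorphM fmorphV rmorphN rmorphM fmorphV.
  have -> : \prod_(u | gt_next row v u) (z v - 1 - z u) = sigma v (gt_pr z (gt_next row v) 0 v).
    by rewrite spr //; apply: eq_bigr => u _; rewrite addr0.
  have -> : \prod_(u | gt_prev row v u) (z v - 1 - (z u - 1)) = sigma v (gt_pr z (gt_prev row v) 1 v).
    by rewrite spr //; apply: eq_bigr => u _; ring.
  have -> : \prod_(u | gt_same row v u) (z v - z u) = sigma v (gt_pr z (gt_same row v) 1 v).
    by rewrite spr //; apply: eq_bigr => u _; ring.
  have -> : \prod_(u | gt_same row v u) (z v - 1 - (z u - 0)) = sigma v (gt_pr z (gt_same row v) 0 v).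
    by rewrite spr //; apply: eq_bigr => u _; ring.
  rewrite subr0 addrAC subrr add0r.
  by rewrite [true%:R]mulr1n; field; rewrite s0' s1' oppr_eq0 oner_neq0.
by rewrite [LHS]addrC; congr (_ + _); [exact: Tf | exact: Tt].
Qed.
End GTRelations.


(** * Relations of the lowering operators, read in the opposite ring *)

Section Converse.
Variables (L : fieldType) (B : nzRingType) (iota : L -> B).
Variables (V : finType) (row : V -> nat) (z : V -> L) (tau : V -> {rmorphism L -> L}).
Variable Y : V -> B.
Hypothesis HY : @exchange L B^c iota V row z tau Y.
Hypothesis two : (2%:R : L) != 0.

Definition gsumc (i a : nat) : B := \sum_(v | row v == i) Y v * iota (z v ^+ a).
Local Notation F := gsumc.
Local Notation br := (fun x y : B => x * y - y * x).

Lemma gsumc_same i a b :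
  br (F i b.+1) (F i a) - br (F i b) (F i a.+1) = F i b * F i a + F i a * F i b.
Proof. exact: (gsum_same HY two i a b). Qed.
Lemma gsumc_next i a b : br (F i a.+1) (F i.+1 b) - br (F i a) (F i.+1 b.+1) = - (F i.+1 b * F i a).
Proof.
rewrite -[RHS](gsum_next HY i a b).
have -> : br (F i a.+1) (F i.+1 b) - br (F i a) (F i.+1 b.+1) =
  br (F i.+1 b.+1) (F i a) - br (F i.+1 b) (F i a.+1) by rewrite opprB addrC opprB.
by [].
Qed.
Lemma gsumc_far i j a b : (i.+1 < j)%N || (j.+1 < i)%N -> F i a * F j b = F j b * F i a.
Proof. by move=> H; apply: esym; exact: (gsum_far HY a b H). Qed.
Lemma gsumc_serre i j a b c : (j == i.+1) || (i == j.+1) ->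
  br (F i a) (br (F i b) (F j c)) + br (F i b) (br (F i a) (F j c)) = 0.
Proof.
move=> Hij; have H := gsum_serre HY two a b c Hij.
have br2 (x y t : B) : br x (br y t) = br (br t y) x.
  by rewrite /= !mulrBl !mulrBr opprB [RHS]addrC opprB.
by rewrite !br2.
Qed.
End Converse.

Section GTRelations.
Variables (k L : fieldType) (M : zmodType) (D : skew_data k L M).
Variables (V : finType) (row : V -> nat) (z : V -> L) (mu : V -> M).
Local Notation SK := (skew_alg D).
Hypothesis HG : gt_data D z mu.
Variables (n : nat) (p : nat -> nat).
Hypothesis p_sorted : forall i, (i.+1 < n)%N -> (p i <= p i.+1)%N.
Hypothesis card_row : forall i, (i < n)%N -> #|[pred v | row v == i]| = msum p i.
Local Notation E := (gt_E D row z mu).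
Local Notation F := (gt_F D row z mu).
Local Notation d := (gt_d D row z).
Local Notation e := (gt_e D row z mu p).
Local Notation f := (gt_f D row z mu).

Lemma gt_eS i r : (yshift p i < r)%N -> e i r.+1 = E i (r - 1 - yshift p i).+1.
Proof. by move=> H; rewrite /gt_e; congr (E _ _); lia. Qed.
Lemma gt_fS i r : (0 < r)%N -> f i r.+1 = F i (r - 1).+1.
Proof. by move=> H; rewrite /gt_f; congr (F _ _); lia. Qed.

Lemma gt_relations : W_relations n p d e f.
Proof.
have tw := gt_two HG.
have HX := exchangeX row HG; have HY := exchangeY row HG.
rewrite /W_relations /comm; repeat split.
- by move=> i j r s _ _ _ _; rewrite -!iotaM mulrC subrr.
- move=> i j r s Hi Hj Hr Hs; rewrite comm_E_F //; case: eqP => // Eij.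
  have Hrs : (r + s - 1 = r - 1 - yshift p i + (s - 1) + 1 + yshift p i)%N by lia.
  rewrite -[X in sk X]opprK -(residues HG p_sorted card_row Hi Hrs) iotaN; congr (- _).
  rewrite serM iota_sum (_ : (r + s - 1).+1 = (r + s)%N); last lia.
  by apply: eq_bigr => t _; rewrite Dinv_gt Dc_gt -iotaM.
- move=> i j [//|r] s _ Hj _ Hs; apply: etrans (comm_d_E row HG i j r _) _.
  apply: (congr1 (fun x => _ * x)); apply: eq_bigr => t _; rewrite Dc_gt /gt_e.
  by apply: (congr1 (fun m => _ * E j m)); have := ltn_ord t; lia.
- move=> i j [//|r] s _ Hj _ Hs; apply: etrans (comm_d_F row HG i j r _) _.
  apply: (congr1 (fun x => _ * x)); apply: eq_bigr => t _; rewrite Dc_gt /gt_f.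
  by apply: (congr1 (fun m => F j m * _)); have := ltn_ord t; lia.
- move=> i r s Hi Hr Hs; rewrite !gt_eS //.
  exact: (gsum_same HX tw).
- move=> i r s Hi Hr Hs; rewrite !gt_fS //.
  exact: (gsumc_same HY tw).
- move=> i r s Hi Hr Hs; rewrite !gt_eS //.
  exact: (gsum_next HX).
- move=> i r s Hi Hr Hs; rewrite !gt_fS //.
  exact: (gsumc_next HY).
- move=> i j r s Hi Hj Hij Hr Hs; apply/eqP; rewrite subr_eq0; apply/eqP.
  exact: (gsum_far HX).
- move=> i j r s Hi Hj Hij Hr Hs; apply/eqP; rewrite subr_eq0; apply/eqP.
  exact: (gsumc_far HY).
- move=> i j r s t Hi Hj Hij Hr Hs Ht.
  exact: (gsum_serre HX tw).
- move=> i j r s t Hi Hj Hij Hr Hs Ht.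
  exact: (gsumc_serre HY tw).
(* No row precedes row 0, so D_0 has no denominator and is a polynomial in 1/u of degree at most the
   number [p 0] of variables in that row. *)
- move=> r Hn Hr; rewrite /gt_d /gt_dser [X in _ * X]big1 ?mulr1; last by move=> w.
  have -> : \prod_(w | row w == 0%N) lin (z w) = pser (\prod_(w | row w == 0%N) (1 - z w *: 'X)).
    by rewrite pser_prod; apply: eq_bigr => w _; rewrite pser_lin.
  rewrite /= nth_default ?sk0 //.
  apply: leq_trans (size_prod_leq _ _) _.
  have H1 : (\sum_(w | row w == 0%N) size (1 - z w *: 'X)%R <= \sum_(w | row w == 0%N) 2)%N.
    apply: leq_sum => i _; apply: leq_trans (size_polyD _ _) _.
    rewrite size_poly1 size_polyN geq_max /=.
    by apply: leq_trans (size_scale_leq _ _) _; rewrite size_polyX.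
  rewrite sum_nat_const in H1.
  have H2 : #|(fun w => row w == 0%N)| = p 0 by rewrite [LHS](card_row Hn) /msum big_ord1.
  rewrite leq_subLR; apply: leq_ltn_trans H1 _; rewrite H2; lia.
Qed.

End GTRelations.


(* [scomp c s] is the substitution u -> u - c in a series s in t = u^-1, that is
   t -> t / (1 - c t). *)
Section Substitution.
Variables (L : fieldType) (c : nat).
Local Notation S := (series L).
Local Notation cc := (c%:R : L).

Definition scomp (s : S) : S :=
  Series (fun j => if j == 0%N then ser s 0
    else \sum_(r < j) ('C(j.-1, j - r.+1) * c ^ (j - r.+1))%N%:R * ser s r.+1).

Lemma scompB f g : scomp (f - g) = scomp f - scomp g.
Proof.
apply: serP => j; rewrite serB /=; case: eqP => // _; rewrite -sumrB.
by apply: eq_bigr => r _; rewrite mulrBr.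
Qed.
Lemma scompCM a f : scomp (sC a * f) = sC a * scomp f.
Proof.
apply: serP => -[|j]; rewrite serCM; first exact: serCM.
transitivity (\sum_(r < j.+1) ('C(j, j.+1 - r.+1) * c ^ (j.+1 - r.+1))%N%:R * ser (sC a * f) r.+1) => //.
by rewrite mulr_sumr; apply: eq_bigr => r _; rewrite serCM mulrCA.
Qed.
Lemma scomp1 : scomp 1 = 1.
Proof.
apply: serP => j /=; case: eqP => // _; rewrite big1 // => r _; exact: mulr0.
Qed.

(** The rule t -> t / (1 - c t) with the denominator cleared; on coefficients it is Pascal's rule
    for the binomials in [scomp]. *)
Lemma scompX s : lin cc * scomp (st L * s) = st L * scomp s.
Proof.
have tS j : ser (scomp (st L * s)) j.+1 =
    \sum_(r < j.+1) ('C(j, j - r) * c ^ (j - r))%N%:R * ser s r.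
  by apply: eq_bigr => r _; rewrite serXM subSS.
have t0 : ser (scomp (st L * s)) 0 = 0 by exact: serXM0.
apply: serP => j; rewrite /lin mulrBl mul1r serB -mulrA serCM.
case: j => [|j]; first by rewrite t0 !serXM0 mulr0 subr0.
rewrite !serXM tS; case: j => [|j].
  by rewrite big_ord1 t0 mulr0 subr0 /= mul1r.
rewrite tS mulr_sumr big_ord_recr /= subnn bin0 expn0 mul1r.
rewrite addrAC -sumrB (eq_bigr (fun r : 'I_j.+1 =>
   ('C(j, j.+1 - r) * c ^ (j.+1 - r))%N%:R * ser s r)); last first.
  move=> r _; rewrite mulrA -natrM -mulrBl; congr (_ * _).
  rewrite subSn; last by have := ltn_ord r; lia.
  rewrite binS expnS [X in _ - X%:R]mulnCA.
  by rewrite mulnDl natrD addrK.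
rewrite big_ord_recl subn0 bin_small // mul0n mul0r add0r.
by rewrite [RHS]big_ord_recr /= subnn bin0 expn0 mul1r.
Qed.

Lemma scompX' s : scomp (st L * s) = st L * geo cc * scomp s.
Proof. by apply: (@lin_cancel _ cc); rewrite scompX mulrA mulrCA lin_geo mulr1. Qed.
Lemma scomp_lin a s : scomp (lin a * s) = lin (a + cc) * geo cc * scomp s.
Proof.
rewrite {1}/lin mulrBl mul1r scompB -[sC a * _ * s]mulrA scompCM scompX' !mulrA.
have h := @lin_geo L cc.
have -> : scomp s - sC a * st L * geo cc * scomp s = (1 - sC a * st L * geo cc) * scomp s.
  by rewrite mulrBl mul1r.
by rewrite -{1}h /lin sCD; congr (_ * _); ring.
Qed.
Lemma scomp_geo a s : scomp (geo a * s) = geo (a + cc) * lin cc * scomp s.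
Proof.
have E : scomp s = lin (a + cc) * geo cc * scomp (geo a * s).
  by rewrite -scomp_lin mulrA lin_geo mul1r.
rewrite [in RHS]E; set X := scomp (geo a * s).
have -> : geo (a + cc) * lin cc * (lin (a + cc) * geo cc * X) =
  (lin (a + cc) * geo (a + cc)) * (lin cc * geo cc) * X by ring.
by rewrite !lin_geo !mul1r.
Qed.
Lemma scomp_prod_lin (I : finType) (P : pred I) (F : I -> L) s :
  scomp (\prod_(i | P i) lin (F i) * s) = \prod_(i | P i) lin (F i + cc) * geo cc ^+ #|P| * scomp s.
Proof.
rewrite -prodr_const -big_split /=.
elim/big_ind2: _ (s) => [s'|x x' y y' Hx Hy s'|i _ s']; rewrite ?mul1r ?scomp_lin //.
by rewrite -mulrA Hx Hy mulrA.
Qed.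
Lemma scomp_prod_geo (I : finType) (P : pred I) (F : I -> L) s :
  scomp (\prod_(i | P i) geo (F i) * s) = \prod_(i | P i) geo (F i + cc) * lin cc ^+ #|P| * scomp s.
Proof.
rewrite -prodr_const -big_split /=.
elim/big_ind2: _ (s) => [s'|x x' y y' Hx Hy s'|i _ s']; rewrite ?mul1r ?scomp_geo //.
by rewrite -mulrA Hx Hy mulrA.
Qed.
End Substitution.

Lemma ser_linX (L : fieldType) (a : L) q j : ser (lin a ^+ q) j = 'C(q, j)%:R * (- a) ^+ j.
Proof.
elim: q j => [|q IH] j.
  by rewrite expr0; case: j => [|j]; rewrite ?bin0n ?mul1r //= mul0r.
rewrite exprS /lin mulrBl mul1r serB -mulrA serCM; case: j => [|j].
  by rewrite serXM0 mulr0 subr0 IH !bin0.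
by rewrite serXM !IH binS natrD mulrDl exprS; ring.
Qed.

(** * Images of the generators of Gamma *)

Section GTCenter.
Variables (k L : fieldType) (M : zmodType) (D : skew_data k L M).
Variables (V : finType) (row : V -> nat) (z : V -> L) (mu : V -> M).
Local Notation SK := (skew_alg D).
Hypothesis HG : gt_data D z mu.
Variables (n : nat) (p : nat -> nat).
Hypothesis card_row : forall i, (i < n)%N -> #|[pred v | row v == i]| = msum p i.
Local Notation d := (gt_d D row z).
Local Notation iotas s := (fun j => sk (ser s j) 0 : SK).

Lemma pmul_iota (f g : nat -> SK) (s t : series L) : f =1 iotas s -> g =1 iotas t ->
  pmul f g =1 iotas (s * t).
Proof.
move=> Hf Hg j; rewrite /pmul serM iota_sum; apply: eq_bigr => l _.
by rewrite Hf Hg iotaM.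
Qed.

Definition gt_Q i c : series L := \prod_(w | row w == i) lin (z w + c%:R).
Definition gt_R i c : series L := \prod_(w | (row w).+1 == i) geo (z w - 1 + c%:R).

(** The substitution u -> u - i creates one power of 1 - i t for each linear factor. Together with
    the prefactor they cancel, because row i has [p i] more variables than the preceding row. *)
Lemma Afactor_gt i : (i < n)%N -> Afactor d i i (p i) =1 iotas (gt_Q i i * gt_R i i).
Proof.
move=> Hi.
have -> : gt_Q i i * gt_R i i = lin (i%:R : L) ^+ p i * scomp i (gt_dser row z i).
  rewrite /gt_dser scomp_prod_lin -[X in _ * scomp i X]mulr1 scomp_prod_geo scomp1 mulr1.
  rewrite -/(gt_Q i i) -/(gt_R i i).
  have h : lin (i%:R : L) ^+ p i * lin i%:R ^+ #|[pred w | (row w).+1 == i]| *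
           geo i%:R ^+ #|[pred w | row w == i]| = 1.
    by rewrite -exprD addnC (card_prev card_row Hi) card_row // -exprMn lin_geo expr1n.
  rewrite -[LHS]mul1r -h; set a := _ ^+ p i; set b := _ ^+ #|_|; set c := _ ^+ #|_|.
  set Q := gt_Q i i; set R := gt_R i i.
  have -> : a * b * c * (Q * R) = a * (Q * c * (R * b)) by ring.
  done.
have iotaX (a : L) j : sk (a ^+ j) 0 = (sk a 0 : SK) ^+ j.
  by elim: j => [|j IH]; rewrite ?expr0 // !exprS iotaM IH.
apply: pmul_iota => j; first by rewrite ser_linX iotaM iota_nat iotaX iotaN iota_nat.
rewrite /dshift; case: j => [|j].
  by rewrite -[ser _ _]/(ser (gt_dser row z i) 0) dser0 sk1.
rewrite -[ser _ _]/(\sum_(r < j.+1) _ * ser (gt_dser row z i) r.+1) [_ == _]/=.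
rewrite iota_sum; apply: eq_bigr => r _.
by rewrite /gt_d iotaM iota_nat.
Qed.

Lemma acoef_gt r j : (r < n)%N -> acoef p d r j = sk (ser (gt_Q r r) j) 0.
Proof.
move=> Hr.
have QR i : gt_Q i i * gt_R i.+1 i.+1 = 1.
  rewrite /gt_Q /gt_R -[RHS](lin_prod_geo [pred w | row w == i] (fun w => z w + i%:R)).
  congr (_ * _); apply: eq_bigr => w _; congr geo; rewrite -addn1 natrD; ring.
(* The shift by the row number makes the denominator of one row the inverse of the preceding
   numerator, since z_w - 1 + (i + 1) = z_w + i; only the last numerator survives. *)
have tel i : \prod_(0 <= l < i.+1) (gt_Q l l * gt_R l l) = gt_Q i i.
  elim: i => [|i IH].
    by rewrite big_nat1 [gt_R _ _]big1 ?mulr1 // => w; rewrite eqn_leq ltn0.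
  by rewrite big_nat_recr //= IH mulrCA QR mulr1.
rewrite -tel /acoef /index_iota subn0.
have: all (fun i => i < n)%N (iota 0 r.+1).
  by apply/allP => i; rewrite mem_iota; lia.
move: (iota 0 r.+1) j; elim=> [|i s IH] /= j.
  by move=> _; rewrite big_nil ser1; case: eqP; rewrite ?sk0.
move=> /andP [Hi Hs]; rewrite big_cons.
by apply: pmul_iota => l; [apply: Afactor_gt | apply: IH].
Qed.
End GTCenter.

(** * Spans over the base field *)


Section LeftSpan.
Variables (L : fieldType) (B : nzRingType) (iota : L -> B).
Hypothesis iotaM : forall a b, iota (a * b) = iota a * iota b.

Definition lspan (U : B -> Prop) (x : B) : Prop :=
  exists l : seq (L * B), (forall t, t \in l -> U t.2) /\ x = \sum_(t <- l) iota t.1 * t.2.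

Lemma lspan0 U : lspan U 0.
Proof. by exists [::]; rewrite big_nil. Qed.
Lemma lspan_in U a u : U u -> lspan U (iota a * u).
Proof. by move=> Hu; exists [:: (a, u)]; rewrite big_seq1; split => // t; rewrite inE => /eqP ->. Qed.
Lemma lspanD U x y : lspan U x -> lspan U y -> lspan U (x + y).
Proof.
move=> [l [Hl ->]] [m [Hm ->]]; exists (l ++ m); rewrite big_cat; split => // t.
by rewrite mem_cat => /orP [/Hl|/Hm].
Qed.
Lemma lspan_sum U (T : Type) (r : seq T) (P : pred T) (F : T -> B) :
  (forall t, P t -> lspan U (F t)) -> lspan U (\sum_(t <- r | P t) F t).
Proof. by move=> H; apply: big_ind => //; [apply: lspan0 | apply: lspanD]. Qed.
Lemma lspan_sub (U U' : B -> Prop) x : (forall u, U u -> U' u) -> lspan U x -> lspan U' x.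
Proof. by move=> H [l [Hl ->]]; exists l; split => // t /Hl /H. Qed.
Lemma lspan_mull U a x : lspan U x -> lspan U (iota a * x).
Proof.
move=> [l [Hl ->]]; rewrite mulr_sumr big_seq; apply: lspan_sum => t /Hl Ht.
by rewrite mulrA -iotaM; apply: lspan_in.
Qed.
Lemma lspan_mulT (U1 U2 U3 : B -> Prop) (t : L -> L) T x :
  (forall u v, U1 u -> U2 v -> U3 (u * v)) -> (forall a, T * iota a = iota (t a) * T) ->
  lspan U1 T -> lspan U2 x -> lspan U3 (T * x).
Proof.
move=> HU HT [l1 [H1 E1]] [l2 [H2 ->]].
rewrite mulr_sumr big_seq; apply: lspan_sum => s /H2 Hs.
rewrite mulrA HT -mulrA; apply: lspan_mull; rewrite E1 mulr_suml big_seq.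
by apply: lspan_sum => s' /H1 Hs'; rewrite -mulrA; apply/lspan_in/HU.
Qed.

End LeftSpan.

(** * Recovering single translations from power sums *)

Section Interpolation.
Variables (L : fieldType) (V : finType) (P : pred V) (z : V -> L) (v : V).

Lemma interpolation : P v -> (forall w, P w -> w != v -> z v != z w) ->
  exists l : nat -> L, forall w, P w -> \sum_(a < #|P|) l a * z w ^+ a = (w == v)%:R.
Proof.
move=> Pv Hz; pose Q := \prod_(w | P w && (w != v)) ('X - (z w)%:P).
have Qv : Q.[z v] != 0.
  rewrite horner_prod; apply/prodf_neq0 => w /andP [Pw nw].
  by rewrite hornerXsubC subr_eq0; apply: Hz.
have sQ : size Q = #|P|.
  rewrite /Q -big_filter size_prod_XsubC size_filter -sum1_count -sum1_card.
  by rewrite [in RHS](bigD1 v) //= add1n.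
exists (fun a => (Q.[z v])^-1 * Q`_a) => w Pw.
under eq_bigr => a _ do rewrite -mulrA.
rewrite -mulr_sumr -sQ -horner_coef.
have [->|nw] := eqVneq w v; first by rewrite mulVf.
have -> : Q.[z w] = 0; last by rewrite mulr0.
rewrite horner_prod (bigD1 w) /=; last by rewrite Pw.
by rewrite hornerXsubC subrr mul0r.
Qed.

Lemma lspan_summand (B : nzRingType) (iota : L -> B) (X : V -> B) (U : B -> Prop) :
  P v -> (forall w, P w -> w != v -> z v != z w) ->
  (forall a b, iota (a * b) = iota a * iota b) -> (forall a b, iota (a + b) = iota a + iota b) ->
  iota 0 = 0 -> iota 1 = 1 ->
  (forall a, (a < #|P|)%N -> U (\sum_(w | P w) iota (z w ^+ a) * X w)) ->
  lspan iota U (X v).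
Proof.
move=> Pv Hz iM iD i0 i1 HU; have [l Hl] := interpolation Pv Hz.
have -> : X v = \sum_(a < #|P|) iota (l a) * \sum_(w | P w) iota (z w ^+ a) * X w.
  under eq_bigr => a _ do rewrite mulr_sumr; rewrite exchange_big /=.
  transitivity (\sum_(w | P w) iota (w == v)%:R * X w).
    rewrite (bigD1 v) //= eqxx i1 mul1r big1 ?addr0 // => w /andP [_ /negbTE ->].
    by rewrite i0 mul0r.
  apply: eq_bigr => w /Hl <-.
  rewrite (big_morph iota iD i0) mulr_suml; apply: eq_bigr => a _.
  by rewrite iM mulrA.
by apply: lspan_sum => a _; apply/lspan_in/HU.
Qed.
End Interpolation.

Section Translations.
Variables (L : fieldType) (B : nzRingType) (iota : L -> B) (M : zmodType) (T : M -> B).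
Hypothesis iotaM : forall a b, iota (a * b) = iota a * iota b.
Hypothesis iota1 : iota 1 = 1.
Hypothesis T0 : T 0 = 1.
Hypothesis TD : forall m m', T (m + m') = T m * T m'.
Variable t : M -> L -> L.
Hypothesis T_iota : forall m a, T m * iota a = iota (t m a) * T m.
Variable U : B -> Prop.
Hypothesis U1 : U 1.
Hypothesis UM : forall x y, U x -> U y -> U (x * y).

Lemma lspan_translations (V : finType) (P : pred V) (mu : V -> M) (c : V -> int) :
  (forall v, P v -> lspan iota U (T (mu v)) /\ lspan iota U (T (- mu v))) ->
  lspan iota U (T (\sum_(v | P v) mu v *~ c v)).
Proof.
move=> H.
have S0 : lspan iota U (T 0) by rewrite T0; have := lspan_in iota 1 U1; rewrite iota1 mul1r.
have SD m m' : lspan iota U (T m) -> lspan iota U (T m') -> lspan iota U (T (m + m')).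
  by move=> Hm Hm'; rewrite TD; apply: (lspan_mulT iotaM UM (T_iota m)).
have Sn m i : lspan iota U (T m) -> lspan iota U (T (m *+ i)).
  by move=> Hm; elim: i => // i IH; rewrite mulrS; apply: SD.
apply: (big_ind (fun m => lspan iota U (T m))) => // v /H [Hp Hm].
case: (c v) => i; first exact: Sn.
by rewrite NegzE mulrNz -mulNrz -pmulrn; apply: Sn.
Qed.
End Translations.


(** * Equivariance under row permutations *)

Section GTAutomorphism.
Variables (k L : fieldType) (M : zmodType) (D : skew_data k L M).
Variables (V : finType) (row : V -> nat) (z : V -> L) (mu : V -> M).
Local Notation SK := (skew_alg D).
Variables (g : {rmorphism L -> L}) (c c' : M -> M).
Hypothesis cK : cancel c c'.
Hypothesis cK' : cancel c' c.
Hypothesis cD : forall m m', c (m + m') = c m + c m'.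
Hypothesis g_act : forall m x, g (act D m x) = act D (c m) (g x).
Variable s : {perm V}.
Hypothesis row_s : forall v, row (s v) = row v.
Hypothesis g_z : forall v, g (z v) = z (s v).
Hypothesis c_mu : forall v, c (mu v) = mu (s v).
Local Notation G := (skmap g c : SK -> SK).

Lemma g_pr (P : V -> pred V) j v : (forall u, P (s v) (s u) = P v u) ->
  g (gt_pr z (P v) j v) = gt_pr z (P (s v)) j (s v).
Proof.
move=> HP; rewrite /gt_pr rmorph_prod [RHS](reindex_inj (@perm_inj _ s)) /=.
apply: eq_big => [u|u _]; first by rewrite HP.
by rewrite rmorphD rmorphB /= !g_z rmorph_nat.
Qed.
Lemma g_same j v : g (gt_pr z (gt_same row v) j v) = gt_pr z (gt_same row (s v)) j (s v).
Proof. by apply: g_pr => u; rewrite /gt_same !row_s (inj_eq perm_inj). Qed.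
Lemma g_c v : g (gt_c row z v) = gt_c row z (s v).
Proof.
rewrite /gt_c fmorph_div /= g_same; congr (_ / _).
by apply: g_pr => u; rewrite /gt_next !row_s.
Qed.
Lemma g_b v : g (gt_b row z v) = gt_b row z (s v).
Proof.
rewrite /gt_b rmorphN fmorph_div /= g_same; congr (- (_ / _)).
by apply: g_pr => u; rewrite /gt_prev !row_s.
Qed.

Lemma skmap_gt_d i r : G (gt_d D row z i r) = gt_d D row z i r.
Proof.
rewrite /gt_d (skmap_iota cK cK' cD).
suff E : smap g (gt_dser row z i) = gt_dser row z i by rewrite -[in RHS]E.
rewrite /gt_dser smapM !smap_prod; congr (_ * _).
  rewrite [RHS](reindex_inj (@perm_inj _ s)) /=; apply: eq_big => [u|u _]; first by rewrite row_s.
  by rewrite smap_lin g_z.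
rewrite [RHS](reindex_inj (@perm_inj _ s)) /=; apply: eq_big => [u|u _]; first by rewrite row_s.
by rewrite smap_geo rmorphB /= g_z rmorph1.
Qed.
Lemma skmap_gt_E i a : G (gt_E D row z mu i a) = gt_E D row z mu i a.
Proof.
rewrite /gt_E (skmap_sum cK cK') [RHS](reindex_inj (@perm_inj _ s)) /=.
apply: eq_big => [u|u _]; first by rewrite row_s.
rewrite (skmapM cK cK' cD g_act) (skmap_iota cK cK' cD) rmorphXn /= g_z; congr (_ * _).
by rewrite /gt_X (skmap_sk cK cK') g_c c_mu.
Qed.
Lemma skmap_gt_F i a : G (gt_F D row z mu i a) = gt_F D row z mu i a.
Proof.
have cN m : c (- m) = - c m by apply/eqP; rewrite -addr_eq0 -cD addNr (additive0 cD).
rewrite /gt_F (skmap_sum cK cK') [RHS](reindex_inj (@perm_inj _ s)) /=.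
apply: eq_big => [u|u _]; first by rewrite row_s.
rewrite (skmapM cK cK' cD g_act) (skmap_iota cK cK' cD) rmorphXn /= g_z; congr (_ * _).
rewrite /gt_Y (skmapM cK cK' cD g_act) (skmap_iota cK cK' cD) (skmap_sk cK cK').
by rewrite rmorph1 g_b cN c_mu.
Qed.
End GTAutomorphism.

Section GTSupport.
Variables (k L : fieldType) (M : zmodType) (D : skew_data k L M).
Variables (V : finType) (row : V -> nat) (z : V -> L) (mu : V -> M).
Variable (Q : M -> Prop).
Hypothesis Q0 : Q 0.
Hypothesis QD : forall m m', Q m -> Q m' -> Q (m + m').
Variable i : nat.
Hypothesis Qmu : forall v, row v = i -> Q (mu v) /\ Q (- mu v).

Lemma supported_gt_E a : supported Q (gt_E D row z mu i a).
Proof.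
apply: supported_sum => v /eqP Hv; apply: supportedM => //; first exact: supported_sk.
by apply: supported_sk; case: (Qmu Hv).
Qed.
Lemma supported_gt_F a : supported Q (gt_F D row z mu i a).
Proof.
apply: supported_sum => v /eqP Hv; apply: supportedM => //; last exact: supported_sk.
by apply: supportedM => //; apply: supported_sk => //; case: (Qmu Hv).
Qed.
End GTSupport.

Section GTTranslations.
Variables (k L : fieldType) (M : zmodType) (D : skew_data k L M).
Variables (V : finType) (row : V -> nat) (z : V -> L) (mu : V -> M).
Local Notation SK := (skew_alg D).
Local Notation iota := (fun a : L => sk a 0 : SK).
Local Notation iotac := (fun a : L => sk a 0 : SK^c).
Hypothesis HG : gt_data D z mu.
Variables (U : SK -> Prop) (v : V).
Hypothesis UE : forall a, (a < #|V|)%N -> U (gt_E D row z mu (row v) a).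
Hypothesis UF : forall a, (a < #|V|)%N -> U (gt_F D row z mu (row v) a).

Let iM a b : iota (a * b) = iota a * iota b. Proof. exact: iotaM. Qed.
Let iMc a b : iotac (a * b) = iotac a * iotac b. Proof. by rewrite mulrC; exact: iotaM. Qed.
Let iD a b : iota (a + b) = iota a + iota b. Proof. exact: skD. Qed.
Let i0 : iota 0 = 0. Proof. exact: sk0. Qed.
Let i1 : iota 1 = 1. Proof. exact: sk1. Qed.
Let P := (fun w => row w == row v).
Let leP a : (a < #|P|)%N -> (a < #|V|)%N.
Proof. by move=> Ha; apply: leq_trans Ha (max_card _). Qed.
Let Pv : P v. Proof. exact: eqxx. Qed.
Let z_inj w : P w -> w != v -> z v != z w.
Proof. by move=> _ nw; rewrite -subr_eq0; apply: (gt_ne0 HG); rewrite eq_sym. Qed.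
Let z1_inj w : P w -> w != v -> z v - 1 != z w - 1.
Proof. by move=> Pw nw; rewrite (inj_eq (addIr _)); apply: z_inj. Qed.
Let tauN w : act D (- mu w) (z w) = z w - 1.
Proof.
have := gt_tau HG w w; rewrite eqxx => H.
have {1}-> : z w = act D (mu w) (z w) - 1 by rewrite H addrK.
by rewrite rmorphB rmorph1 -actD addNr act0.
Qed.
Let c_neq0 w : gt_c row z w != 0.
Proof.
by rewrite /gt_c mulf_neq0 ?invr_eq0 ?(gt_pr_neq0 HG) // /gt_next /gt_same ?eqxx //; lia.
Qed.
Let b_neq0 w : gt_b row z w != 0.
Proof.
by rewrite /gt_b oppr_eq0 mulf_neq0 ?invr_eq0 ?(gt_pr_neq0 HG) // /gt_prev /gt_same ?eqxx //; lia.
Qed.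

Lemma lspan_mu : lspan iota U (sk 1 (mu v)).
Proof.
have -> : sk 1 (mu v) = iota (gt_c row z v)^-1 * gt_X D row z mu v.
  by rewrite /gt_X skM act0 add0r mulVf.
apply: (lspan_mull iM).
exact: (@lspan_summand L V P z v SK iota (gt_X D row z mu) U Pv z_inj iM iD i0 i1 (fun a Ha => UE (leP Ha))).
Qed.
Lemma lspan_muN : lspan iota U (sk 1 (- mu v)).
Proof.
have YE w : gt_Y D row z mu w = sk (act D (- mu w) (gt_b row z w)) (- mu w).
  by rewrite /gt_Y skM mul1r addr0.
have -> : sk 1 (- mu v) = iota (act D (- mu v) (gt_b row z v))^-1 * gt_Y D row z mu v.
  by rewrite YE skM act0 add0r mulVf // fmorph_eq0.
apply: (lspan_mull iM).
(* Moving z_w^a from the right to the left of the inverse shift turns it into (z_w - 1)^a, so the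
   interpolation nodes are z_w - 1. *)
apply: (@lspan_summand L V P (fun w => z w - 1) v SK iota (gt_Y D row z mu) U Pv z1_inj iM iD i0 i1) => a Ha.
have -> : \sum_(w | P w) iota ((z w - 1) ^+ a) * gt_Y D row z mu w = gt_F D row z mu (row v) a; last exact/UF/leP.
apply: eq_bigr => w _; rewrite !YE !skM act0 add0r addr0 rmorphXn /= tauN.
by rewrite mulrC.
Qed.
Lemma rspan_mu : lspan iotac U (sk 1 (mu v) : SK^c).
Proof.
pose b w := act D (- mu w) (gt_c row z w).
have XE w : gt_X D row z mu w = sk 1 (mu w) * sk (b w) 0.
  by rewrite skM mul1r addr0 /b -actD subrr act0.
have -> : sk 1 (mu v) = iotac (b v)^-1 * (gt_X D row z mu v : SK^c) :> SK^c.
  have -> : iotac (b v)^-1 * (gt_X D row z mu v : SK^c) = gt_X D row z mu v * iota (b v)^-1 :> SK by [].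
  by rewrite XE -mulrA -iM mulfV ?sk1 ?mulr1 // fmorph_eq0.
apply: (lspan_mull iMc).
apply: (@lspan_summand L V P (fun w => z w - 1) v SK^c iotac (gt_X D row z mu) U Pv z1_inj iMc iD i0 i1) => a Ha.
have -> : \sum_(w | P w) iotac ((z w - 1) ^+ a) * (gt_X D row z mu w : SK^c) =
   \sum_(w | P w) gt_X D row z mu w * iota ((z w - 1) ^+ a) by [].
have -> : \sum_(w | P w) gt_X D row z mu w * iota ((z w - 1) ^+ a) = gt_E D row z mu (row v) a; last exact/UE/leP.
apply: eq_bigr => w _; rewrite /gt_X !skM act0 add0r addr0 -tauN rmorphXn /= -actD subrr act0.
by rewrite mulrC.
Qed.
Lemma rspan_muN : lspan iotac U (sk 1 (- mu v) : SK^c).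
Proof.
have -> : sk 1 (- mu v) = iotac (gt_b row z v)^-1 * (gt_Y D row z mu v : SK^c) :> SK^c.
  have -> : iotac (gt_b row z v)^-1 * (gt_Y D row z mu v : SK^c) =
    gt_Y D row z mu v * iota (gt_b row z v)^-1 :> SK by [].
  by rewrite /gt_Y -mulrA -iM mulfV ?sk1 ?mulr1.
apply: (lspan_mull iMc).
apply: (@lspan_summand L V P z v SK^c iotac (gt_Y D row z mu) U Pv z_inj iMc iD i0 i1) => a Ha.
exact/UF/leP.
Qed.
End GTTranslations.

(** * Averaging coefficients over the group *)

Section Averaging.
Variables (k L : fieldType) (M : zmodType) (D : skew_data k L M).
Local Notation SK := (skew_alg D).
Variables (I : finType) (P : pred I) (g : I -> SK -> SK) (gL : I -> L -> L).
Hypothesis g_sum : forall s (T : Type) (r : seq T) (F : T -> SK),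
  g s (\sum_(i <- r) F i) = \sum_(i <- r) g s (F i).
Hypothesis gM : forall s X Y, g s (X * Y) = g s X * g s Y.
Hypothesis g_iota : forall s a, g s (sk a 0) = sk (gL s a) 0.
Hypothesis card_neq0 : (#|P|%:R : L) != 0.

Definition average (a : L) : L := #|P|%:R^-1 * \sum_(s | P s) gL s a.

Variables (T : Type) (l : seq T) (a : T -> L) (u : T -> SK) (X : SK).
Hypothesis Hu : forall i s, P s -> g s (u i) = u i.
Hypothesis HX : forall s, P s -> g s X = X.

Let sumX : \sum_(s | P s) g s X = sk #|P|%:R 0 * X.
Proof.
by rewrite iota_nat mulr_natl (eq_bigr (fun=> X)) ?sumr_const.
Qed.

(** Both X and the u_i are fixed by the group, so averaging the whole expression changes only the
    coefficients. *)
Lemma average_left : X = \sum_(i <- l) sk (a i) 0 * u i -> X = \sum_(i <- l) sk (average (a i)) 0 * u i.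
Proof.
move=> EX; have E : X = sk #|P|%:R^-1 0 * \sum_(s | P s) g s X.
  by rewrite sumX mulrA -iotaM mulVf // sk1 mul1r.
rewrite [LHS]E; under eq_bigr => s Hs do rewrite [X in g s X]EX g_sum.
rewrite exchange_big mulr_sumr /=; apply: eq_bigr => i _.
rewrite /average iotaM -mulrA iota_sum mulr_suml; congr (_ * _).
by apply: eq_bigr => s Hs; rewrite gM g_iota Hu.
Qed.

Lemma average_right : X = \sum_(i <- l) u i * sk (a i) 0 -> X = \sum_(i <- l) u i * sk (average (a i)) 0.
Proof.
move=> EX; have E : X = (\sum_(s | P s) g s X) * sk #|P|%:R^-1 0.
  by rewrite sumX iota_nat mulr_natl -mulr_natr -mulrA -iota_nat -iotaM mulfV // sk1 mulr1.
rewrite [LHS]E; under eq_bigr => s Hs do rewrite [X in g s X]EX g_sum.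
rewrite exchange_big mulr_suml /=; apply: eq_bigr => i _.
rewrite /average mulrC iotaM mulrA iota_sum mulr_sumr; congr (_ * _).
by apply: eq_bigr => s Hs; rewrite gM g_iota Hu.
Qed.
End Averaging.

Section GTFull.
Variables (k L : fieldType) (M : zmodType) (D : skew_data k L M).
Variables (V : finType) (row : V -> nat) (z : V -> L) (mu : V -> M).
Local Notation SK := (skew_alg D).
Local Notation iota := (fun a : L => sk a 0 : SK).
Local Notation iotac := (fun a : L => sk a 0 : SK^c).
Hypothesis HG : gt_data D z mu.
Variables (n : nat) (Q : M -> Prop).
Hypothesis HQ : forall m, Q m -> exists c : V -> int, m = \sum_(v | (row v < n.-1)%N) mu v *~ c v.
Variable U : SK -> Prop.
Hypothesis U1 : U 1.
Hypothesis UM : forall X Y, U X -> U Y -> U (X * Y).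
Hypothesis UE : forall i a, (i.+1 < n)%N -> U (gt_E D row z mu i a).
Hypothesis UF : forall i a, (i.+1 < n)%N -> U (gt_F D row z mu i a).

Let skT m m' : sk 1 (m + m') = sk 1 m * sk 1 m' :> SK.
Proof. by rewrite skM rmorph1 mulr1. Qed.

Let iMc a b : iotac (a * b) = iotac a * iotac b.
Proof. by rewrite mulrC; exact: iotaM. Qed.

Lemma lspan_full X : supported Q X -> lspan iota U X.
Proof.
move=> HX; rewrite (skewE X) big_seq; apply: lspan_sum => m; rewrite skc_suppP => /HX /HQ [c Hc].
have -> : sk (skc X m) m = sk (skc X m) 0 * sk 1 m :> SK by rewrite skM act0 add0r mulr1.
apply: (lspan_mull (iota := iota)) => [a b|]; first exact: iotaM.
rewrite Hc.
apply: (@lspan_translations L SK iota M (sk 1) _ _ _ skT (act D) _ U U1 UM) => //.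
- by move=> a b; apply: iotaM.
- by move=> m' a; rewrite !skM act0 mul1r mulr1 addr0 add0r.
move=> v Hv; split; [apply: (lspan_mu HG)|apply: (lspan_muN HG)] => a _.
  by apply: UE; lia.
by apply: UF; lia.
Qed.

Lemma rspan_full (X : SK) : supported Q X -> lspan iotac U (X : SK^c).
Proof.
move=> HX; rewrite [X]skewE big_seq.
apply: (@lspan_sum L SK^c) => m; rewrite skc_suppP => /HX /HQ [c Hc].
have -> : sk (skc X m) m = iotac (act D (- m) (skc X m)) * (sk 1 m : SK^c) :> SK^c.
  have -> : iotac (act D (- m) (skc X m)) * (sk 1 m : SK^c) = sk 1 m * iota (act D (- m) (skc X m)) :> SK by [].
  by rewrite skM addr0 -actD subrr act0 mul1r.
apply: (lspan_mull iMc).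
rewrite Hc.
apply: (@lspan_translations L SK^c iotac M (sk 1) iMc _ _ _ (fun m => act D (- m)) _ U U1) => //.
- by move=> m' m''; rewrite addrC skT.
- move=> m' a; have -> : (sk 1 m' : SK^c) * iotac a = iota a * sk 1 m' by [].
  have -> : iotac (act D (- m') a) * (sk 1 m' : SK^c) = sk 1 m' * iota (act D (- m') a) by [].
  by rewrite !skM -actD subrr !act0 mul1r mulr1 addr0 add0r.
- by move=> Y Z HY HZ; apply: (UM HZ HY).
move=> v Hv; split; [apply: (rspan_mu HG)|apply: (rspan_muN HG)] => a _.
  by apply: UE; lia.
by apply: UF; lia.
Qed.

Variables (W : Type) (Phi : W -> SK).
Hypothesis HU : forall X, U X -> exists w, Phi w = X.

Lemma left_combination X : supported Q X ->
  exists l : seq (L * W), X = \sum_(t <- l) sk t.1 0 * Phi t.2.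
Proof.
case/lspan_full => l [Hl ->]; elim: l Hl => [|t l IH] Hl; first by exists [::]; rewrite !big_nil.
have [|l' El'] := IH; first by move=> t' Ht'; apply: Hl; rewrite inE Ht' orbT.
have [w Hw] := HU (Hl t (mem_head _ _)).
by exists ((t.1, w) :: l'); rewrite !big_cons El' -Hw.
Qed.
Lemma right_combination X : supported Q X ->
  exists l : seq (L * W), X = \sum_(t <- l) Phi t.2 * sk t.1 0.
Proof.
case/rspan_full => l [Hl ->]; elim: l Hl => [|t l IH] Hl; first by exists [::]; rewrite !big_nil.
have [|l' El'] := IH; first by move=> t' Ht'; apply: Hl; rewrite inE Ht' orbT.
have [w Hw] := HU (Hl t (mem_head _ _)).
exists ((t.1, w) :: l'); rewrite !big_cons El' Hw; congr (_ + _).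
Qed.
End GTFull.

(** * The field of rational functions *)
From mathcomp Require Import mpoly.


Lemma frac_numden (R : idomainType) (x : {fraction R}) :
  x = (\n_(generic_quotient.repr x))%:F / (\d_(generic_quotient.repr x))%:F.
Proof.
have d0 : (\d_(generic_quotient.repr x))%:F != 0 :> {fraction R}.
  by rewrite tofrac_eq0 denom_ratioP.
apply: (mulIf d0); rewrite divfK //.
rewrite -{1}[x]generic_quotient.reprK.
move: (generic_quotient.repr x) => r.
have h0 : \d_r != 0 by apply: denom_ratioP.
unlock FracField.tofrac; rewrite -[LHS]FracField.pi_mul.
apply/generic_quotient.eqmodP; rewrite /= FracField.equivfE /FracField.mulf.
rewrite !numden_Ratio ?oner_eq0 ?mulf_neq0 ?oner_eq0 //.
by rewrite !mulr1 mulrC.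
Qed.

Section LiftToFractions.
Variable R : idomainType.
Local Notation L := {fraction R}.

Lemma frac_ex (x : L) : exists a b : R, b != 0 /\ x = a%:F / b%:F.
Proof.
exists (\n_(generic_quotient.repr x)), (\d_(generic_quotient.repr x)).
by split; [apply: denom_ratioP | apply: frac_numden].
Qed.

Lemma tofrac_div_eq (a b c d : R) : b != 0 -> d != 0 ->
  (a%:F / b%:F = c%:F / d%:F :> L) <-> a * d = c * b.
Proof.
move=> b0 d0.
have db : (b%:F : L) != 0 by rewrite tofrac_eq0.
have dd : (d%:F : L) != 0 by rewrite tofrac_eq0.
split=> [/eqP|H]; first by rewrite eqr_div // -!tofracM tofrac_eq => /eqP.
by apply/eqP; rewrite eqr_div // -!tofracM tofrac_eq H.
Qed.

Variable h : {rmorphism R -> R}.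
Hypothesis h_inj : injective h.

Definition fracmap (x : L) : L :=
  (h \n_(generic_quotient.repr x))%:F / (h \d_(generic_quotient.repr x))%:F.

Lemma h_neq0 b : b != 0 -> h b != 0.
Proof. by rewrite (raddf_eq0 _ h_inj). Qed.

(** [fracmap] has the same formula as [Lmap], through a chosen representative. Independence of that
    choice is what makes it a field endomorphism. *)
Lemma fracmapE (a b : R) : b != 0 -> fracmap (a%:F / b%:F) = (h a)%:F / (h b)%:F.
Proof.
move=> b0; rewrite /fracmap; move: (frac_numden (a%:F / b%:F)).
move: (generic_quotient.repr _) => r.
have d0 : \d_r != 0 by apply: denom_ratioP.
move/(tofrac_div_eq _ _ b0 d0) => E.
apply/tofrac_div_eq; rewrite ?h_neq0 //.
by rewrite -!rmorphM E.
Qed.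

Lemma fracmap_tofrac (a : R) : fracmap a%:F = (h a)%:F.
Proof. by rewrite -[a%:F]divr1 -tofrac1 fracmapE ?oner_eq0 // rmorph1 tofrac1 divr1. Qed.

Lemma fracmap_zmod : zmod_morphism fracmap.
Proof.
move=> x y; have [a [b [b0 ->]]] := frac_ex x; have [c [d [d0 ->]]] := frac_ex y.
have subE a' b' c' d' : b' != 0 -> d' != 0 ->
    a'%:F / b'%:F - c'%:F / d'%:F = (a' * d' - c' * b')%:F / (b' * d')%:F :> L.
  move=> b0' d0'; rewrite -mulNr addf_div ?tofrac_eq0 // tofracB !tofracM mulNr.
  done.
by rewrite subE // !fracmapE ?mulf_neq0 // subE ?h_neq0 // rmorphB !rmorphM.
Qed.
Lemma fracmap_monoid : monoid_morphism fracmap.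
Proof.
split; first by rewrite -tofrac1 fracmap_tofrac rmorph1.
move=> x y; have [a [b [b0 ->]]] := frac_ex x; have [c [d [d0 ->]]] := frac_ex y.
by rewrite !fracmapE // !mulf_div -!tofracM fracmapE ?mulf_neq0 // !rmorphM.
Qed.
End LiftToFractions.

Section Concrete.
Variables (k : fieldType) (n : nat) (p : nat -> nat).
Local Notation R := {mpoly k[NV n p]}.
Local Notation L := (Lfld k n p).
Local Notation Var := (Var n p).
Local Notation Mt := (Mt n p).
Local Notation actM := (@Defs.actM k n p).
Local Notation actG := (@Defs.actG k n p).
Implicit Types (v w : Var) (m : Mt) (s : {perm Var}).

Lemma substL_zmod (g : Var -> R) : zmod_morphism (substL g).
Proof. by move=> a b; exact: comp_mpolyB. Qed.
Lemma substL_monoid (g : Var -> R) : monoid_morphism (substL g).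
Proof. by split; [exact: comp_mpoly1 | move=> a b; exact: (rmorphM (comp_mpoly _))]. Qed.
HB.instance Definition _ (g : Var -> R) :=
  GRing.isZmodMorphism.Build R R (substL g) (substL_zmod g).
HB.instance Definition _ (g : Var -> R) :=
  GRing.isMonoidMorphism.Build R R (substL g) (substL_monoid g).

Lemma substL_xv (g : Var -> R) v : substL g (xv k v) = g v.
Proof. by rewrite /substL /xv /comp_mpoly mmapX mmap1U tnth_mktuple enum_rankK. Qed.
Lemma substLC (g : Var -> R) (c : k) : substL g c%:MP = c%:MP.
Proof. exact: comp_mpolyC. Qed.

Lemma substL_unique (h : {rmorphism R -> R}) (q : R) :
  (forall c : k, h c%:MP = c%:MP) -> h q = substL (fun v => h (xv k v)) q.
Proof.
move=> hC; rewrite [in LHS](mpolyE q) /substL comp_mpolyEX rmorph_sum /=.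
apply: eq_bigr => m _; rewrite -mul_mpolyC rmorphM /= hC mul_mpolyC; congr (_ *: _).
rewrite comp_mpolyX mpolyXE_id rmorph_prod; apply: eq_bigr => i _.
by rewrite rmorphXn tnth_mktuple /xv enum_valK.
Qed.

Lemma substL_comp (g g' : Var -> R) q : substL g (substL g' q) = substL (fun v => substL g (g' v)) q.
Proof.
have /= -> := @substL_unique (substL g \o substL g' : {rmorphism R -> R}) q.
  by congr (comp_mpoly _ q); apply: eq_mktuple => i /=; rewrite substL_xv.
by move=> c; rewrite !substLC.
Qed.
Lemma eq_substL (g g' : Var -> R) q : g =1 g' -> substL g q = substL g' q.
Proof. by move=> H; congr (comp_mpoly _ q); apply: eq_mktuple => i. Qed.
Lemma substL_id q : substL (@xv k n p) q = q.
Proof.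
rewrite -[RHS]comp_mpoly_id; congr (comp_mpoly _ q).
by apply: eq_mktuple => i; rewrite /xv enum_valK.
Qed.

Definition shg m : Var -> R := fun v => xv k v + ((m v)%:~R)%:MP.
Lemma shg_comp m m' q : substL (shg m) (substL (shg m') q) = substL (shg (m + m')) q.
Proof.
rewrite substL_comp; apply: eq_substL => v.
by rewrite /shg rmorphD /= substL_xv substLC ffunE addrAC intrD mpolyCD addrA [in RHS]addrAC.
Qed.
Lemma shg0 q : substL (shg 0) q = q.
Proof. by rewrite -[RHS]substL_id; apply: eq_substL => v; rewrite /shg ffunE mpolyC0 addr0. Qed.
Lemma shg_inj m : injective (substL (shg m)).
Proof. by apply: (can_inj (g := substL (shg (- m)))) => q; rewrite shg_comp addNr shg0. Qed.

HB.instance Definition _ s :=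
  GRing.isZmodMorphism.Build R R (@permL k n p s) (substL_zmod _).
HB.instance Definition _ s :=
  GRing.isMonoidMorphism.Build R R (@permL k n p s) (substL_monoid _).

Lemma permL_xv s v : permL s (xv k v) = xv k (s v).
Proof. exact: substL_xv. Qed.
(** The product of permutations applies its left factor first, hence the reversed order. *)
Lemma permL_comp s t (q : R) : permL s (permL t q) = permL (t * s)%g q.
Proof.
by rewrite /permL substL_comp; apply: eq_substL => v; rewrite substL_xv permM.
Qed.
Lemma permL1 (q : R) : permL 1%g q = q.
Proof. by rewrite -[RHS]substL_id; apply: eq_substL => v; rewrite perm1. Qed.
Lemma permL_inj s : injective (@permL k n p s).
Proof. by apply: (can_inj (g := @permL k n p s^-1%g)) => q; rewrite permL_comp mulgV permL1. Qed.

HB.instance Definition _ m :=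
  GRing.isZmodMorphism.Build L L (actM m) (fracmap_zmod (@shg_inj m)).
HB.instance Definition _ m :=
  GRing.isMonoidMorphism.Build L L (actM m) (fracmap_monoid (@shg_inj m)).
HB.instance Definition _ s :=
  GRing.isZmodMorphism.Build L L (actG s) (fracmap_zmod (@permL_inj s)).
HB.instance Definition _ s :=
  GRing.isMonoidMorphism.Build L L (actG s) (fracmap_monoid (@permL_inj s)).

Lemma actM_tofrac m (q : R) : actM m (q%:F : L) = (substL (shg m) q)%:F.
Proof. exact: (fracmap_tofrac (@shg_inj m)). Qed.
Lemma actG_tofrac s (q : R) : actG s (q%:F : L) = (permL s q)%:F.
Proof. exact: (fracmap_tofrac (@permL_inj s)). Qed.

Lemma Lfld_ind (f g : {rmorphism L -> L}) : (forall q : R, f q%:F = g q%:F) -> f =1 g.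
Proof.
move=> H x; have [a [b [b0 ->]]] := frac_ex x.
by rewrite !fmorph_div /= !H.
Qed.

Lemma actM0 (x : L) : actM 0 x = x :> L.
Proof.
apply: (Lfld_ind (f := actM 0) (g := idfun)) => q /=.
by rewrite actM_tofrac shg0.
Qed.
Lemma actM_add m m' (x : L) : actM (m + m') x = actM m (actM m' x) :> L.
Proof.
apply: (Lfld_ind (f := actM (m + m')) (g := (actM m \o actM m' : {rmorphism L -> L}))) => q /=.
by rewrite !actM_tofrac shg_comp.
Qed.
Lemma actG_mul s t (x : L) : actG s (actG t x) = actG (t * s)%g x :> L.
Proof.
symmetry; apply: (Lfld_ind (f := actG (t * s)%g) (g := (actG s \o actG t : {rmorphism L -> L}))) => q /=.
by rewrite !actG_tofrac permL_comp.
Qed.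
Lemma actG_actM s m (x : L) : actG s (actM m x) = actM (conjM s m) (actG s x) :> L.
Proof.
apply: (Lfld_ind (f := (actG s \o actM m : {rmorphism L -> L}))
  (g := (actM (conjM s m) \o actG s : {rmorphism L -> L}))) => q /=.
rewrite !(actM_tofrac, actG_tofrac); congr (_%:F).
rewrite /permL !substL_comp; apply: eq_substL => v.
by rewrite /shg rmorphD /= substLC !substL_xv ffunE permK.
Qed.

Definition cstL (c : k) : L := (c%:MP)%:F.
Lemma cstL_zmod : zmod_morphism cstL.
Proof. by move=> a b; rewrite /cstL mpolyCB tofracB. Qed.
Lemma cstL_monoid : monoid_morphism cstL.
Proof. by split; [rewrite /cstL mpolyC1 tofrac1 | move=> a b; rewrite /cstL mpolyCM tofracM]. Qed.
HB.instance Definition _ := GRing.isZmodMorphism.Build k L cstL cstL_zmod.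
HB.instance Definition _ := GRing.isMonoidMorphism.Build k L cstL cstL_monoid.

Lemma actM_cst m c : actM m (cstL c) = cstL c.
Proof. by rewrite /cstL actM_tofrac substLC. Qed.
Lemma actG_cst s c : actG s (cstL c) = cstL c.
Proof. by rewrite /cstL actG_tofrac /permL substLC. Qed.

Definition LM_data : skew_data k L Mt :=
  @SkewData k L Mt (fun m => actM m) cstL actM0 actM_add actM_cst.

Definition zL v : L := - ((rowv v)%:R + (xv k v)%:F).
Definition muL v : Mt := [ffun u => - (u == v)%:R].

Lemma zL_tofrac v : zL v = (- ((rowv v)%:R%:MP + xv k v))%:F.
Proof. by rewrite tofracN tofracD mpolyC_nat rmorph_nat. Qed.

Lemma xv_neq0 v (c : k) : xv k v + c%:MP != 0.
Proof.
apply/eqP => /(congr1 (fun q : R => q@_U_(enum_rank v))).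
rewrite mcoeffD mcoeff0 mcoeffXU eqxx mcoeffC mnm1_eq0 mulr0 addr0 => /eqP.
by rewrite oner_eq0.
Qed.
Lemma xv_diff_neq0 v w (c : k) : v != w -> xv k v - xv k w + c%:MP != 0.
Proof.
move=> nvw; apply/eqP => /(congr1 (fun q : R => q@_U_(enum_rank v))).
rewrite mcoeffD mcoeffB mcoeff0 !mcoeffXU eqxx mcoeffC mnm1_eq0 mulr0 addr0.
rewrite (inj_eq enum_rank_inj) [w == v]eq_sym (negbTE nvw) subr0 => /eqP.
by rewrite oner_eq0.
Qed.

Hypothesis char0 : [pchar k] =i pred0.

Lemma gtL : gt_data LM_data zL muL.
Proof.
have natF c : c%:R = ((c%:R : k)%:MP)%:F :> L by rewrite mpolyC_nat rmorph_nat.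
have dif v w (c : k) : v != w -> zL v - zL w + cstL c != 0.
  move=> nvw; rewrite !zL_tofrac /cstL -tofracB -tofracD tofrac_eq0 -oppr_eq0.
  have := xv_diff_neq0 ((rowv v)%:R - (rowv w)%:R - c) nvw; congr (_ != _).
  by rewrite !mpolyCB; ring.
have cst1 : cstL 1 = 1 by exact: rmorph1.
split.
- move=> v w; rewrite -[LHS]/(actM (muL v) (zL w)) !zL_tofrac actM_tofrac natF -tofracD.
  congr (_%:F); rewrite rmorphN rmorphD /= substLC substL_xv /shg ffunE.
  have b01 (b : bool) : (b%:R : int)%:~R = b%:R :> k by case: b.
  by rewrite intrN b01 mpolyCN eq_sym; ring.
- by move=> v w nvw; have := dif v w 0 nvw; rewrite [cstL 0]rmorph0 addr0.
- by move=> v w nvw; have := dif v w 1 nvw; rewrite cst1.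
- move=> v; rewrite zL_tofrac tofrac_eq0 oppr_eq0 addrC; exact: xv_neq0.
- move=> v; rewrite zL_tofrac -(tofrac1 R) -tofracB tofrac_eq0 -oppr_eq0.
  have := xv_neq0 v ((rowv v)%:R + 1); congr (_ != _).
  by rewrite mpolyCD mpolyC1; ring.
- rewrite natF tofrac_eq0 mpolyC_eq0.
  by have := char0 2; rewrite !inE /= => /negbT.
Qed.

(** Since [zL v] plus the row number is -x_v, the products are distinct monomials up to sign. *)
Lemma monomials_indep (E : nat) (c : {ffun Var -> 'I_E} -> k) :
  \sum_al cstL (c al) * \prod_v (zL v + (rowv v)%:R) ^+ al v = 0 -> forall al, c al = 0.
Proof.
move=> H al.
have yE v : zL v + (rowv v)%:R = - (xv k v)%:F by rewrite /zL opprD addrAC addNr add0r.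
pose mn (be : {ffun Var -> 'I_E}) : 'X_{1..NV n p} := [multinom (be (enum_val i) : nat) | i < NV n p].
have mn_inj : injective mn.
  move=> be be' /mnmP Hb; apply/ffunP => v; apply: val_inj.
  by have := Hb (enum_rank v); rewrite !mnmE enum_rankK.
have prE (be : {ffun Var -> 'I_E}) : \prod_v (zL v + (rowv v)%:R) ^+ be v =
   (((-1) ^+ (\sum_v be v) : k)%:MP * 'X_[mn be])%:F.
  rewrite mpolyXE_id rmorphM rmorph_prod /= rmorphXn /= mpolyCN mpolyC1.
  have -> : \prod_i ('X_i ^+ mn be i : R)%:F = \prod_v ((xv k v)%:F : L) ^+ be v.
    rewrite (reindex_onto enum_rank enum_val) /=; last by move=> i _; rewrite enum_valK.
    rewrite (eq_bigl predT); last by move=> v; rewrite enum_rankK eqxx.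
    by apply: eq_bigr => v _; rewrite mnmE enum_rankK tofracXn.
  rewrite expr_sum rmorph_prod -big_split /=; apply: eq_bigr => v _.
  by rewrite yE tofracXn tofracN tofrac1 -exprMn mulN1r.
have E0 : \sum_be (c be * (-1) ^+ (\sum_v be v)) *: 'X_[mn be] = 0 :> R.
  apply/eqP; rewrite -(tofrac_eq0 (R := R)) rmorph_sum /= -[X in _ == X]H; apply/eqP.
  by apply: eq_bigr => be _; rewrite prE /cstL -tofracM -mul_mpolyC mpolyCM mulrA.
have := congr1 (fun q : R => q@_(mn al)) E0.
rewrite mcoeff0 raddf_sum (bigD1 al) //= mcoeffZ mcoeffX eqxx mulr1 [X in _ + X]big1 ?addr0.
  by move/eqP; rewrite mulf_eq0 expf_eq0 oppr_eq0 oner_eq0 andbF orbF => /eqP.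
by move=> be nb; rewrite mcoeffZ mcoeffX (inj_eq mn_inj) (negbTE nb) mulr0.
Qed.

Lemma card_rowv i : (i < n)%N -> #|[pred v : Var | rowv v == i]| = msum p i.
Proof.
move=> Hi.
rewrite -sum1_card.
transitivity (\sum_(x : 'I_n * 'I_n * 'I_(maxp n p) | @Vpred n p x && (x.1.1 == i :> nat)) 1)%N.
  rewrite (reindex_omap (fun v : Var => sval v) insub) /=; last first.
    by move=> x /andP [Hx _]; rewrite insubT.
  apply: eq_bigl => v; rewrite valK eqxx andbT /rowv unfold_in.
  by case: v => [x Hx] /=; rewrite Hx.
rewrite (eq_bigl (fun x : 'I_n * 'I_n * 'I_(maxp n p) =>
   ((x.1.1 == i :> nat) && (x.1.2 <= x.1.1)%N) && (x.2 < p x.1.2)%N)); last first.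
  by move=> x; rewrite /Vpred andbC andbA.
rewrite -(pair_big_dep (fun x : 'I_n * 'I_n => (x.1 == i :> nat) && (x.2 <= x.1)%N)
  (fun x (kk : 'I_(maxp n p)) => (kk < p x.2)%N) (fun _ _ => 1%N)) /=.
rewrite (eq_bigr (fun x : 'I_n * 'I_n => p x.2)); last first.
  move=> x _; have Hx : (p x.2 <= maxp n p)%N by apply: (leq_bigmax (F := fun j : 'I_n => p j)).
  rewrite -(big_ord_widen _ (fun=> 1%N) Hx) sum_nat_const card_ord muln1; done.
rewrite -(pair_big_dep (fun r : 'I_n => r == i :> nat) (fun r (j : 'I_n) => (j <= r)%N)
  (fun _ j => p j)) /=.
rewrite (big_pred1 (Ordinal Hi)); last by move=> r.
by rewrite /msum (big_ord_widen _ p Hi) /=; apply: eq_bigl => j; rewrite ltnS.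
Qed.
End Concrete.

(** * The algebra W(pi) *)


Section Transfer.
Variables (k : fieldType) (n : nat) (p : nat -> nat) (A B : algType k).
Variables (h : {rmorphism B -> A}) (d e f : nat -> nat -> A) (d' e' f' : nat -> nat -> B).
Hypothesis h_inj : injective h.
Hypothesis hd : forall i r, (i < n)%N -> (0 < r)%N -> h (d' i r) = d i r.
Hypothesis he : forall i r, (i.+1 < n)%N -> (yshift p i < r)%N -> h (e' i r) = e i r.
Hypothesis hf : forall i r, (i.+1 < n)%N -> (0 < r)%N -> h (f' i r) = f i r.

Lemma Dinv_morph i r : (i < n)%N -> h (Dinv d' i r) = Dinv d i r.
Proof.
move=> Hi; elim/ltn_ind: r => -[|r] IH; first by rewrite !Dinv0 rmorph1.
rewrite !DinvS rmorphN rmorph_sum; congr (- _); apply: eq_bigr => t _.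
by rewrite rmorphM /= hd // IH // ltnS leq_subr.
Qed.
Lemma Dc_morph i r : (i < n)%N -> h (Dc d' i r) = Dc d i r.
Proof. by move=> Hi; rewrite /Dc; case: eqP => [_|/eqP r0]; rewrite ?rmorph1 ?hd ?lt0n. Qed.

(** Relations may be tested after an injective homomorphism. Applied to the inclusion of a
    subalgebra of [W], this lifts the generators into the subalgebra. *)
Lemma W_relations_transfer : W_relations n p d e f -> W_relations n p d' e' f'.
Proof.
have nb (a b : bool) : h (a%:R - b%:R) = a%:R - b%:R by rewrite rmorphB !rmorph_nat.
case=> [h1 [h2 [h3 [h4 [h5 [h6 [h7 [h8 [h9 [h10 [h11 [h12 h13]]]]]]]]]]]].
rewrite /W_relations /comm; repeat split.
- move=> i j r s Hi Hj Hr Hs; apply: h_inj.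
  by rewrite rmorph0 rmorphB !rmorphM /= !hd //; apply: h1.
- move=> i j r s Hi Hj Hr Hs; apply: h_inj.
  rewrite rmorphB !rmorphM /= he // hf // [LHS](h2 i j r s Hi Hj Hr Hs).
  case: eqP => _; last by rewrite rmorph0.
  rewrite rmorphN rmorph_sum; congr (- _); apply: eq_bigr => t _.
  by rewrite rmorphM /= Dinv_morph ?Dc_morph // ltnW.
- move=> i j r s Hi Hj Hr Hs; apply: h_inj.
  rewrite rmorphB !rmorphM /= he // hd // [LHS](h3 i j r s Hi Hj Hr Hs) nb rmorph_sum.
  congr (_ * _); apply: eq_bigr => t _; rewrite rmorphM /= Dc_morph // he //.
  by have := ltn_ord t; lia.
- move=> i j r s Hi Hj Hr Hs; apply: h_inj.
  rewrite rmorphB !rmorphM /= hf // hd // [LHS](h4 i j r s Hi Hj Hr Hs) nb rmorph_sum.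
  congr (_ * _); apply: eq_bigr => t _; rewrite rmorphM /= Dc_morph // hf //.
  by have := ltn_ord t; lia.
- move=> i r s Hi Hr Hs; apply: h_inj.
  by rewrite !(rmorphB, rmorphD, rmorphM) /= !he //; try lia; apply: h5.
- move=> i r s Hi Hr Hs; apply: h_inj.
  by rewrite !(rmorphB, rmorphD, rmorphM) /= !hf //; apply: h6.
- move=> i r s Hi Hr Hs; apply: h_inj.
  by rewrite !(rmorphB, rmorphN, rmorphM) /= !he //; try lia; apply: h7.
- move=> i r s Hi Hr Hs; apply: h_inj.
  by rewrite !(rmorphB, rmorphN, rmorphM) /= !hf //; try lia; apply: h8.
- move=> i j r s Hi Hj Hij Hr Hs; apply: h_inj.
  by rewrite rmorph0 rmorphB !rmorphM /= !he //; apply: h9.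
- move=> i j r s Hi Hj Hij Hr Hs; apply: h_inj.
  by rewrite rmorph0 rmorphB !rmorphM /= !hf //; apply: h10.
- move=> i j r s t Hi Hj Hij Hr Hs Ht; apply: h_inj.
  by rewrite rmorph0 !(rmorphB, rmorphD, rmorphM) /= !he //; apply: h11.
- move=> i j r s t Hi Hj Hij Hr Hs Ht; apply: h_inj.
  by rewrite rmorph0 !(rmorphB, rmorphD, rmorphM) /= !hf //; apply: h12.
- by move=> r Hn Hr; apply: h_inj; rewrite rmorph0 hd ?h13 //; lia.
Qed.
End Transfer.

Definition subalg_prop (k : fieldType) (W : algType k) (S : W -> Prop) : Prop :=
  [/\ S 1, forall (c : k) x y, S x -> S y -> S (c *: x + y) & forall x y, S x -> S y -> S (x * y)].

(** The closure proof is an argument so that the structure of a closed subalgebra can be attached to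
    the predicate itself. *)
Definition subalg_pred (k : fieldType) (W : algType k) (S : W -> Prop) (_ : subalg_prop S) : {pred W} :=
  fun w => `[<S w>].

Section Subalgebra.
Variables (k : fieldType) (W : algType k) (S : W -> Prop) (HS : subalg_prop S).

Lemma subalg_pred_closed : subalg_closed (subalg_pred HS).
Proof.
case: (HS) => S1 Slin SM; split; first exact/asboolP.
- by move=> c x y /asboolP Hx /asboolP Hy; apply/asboolP; apply: Slin.
- by move=> x y /asboolP Hx /asboolP Hy; apply/asboolP; apply: SM.
Qed.
HB.instance Definition _ := GRing.isSubalgClosed.Build k W (subalg_pred HS) subalg_pred_closed.
Definition subalg : Type := {w : W | subalg_pred HS w}.
HB.instance Definition _ := [isSub of subalg for (@sval W (subalg_pred HS))].
HB.instance Definition _ := [Choice of subalg by <:].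
HB.instance Definition _ := [SubChoice_isSubAlgebra of subalg by <:].
End Subalgebra.

Section Induction.
Variables (k : fieldType) (n : nat) (p : nat -> nat) (W : algType k) (d e f : nat -> nat -> W).
Hypothesis HW : is_W_pi n p d e f.
Variable S : W -> Prop.
Hypothesis S1 : S 1.
Hypothesis Slin : forall (c : k) x y, S x -> S y -> S (c *: x + y).
Hypothesis SM : forall x y, S x -> S y -> S (x * y).
Hypothesis Sd : forall i r, (i < n)%N -> (0 < r)%N -> S (d i r).
Hypothesis Se : forall i r, (i.+1 < n)%N -> (yshift p i < r)%N -> S (e i r).
Hypothesis Sf : forall i r, (i.+1 < n)%N -> (0 < r)%N -> S (f i r).

(** Initiality yields induction: the lifted generators give a homomorphism from [W] to the
    subalgebra of S, and its composite with the inclusion is the identity by uniqueness. *)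
Lemma W_induction w : S w.
Proof.
have [Hrel Huniv] := HW.
have HS : subalg_prop S by split.
pose T := subalg HS.
pose lift (g : nat -> nat -> W) i r : T := insubd (0 : T) (g i r).
have liftE g i r : S (g i r) -> val (lift g i r) = g i r.
  by move=> H; rewrite val_insubd ifT //; apply/asboolP.
have HT : W_relations n p (lift d) (lift e) (lift f).
  apply: (@W_relations_transfer k n p W (subalg HS) (val : {rmorphism subalg HS -> W}) d e f) => //.
  - exact: val_inj.
  - by move=> i r Hi Hr; rewrite -[LHS]/(val _) liftE //; apply: Sd.
  - by move=> i r Hi Hr; rewrite -[LHS]/(val _) liftE //; apply: Se.
  - by move=> i r Hi Hr; rewrite -[LHS]/(val _) liftE //; apply: Sf.
have [h [[[hl hm h1] hd he hf] _]] := Huniv T _ _ _ HT.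
have [g [_ Hg]] := Huniv W _ _ _ Hrel.
have Hid : id =1 g by apply: Hg; split => //; split.
have Hh : (fun w => val (h w)) =1 g.
  apply: Hg; split.
  - by split=> [c x y|x y|]; rewrite ?hl ?hm ?h1 ?linearP ?rmorphM ?rmorph1.
  - by move=> i r Hi Hr; rewrite hd // liftE //; apply: Sd.
  - by move=> i r Hi Hr; rewrite he // liftE //; apply: Se.
  - by move=> i r Hi Hr; rewrite hf // liftE //; apply: Sf.
rewrite [w]Hid -Hh; apply/asboolP; exact: (valP (h w)).
Qed.
End Induction.


Lemma Var_ex (n : nat) (p : nat -> nat) r i kk : (i <= r)%N -> (r < n)%N -> (kk < p i)%N ->
  exists v : Var n p, [/\ rowv v = r, (sval v).1.2 = i :> nat & (sval v).2 = kk :> nat].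
Proof.
move=> Hir Hr Hk; have Hi : (i < n)%N by lia.
have Hk' : (kk < maxp n p)%N.
  by apply: leq_trans Hk _; apply: (leq_bigmax (F := fun j : 'I_n => p j) (Ordinal Hi)).
have Hv : Vpred ((Ordinal Hr, Ordinal Hi), Ordinal Hk') by rewrite /Vpred /= Hir.
by exists (exist (fun v => Vpred v) _ Hv : Var n p).
Qed.

(** * The loop filtration of W(pi) and its spanning monomials *)

Section LoopFiltration.
Variables (k : fieldType) (n : nat) (p : nat -> nat) (W : algType k) (d e f : nat -> nat -> W).
Hypothesis Hrel : W_relations n p d e f.
Hypothesis p_sorted : forall i, (i.+1 < n)%N -> (p i <= p i.+1)%N.
Hypothesis two : (2%:R : k) != 0.

Definition loop_gen (r : nat) (g : W) : Prop :=
  [\/ exists2 i, (i < n)%N & g = d i r.+1,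
      exists i, [/\ (i.+1 < n)%N, (yshift p i <= r)%N & g = e i r.+1] |
      exists2 i, (i.+1 < n)%N & g = f i r.+1].
Local Notation fil := (wfil loop_gen).
Local Notation br := (fun x y : W => x * y - y * x).
Local Notation x := (fun i r => e i r.+1).
Local Notation y := (fun i r => f i r.+1).
Local Notation h := (fun i r => d i r.+1).
Local Notation sx := (yshift p).
Local Notation sy := (fun _ : nat => 0%N).
Let HF := wfil_bracket loop_gen.

Let fd i r : (i < n)%N -> fil r.+1 (d i r.+1).
Proof. by move=> Hi; apply: wfil_gen; apply: Or31; exists i. Qed.
Let fe i r : (i.+1 < n)%N -> (sx i <= r)%N -> fil r.+1 (e i r.+1).
Proof. by move=> Hi Hr; apply: wfil_gen; apply: Or32; exists i. Qed.
Let ff i r : (i.+1 < n)%N -> fil r.+1 (f i r.+1).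
Proof. by move=> Hi; apply: wfil_gen; apply: Or33; exists i. Qed.
Let fDc i t : (i < n)%N -> fil t.-1.+1 (Dc d i t).
Proof. by move=> Hi; case: t => [|t]; [apply: wfil1 | apply: fd]. Qed.
Let fDinv i t : (i < n)%N -> fil t.-1.+1 (Dinv d i t).
Proof.
move=> Hi; elim/ltn_ind: t => -[|t] IH; first exact: wfil1.
rewrite DinvS; apply: wfilN; apply: wfil_sum => s _ /=.
have Hs := ltn_ord s.
have H : fil (t - s).-1.+1 (Dinv d i (t - s)) by apply: IH; lia.
apply: (wfil_le (D := (s + (t - s).-1).+1)); first lia.
by apply: wfilM => //; apply: fd.
Qed.
Let scal (a b : bool) (w : W) : (a%:R - b%:R) * w = ((a%:R - b%:R : k)) *: w.
Proof. by rewrite mulrBl scalerBl !mulr_natl !scaler_nat. Qed.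

(** The generator with superscript r + 1 has degree r. The product terms in the defining relations
    are then one degree below the brackets, so only the relations of a current algebra remain to
    leading order. *)
Lemma current_e : current_relations br fil n x h sx 1.
Proof.
case: Hrel => [h1 [h2 [h3 [h4 [h5 [h6 [h7 [h8 [h9 [h10 [h11 [h12 h13]]]]]]]]]]]].
split.
- by move=> i r Hi Hr; apply: fe.
- move=> i r s Hi Hr Hs; rewrite /fil_eq [X in fil _ X](h5 i r.+1 s.+1) //.
  by apply: wfilD; [| rewrite addnC]; apply: wfilM; apply: fe.
- move=> i r s Hi Hr Hs; rewrite /fil_eq [X in fil _ X](h7 i r.+1 s.+1) //.
  by apply: wfilN; apply: wfilM; apply: fe => //; lia.
- move=> i j r s Hi Hj Hij Hr Hs; rewrite [X in fil _ X](h9 i j r.+1 s.+1) //.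
  exact: wfil0.
- move=> i j r s t Hi Hj Hij Hr Hs Ht.
  rewrite [X in fil _ X](h11 i j r.+1 s.+1 t.+1) //; exact: wfil0.
- by move=> i r Hi; apply: fd.
- move=> i j r s Hj Hi Hs; rewrite /fil_eq [X in fil _ (X - _)](h3 j i r.+1 s.+1) //.
  rewrite scal mul1r -scalerBr; apply: wfilZ.
  (* The term t = 0, where [Dc] is 1, is the leading one; the remaining products have degree r + s -
     1. *)
  rewrite big_ord_recl /= mul1r (_ : (r.+1 + s.+1 - 1 - 0 = (r + s).+1)%N); last lia.
  rewrite addrAC subrr add0r; apply: wfil_sum => t _.
  have Ht := ltn_ord t; rewrite /bump add1n.
  rewrite (_ : (r.+1 + s.+1 - 1 - t.+1 = (r + s - t.+1).+1)%N); last lia.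
  apply: (wfil_le (D := (t + (r + s - t.+1)).+1)); first lia.
  by apply: wfilM; [apply: fd | apply: fe => //; lia].
Qed.

Lemma current_f : current_relations br fil n y h sy (-1).
Proof.
case: Hrel => [h1 [h2 [h3 [h4 [h5 [h6 [h7 [h8 [h9 [h10 [h11 [h12 h13]]]]]]]]]]]].
split.
- by move=> i r Hi Hr; apply: ff.
- move=> i r s Hi Hr Hs; rewrite /fil_eq -opprB [X in fil _ (- X)](h6 i r.+1 s.+1) //.
  by apply: wfilN; apply: wfilD; [| rewrite addnC]; apply: wfilM; apply: ff.
- move=> i r s Hi Hr Hs; rewrite /fil_eq -opprB [X in fil _ (- X)](h8 i r.+1 s.+1) //.
  by rewrite opprK addnC; apply: wfilM; apply: ff => //; lia.
- move=> i j r s Hi Hj Hij Hr Hs; rewrite [X in fil _ X](h10 i j r.+1 s.+1) //.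
  exact: wfil0.
- move=> i j r s t Hi Hj Hij Hr Hs Ht.
  rewrite [X in fil _ X](h12 i j r.+1 s.+1 t.+1) //; exact: wfil0.
- by move=> i r Hi; apply: fd.
- move=> i j r s Hj Hi Hs; rewrite /fil_eq [X in fil _ (X - _)](h4 j i r.+1 s.+1) //.
  rewrite scal mulN1r opprB -scalerBr; apply: wfilZ.
  rewrite big_ord_recl /= mulr1 (_ : (r.+1 + s.+1 - 1 - 0 = (r + s).+1)%N); last lia.
  rewrite addrAC subrr add0r; apply: wfil_sum => t _.
  have Ht := ltn_ord t; rewrite /bump add1n.
  rewrite (_ : (r.+1 + s.+1 - 1 - t.+1 = (r + s - t.+1).+1)%N); last lia.
  apply: (wfil_le (D := ((r + s - t.+1) + t).+1)); first lia.
  by apply: wfilM; [apply: ff | apply: fd].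
Qed.

Lemma current_ef i j r s : (i.+1 < n)%N -> (j.+1 < n)%N -> (sx i <= r)%N -> (0 <= s)%N ->
  fil_eq fil (r + s) (br (x i r) (y j s)) (if i == j then h i (r + s) - h i.+1 (r + s) else 0).
Proof.
case: Hrel => [_ [h2 _]] Hi Hj Hr _.
rewrite /fil_eq [X in fil _ (X - _)](h2 i j r.+1 s.+1) //; case: eqP => _; last first.
  by rewrite subrr; apply: wfil0.
rewrite (_ : (r.+1 + s.+1 = (r + s).+2)%N); last lia.
(* Only the extreme terms reach degree r + s: the first gives d_{i+1}, and the last gives the
   coefficient of the inverse of D_i, whose leading term is -d_i. *)
rewrite big_ord_recl big_ord_recr /= mul1r.
rewrite (_ : ((r + s).+2 - 1 - 0 = (r + s).+1)%N); last lia.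
rewrite (_ : ((r + s).+2 - 1 - bump 0 (r + s) = 0)%N) /Dc /=; last by rewrite /bump; lia.
rewrite mulr1 /bump add1n DinvS big_ord_recr /= subnn Dinv0 mulr1.
set A := \sum_(i0 < r + s) _; set B := \sum_(i0 < r + s) _.
have -> : - (d i.+1 (r + s).+1 + (A - (B + d i (r + s).+1))) -
    (d i (r + s).+1 - d i.+1 (r + s).+1) = B - A.
  have key (u v X : W) : - (u + X) - (v - u) = - X - v.
    by rewrite opprB (opprD u X) addrACA addNr add0r.
  by rewrite key opprB addrAC addrK.
apply: wfilB; apply: wfil_sum => t _; have Ht := ltn_ord t.
  apply: (wfil_le (D := (t + (r + s - t).-1).+1)); first lia.
  by apply: wfilM; [apply: fd; lia | apply: fDinv; lia].
have -> : ((r + s).+2 - 1 - t.+1 = (r + s - t))%N by lia.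
apply: (wfil_le (D := (t + (r + s - t).-1).+1)); first lia.
by apply: wfilM; [have := @fDinv i t.+1; apply; lia | apply: (@fDc i.+1)].
Qed.

Local Notation rootx := (root br x sx).
Local Notation rooty := (root br y sy).
Local Notation I := (Var n p + {v : Var n p | (rowv v < n.-1)%N})%type.

(** A variable (r, i, k) labels the Cartan element of row i if i = r, and otherwise the raising root
    vector of the simple roots i, ..., r - 1. The second copy, with r < n - 1, labels the lowering
    root vectors of i, ..., r. Each family takes p_i consecutive degrees. *)
Definition pbw_deg (a : I) : nat :=
  match a with
  | inl v => let i := nat_of_ord (sval v).1.2 in let r := rowv v in
      if i == r then nat_of_ord (sval v).2 else (rshift sx i (r - i).-1 + (sval v).2)%N
  | inr v => (sval (sval v)).2
  end.
Definition pbw_gen (a : I) : W :=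
  match a with
  | inl v => let i := nat_of_ord (sval v).1.2 in let r := rowv v in
      if i == r then h i (pbw_deg a) else rootx i (r - i).-1 (pbw_deg a)
  | inr v => let i := nat_of_ord (sval (sval v)).1.2 in
      rooty i (rowv (sval v) - i) (pbw_deg a)
  end.

Let sy0 i l : rshift sy i l = 0%N.
Proof. by elim: l => //= l ->. Qed.

Let pbw_cases a :
  [\/ exists2 i, (i < n)%N & pbw_gen a = h i (pbw_deg a),
      exists i l, [/\ (i + l.+1 < n)%N, (rshift sx i l <= pbw_deg a)%N & pbw_gen a = rootx i l (pbw_deg a)] |
      exists i l, [/\ (i + l.+1 < n)%N, (rshift sy i l <= pbw_deg a)%N & pbw_gen a = rooty i l (pbw_deg a)]].
Proof.
case: a => v.
  have Hr : (rowv v < n)%N by apply: ltn_ord.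
  have Hi : ((sval v).1.2 <= rowv v)%N by case/andP: (svalP v).
  rewrite /pbw_gen; have [E|ne] := eqVneq (nat_of_ord (sval v).1.2) (rowv v).
    by apply: Or31; exists (nat_of_ord (sval v).1.2) => //; rewrite E.
  apply: Or32; exists (nat_of_ord (sval v).1.2), (rowv v - (sval v).1.2).-1; split => //; first lia.
  by rewrite /pbw_deg (negbTE ne) leq_addr.
have Hv : (rowv (sval v) < n.-1)%N := svalP v.
have Hi : ((sval (sval v)).1.2 <= rowv (sval v))%N by case/andP: (svalP (sval v)).
apply: Or33; exists (nat_of_ord (sval (sval v)).1.2), (rowv (sval v) - (sval (sval v)).1.2)%N.
by split => //; rewrite ?sy0 //; lia.
Qed.

Let pbw_h i D : (i < n)%N -> (D < p i)%N -> exists a, pbw_gen a = h i D /\ pbw_deg a = D.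
Proof.
move=> Hi HD; have [v [H1 H2 H3]] := Var_ex (leqnn i) Hi HD.
by exists (inl v); rewrite /pbw_gen /= H1 H2 eqxx H3.
Qed.
Let pbw_x i l D : (i + l.+1 < n)%N -> (rshift sx i l <= D < rshift sx i l + p i)%N ->
  exists a, pbw_gen a = rootx i l D /\ pbw_deg a = D.
Proof.
move=> Hn /andP [H1 H2].
have [|||v [E1 E2 E3]] := @Var_ex n p (i + l.+1) i (D - rshift sx i l); try lia.
exists (inl v); rewrite /pbw_gen /= E1 E2 E3 (_ : (i == i + l.+1)%N = false); last lia.
by rewrite (_ : (i + l.+1 - i).-1 = l) ?subnKC //; lia.
Qed.
Let pbw_y i l D : (i + l.+1 < n)%N -> (rshift sy i l <= D < rshift sy i l + p i)%N ->
  exists a, pbw_gen a = rooty i l D /\ pbw_deg a = D.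
Proof.
rewrite sy0 => Hn /andP [_ H2].
have [|||v [E1 E2 E3]] := @Var_ex n p (i + l) i D; try lia.
have Hv : (rowv v < n.-1)%N by rewrite E1; lia.
exists (inr (exist (fun v : Var n p => (rowv v < n.-1)%N) v Hv)).
by rewrite /pbw_gen /= E1 E2 E3 (_ : (i + l - i)%N = l) //; lia.
Qed.

Let Hhh i j r s : (i < n)%N -> (j < n)%N -> fil (r + s) (br (h i r) (h j s)).
Proof. by case: Hrel => [h1 _] Hi Hj; rewrite [X in fil _ X](h1 i j r.+1 s.+1) //; apply: wfil0. Qed.
Let p_shift i : (i.+1 < n)%N -> p i.+1 = (p i + sx i)%N.
Proof. by move=> Hi; have := p_sorted Hi; rewrite /yshift; lia. Qed.
Let h_trunc0 r : (0 < n)%N -> (p 0 <= r)%N -> fil r (h 0 r).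
Proof.
move=> Hn Hr; case: Hrel => [h1 [h2 [h3 [h4 [h5 [h6 [h7 [h8 [h9 [h10 [h11 [h12 h13]]]]]]]]]]]].
by rewrite h13 //; apply: wfil0.
Qed.

Let sy00 (i : nat) : sy i = 0%N. Proof. by []. Qed.

Lemma pbw_comm a b : zcomb fil pbw_gen pbw_deg (pbw_deg a + pbw_deg b)
  (pbw_gen a * pbw_gen b - pbw_gen b * pbw_gen a).
Proof.
exact: (Z_br HF two current_e current_f current_ef Hhh p_shift sy00 h_trunc0
  pbw_h pbw_x pbw_y pbw_cases a b).
Qed.

Lemma loop_gen_zcomb r g : loop_gen r g -> zcomb fil pbw_gen pbw_deg r g.
Proof.
case=> [[i Hi ->]|[i [Hi Hr ->]]|[i Hi ->]].
- exact: (zcomb_h HF two current_e current_f current_ef p_shift sy00 h_trunc0 pbw_h pbw_x pbw_y r Hi).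
- exact: (zcomb_x HF two current_e current_f current_ef p_shift sy00 h_trunc0 pbw_h pbw_x pbw_y Hi Hr).
- exact: (zcomb_y HF two current_e current_f current_ef p_shift sy00 h_trunc0 pbw_h pbw_x pbw_y Hi (leq0n r)).
Qed.
End LoopFiltration.

(** The spanning half of a PBW theorem, in the weighted form that the growth argument consumes: the
    algebra is commutative up to lower weight. *)
Theorem W_pbw (k : fieldType) (n : nat) (p : nat -> nat) (W : algType k) (d e f : nat -> nat -> W) :
  is_W_pi n p d e f -> (forall i, (i.+1 < n)%N -> (p i <= p i.+1)%N) -> (2%:R : k) != 0 ->
  exists (Z : Var n p + {v : Var n p | (rowv v < n.-1)%N} -> W) wt,
  [/\ forall a, (0 < wt a)%N,
      forall a b, wspan Z (fun s => wsum wt s < wt a + wt b)%N (Z a * Z b - Z b * Z a) &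
      forall w, exists D, wspan Z (fun s => wsum wt s < D)%N w].
Proof.
move=> HW p_sorted two; have Hrel := HW.1.
pose gen := loop_gen n p d e f.
have Hz := loop_gen_zcomb Hrel p_sorted two.
have [wt [wt0 Hwt]] := commuting_weights Hz (pbw_comm Hrel p_sorted two).
exists (@pbw_gen k n p W d e f), wt; split => // w.
have [D HD] : exists D, wfil gen D w.
  move: w; apply: (W_induction HW).
  - by exists 1; apply: wfil1.
  - move=> c x y [D HD] [E HE]; exists (D + E)%N.
    apply: wfilD; first by apply: wfilZ; apply: wfil_le HD; apply: leq_addr.
    by apply: wfil_le HE; apply: leq_addl.
  - move=> x y [D HD] [E HE]; exists (D + E).+1.
    by apply: wfilM; apply: wfilS.
  - by move=> i [//|r] Hi _; exists r.+1; apply: wfil_gen; apply: Or31; exists i.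
  - by move=> i [//|r] Hi Hr; exists r.+1; apply: wfil_gen; apply: Or32; exists i.
  - by move=> i [//|r] Hi _; exists r.+1; apply: wfil_gen; apply: Or33; exists i.
have [l [_ ->]] := wfil_wspan Hz HD.
exists (\max_(t <- l) wsum wt t.2).+1, l; split => //.
by apply/allP => t Ht; rewrite ltnS (big_rem t) //= leq_maxl.
Qed.

(** * Lower bound for the growth of the image *)


(** The coefficients of the product of the 1 - a t are those of the monic polynomial with roots a.
    At a root this is an integral equation over Gamma. *)
Lemma lin_prod_root (L : fieldType) (s : seq L) (y : L) :
  (forall j, (size s < j)%N -> ser (\prod_(a <- s) lin a) j = 0) /\
  \sum_(j < (size s).+1) ser (\prod_(a <- s) lin a) j * y ^+ (size s - j) = \prod_(a <- s) (y - a).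
Proof.
elim: s => [|a s [IH0 IH]].
  by rewrite !big_nil; split=> [[|j] //|]; rewrite big_ord1 /= mulr1.
have linS (f : series L) j : ser (lin a * f) j.+1 = ser f j.+1 - a * ser f j.
  by rewrite /lin mulrBl mul1r serB -mulrA serCM serXM.
have lin00 (f : series L) : ser (lin a * f) 0 = ser f 0 by rewrite serM0 lin0 mul1r.
split=> [[//|j] /= Hj|].
  by rewrite big_cons linS !IH0 ?mulr0 ?subr0 //; lia.
rewrite !big_cons -IH [size _]/= [RHS]mulrBl.
set f := \prod_(b <- s) lin b in IH0 *; set m := size s in IH0 *.
rewrite [LHS]big_ord_recl lin00 subn0.
under eq_bigr => j _ do rewrite linS mulrBl.
rewrite sumrB [X in _ + (X - _)]big_ord_recr /= (IH0 _ (ltnSn m)) mul0r addr0 addrA; congr (_ - _).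
  rewrite mulr_sumr [RHS]big_ord_recl /= subn0 exprS mulrCA; congr (_ + _).
  apply: eq_bigr => j _; rewrite mulrCA -exprS; congr (_ * _ ^+ _).
  by rewrite /bump; have := ltn_ord j; lia.
rewrite mulr_sumr; apply: eq_bigr => j _; rewrite mulrA; congr (_ * _ ^+ _).
Qed.

Lemma uniform_bound (T : finType) (Q : nat -> T -> Prop) :
  (forall d e t, (d <= e)%N -> Q d t -> Q e t) -> (forall t, exists d, Q d t) ->
  exists d, forall t, Q d t.
Proof.
move=> Qmono /fin_all_exists [f Hf]; exists (\max_t f t)%N => t.
by apply: Qmono (Hf t); apply: leq_bigmax.
Qed.

Section LowerBound.
Variables (k L : fieldType) (M : zmodType) (D : skew_data k L M).
Variables (V : finType) (row : V -> nat) (z : V -> L) (mu : V -> M).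
Local Notation SK := (skew_alg D).
Local Notation iota := (fun a : L => sk a 0 : SK).
Hypothesis HG : gt_data D z mu.
Variable n : nat.
Hypothesis row_lt : forall v, (row v < n)%N.
Local Notation y v := (z v + (row v)%:R).
Local Notation V' := {v : V | (row v < n.-1)%N}.
Hypothesis mu_indep : forall E, injective (fun m : {ffun V' -> 'I_E} => \sum_v mu (val v) *+ m v).
Hypothesis y_indep : forall E (c : {ffun V -> 'I_E} -> k),
  \sum_al cst D (c al) * \prod_v y v ^+ al v = 0 -> forall al, c al = 0.
Variables (W : algType k) (phi : W -> SK) (fil : nat -> W -> Prop).
Hypothesis phiM : forall u w, phi (u * w) = phi u * phi w.
Hypothesis phi1 : phi 1 = 1.
Hypothesis fil1 : fil 1 1.
Hypothesis fil_le : forall a b w, (a <= b)%N -> fil a w -> fil b w.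
Hypothesis filM : forall a b u w, fil a.+1 u -> fil b.+1 w -> fil (a + b).+1 (u * w).
Hypothesis fil_ex : forall w, exists a, fil a w.
Hypothesis phi_Q : forall r j, (r < n)%N -> exists w, phi w = iota (ser (gt_Q row z r r) j).
Hypothesis phi_E : forall i a, (i.+1 < n)%N -> exists w, phi w = gt_E D row z mu i a.

Let img (d : nat) (b : SK) : Prop := exists w, fil d w /\ phi w = b.
Local Notation N := #|V|.

(** Only finitely many elements enter the construction, so one filtration degree contains preimages
    of all of them. *)
Lemma image_bound : exists c,
  (forall r j, (r < n)%N -> (j <= N)%N -> img c.+1 (iota (ser (gt_Q row z r r) j))) /\
  (forall i a, (i.+1 < n)%N -> (a <= N)%N -> img c.+1 (gt_E D row z mu i a)).
Proof.
have mono (d e : nat) b : (d <= e)%N -> img d b -> img e b.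
  by move=> Hd [w [Hw <-]]; exists w; split => //; apply: fil_le Hw.
have [c1 H1] : exists d, forall t : 'I_n * 'I_N.+1, img d (iota (ser (gt_Q row z t.1 t.1) t.2)).
  apply: uniform_bound => [d e t|t]; first exact: mono.
  by have [w Hw] := phi_Q t.2 (ltn_ord t.1); have [d Hd] := fil_ex w; exists d, w.
have [c2 H2] : exists d, forall t : 'I_n.-1 * 'I_N.+1, img d (gt_E D row z mu t.1 t.2).
  apply: uniform_bound => [d e t|t]; first exact: mono.
  have [|w Hw] := @phi_E t.1 t.2; first by have := ltn_ord t.1; lia.
  by have [d Hd] := fil_ex w; exists d, w.
exists (c1 + c2)%N; split=> [r j Hr|i a Hi]; rewrite -ltnS => Hj.
  by apply: mono (H1 (Ordinal Hr, Ordinal Hj)); lia.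
have Hi' : (i < n.-1)%N by lia.
by apply: mono (H2 (Ordinal Hi', Ordinal Hj)); lia.
Qed.

Section Bounded.
Variable c : nat.
Hypothesis img_Q : forall r j, (r < n)%N -> (j <= N)%N -> img c.+1 (iota (ser (gt_Q row z r r) j)).
Hypothesis img_E : forall i a, (i.+1 < n)%N -> (a <= N)%N -> img c.+1 (gt_E D row z mu i a).

Lemma imgM a b u w : img a.+1 u -> img b.+1 w -> img (a + b).+1 (u * w).
Proof.
move=> [u' [Hu <-]] [w' [Hw <-]]; exists (u' * w'); split; first exact: filM.
exact: phiM.
Qed.
Lemma img_le a b u : (a <= b)%N -> img a u -> img b u.
Proof. by move=> Hab [w [Hw <-]]; exists w; split => //; apply: fil_le Hw. Qed.

Let sk_mul m (a : L) : (sk 1 m : SK) * iota a = iota (act D m a) * sk 1 m.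
Proof. by rewrite !skM act0 mul1r mulr1 addr0 add0r. Qed.

Let iM : forall a b, iota (a * b) = iota a * iota b.
Proof. by move=> a b; apply: iotaM. Qed.

Lemma lspan_translation v : (row v < n.-1)%N -> lspan iota (img c.+1) (sk 1 (mu v)).
Proof. by move=> Hv; apply: (lspan_mu HG) => a Ha; apply: img_E; lia. Qed.

Lemma lspan_box E (m : {ffun V' -> 'I_E}) :
  lspan iota (img (c * (#|{: V'}| * E)).+1) (sk 1 (\sum_v mu (val v) *+ m v)).
Proof.
pose S a (x : M) := lspan iota (img (a : nat).+1) (sk 1 x : SK).
have S0 : S 0 0.
  rewrite /S -[sk 1 0]mul1r -sk1; apply: lspan_in; exists 1.
  by rewrite phi1.
have SD a b x x' : S a x -> S b x' -> S (a + b)%N (x + x').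
  rewrite /S => Hx Hx'; have -> : sk 1 (x + x') = sk 1 x * sk 1 x' :> SK by rewrite skM rmorph1 mulr1.
  apply: (@lspan_mulT _ _ iota iM _ _ _ _ _ _ _ (sk_mul x) Hx Hx'); exact: imgM.
have Sm v e : S (c * e)%N (mu (val (v : V')) *+ e).
  elim: e => [|e IH]; first by rewrite muln0.
  by rewrite mulnS mulrS; apply: SD => //; apply: lspan_translation; apply: (valP v).
have : S (\sum_v c * m v)%N (\sum_v mu (val v) *+ m v).
  by elim/big_rec2: _ => // v a x _ IH; apply: SD.
apply: lspan_sub => u; apply: img_le; rewrite ltnS -big_distrr /= leq_mul2l.
apply/orP; right; apply: (leq_trans (n := \sum_(v : V') E)).
  by apply: leq_sum => v _; apply/ltnW/ltn_ord.
by rewrite sum_nat_const.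
Qed.

(** While some exponent is at least N, the integral equation of y_v lowers it. Each step costs at
    most c in filtration degree and gains at least 1 in total exponent, so the bound by b is
    preserved and the exponents end below N. *)
Lemma integral_span (S : SK -> Prop) b :
  (forall u w, S u -> S w -> S (u + w)) -> (forall u, S u -> S (- u)) -> S 0 ->
  (forall (be : {ffun V -> nat}) w, (forall v, be v < N)%N -> img b.+1 w ->
     S (iota (\prod_v y v ^+ be v) * w)) ->
  forall (al : {ffun V -> nat}) a w, img a.+1 w -> (a + c * \sum_v al v <= b)%N ->
     S (iota (\prod_v y v ^+ al v) * w).
Proof.
move=> SD SN S0 Sbase al; move: {2}(\sum_v al v)%N (leqnn (\sum_v al v)%N) => t.
elim: t al => [|t IH] al Ht a w Hw Hb.
  apply: Sbase => [v|]; last by apply: img_le Hw; lia.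
  move: Ht; rewrite leqn0 sum_nat_eq0 => /forallP /(_ v) /= /eqP ->.
  by apply/card_gt0P; exists v.
have [Hall|] := boolP [forall v, (al v < N)%N].
  by apply: Sbase => [v|]; [apply: (forallP Hall) | apply: img_le Hw; lia].
rewrite negb_forall => /existsP [v]; rewrite -leqNgt => Hv.
set P := [pred w' | row w' == row v].
have HP : (#|P| <= N)%N by apply: max_card.
pose s := [seq z w' + (row v)%:R | w' <- enum P].
have ss : size s = #|P| by rewrite size_map cardE.
have Qs : gt_Q row z (row v) (row v) = \prod_(a <- s) lin a by rewrite big_map big_enum; apply: eq_bigl => u.
have := (lin_prod_root s (y v)).2; rewrite ss -Qs.
rewrite [RHS](_ : _ = 0); last first.
  by rewrite big_map big_enum (bigD1 v) ?inE //= subrr mul0r.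
rewrite big_ord_recl /= subn0.
have -> : ser (gt_Q row z (row v) (row v)) 0 = 1.
  by rewrite /gt_Q ser_prod0 => [|u]; rewrite ?lin0.
rewrite mul1r => /eqP; rewrite addr_eq0 => /eqP Hroot.
pose al' (j : nat) : {ffun V -> nat} := [ffun u => if u == v then al v - j else al u]%N.
have Hal' j : (j <= al v)%N -> (\sum_u al' j u + j = \sum_u al u)%N.
  move=> Hj; rewrite (bigD1 v) //= [in RHS](bigD1 v) //= ffunE eqxx.
  rewrite (eq_bigr al); last by move=> u /negbTE nu; rewrite ffunE nu.
  by rewrite addnAC subnK.
(* The equation has degree |P| <= N <= al v, so it can be applied inside the power of y_v. *)
have -> : \prod_u y u ^+ al u = - \sum_(j < #|P|) (\prod_u y u ^+ al' j.+1 u) * ser (gt_Q row z (row v) (row v)) j.+1.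
  rewrite (bigD1 v) //= -(subnK (leq_trans HP Hv)) exprD Hroot mulrN mulNr; congr (- _).
  rewrite mulr_sumr mulr_suml; apply: eq_bigr => j _.
  rewrite [in RHS](bigD1 v) //= ffunE eqxx.
  rewrite [in RHS](eq_bigr (fun u => y u ^+ al u)); last by move=> u /negbTE nu; rewrite ffunE nu.
  have -> : (al v - j.+1 = (al v - #|P|) + (#|P| - j.+1))%N by have := ltn_ord j; lia.
  by rewrite exprD; ring.
rewrite iotaN mulNr; apply: SN; rewrite iota_sum mulr_suml.
apply: (big_ind S) => // j _; rewrite iotaM -mulrA.
have Hj := ltn_ord j; have := Hal' j.+1; rewrite (leq_trans Hj (leq_trans HP Hv)) => /(_ isT) Hs.
apply: (IH (al' j.+1) _ (c + a)%N); first lia.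
  by apply: imgM => //; apply: img_Q; [apply: row_lt | lia].
by move: Hb; rewrite -Hs mulnDr mulnS; lia.
Qed.
End Bounded.

Lemma indep_span_le_fin (T T' : finType) (u : T -> SK) (b : T' -> SK) :
  (forall t, exists c : T' -> k, u t = \sum_j c j *: b j) ->
  (forall c : T -> k, \sum_t c t *: u t = 0 -> forall t, c t = 0) -> (#|T| <= #|T'|)%N.
Proof.
move=> Hs Hi; apply: (@indep_span_le _ _ _ _ (fun i => u (enum_val i)) (fun j => b (enum_val j))).
  move=> i; have [c ->] := Hs (enum_val i); exists (fun j => c (enum_val j)).
  by rewrite (reindex _ (onW_bij _ (enum_val_bij _))).
move=> c Hc i; rewrite -[i]enum_valK; apply: (Hi (fun t => c (enum_rank t))).
rewrite -[RHS]Hc (reindex _ (onW_bij _ (enum_val_bij _))).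
by apply: eq_bigr => j _; rewrite enum_valK.
Qed.

(** The translations of a box are only L-combinations of image elements. Linear algebra over L
    exchanges them for as many elements of the image itself, still L-independent. *)
Lemma translation_family c E :
  (forall i a, (i.+1 < n)%N -> (a <= N)%N -> img c.+1 (gt_E D row z mu i a)) ->
  exists u : {ffun V' -> 'I_E} -> SK, (forall m, img (c * (#|{: V'}| * E)).+1 (u m)) /\
    forall a : {ffun V' -> 'I_E} -> L, \sum_m iota (a m) * u m = 0 -> forall m, a m = 0.
Proof.
move=> img_E; pose T := {ffun V' -> 'I_E}.
pose Tm (m : T) := \sum_v mu (val v) *+ m v.
have [g Hg] := fin_all_exists (lspan_box img_E (E := E)).
pose s := flatten [seq g m | m <- enum {: T}].
pose rw (x : SK) := \row_(j < #|{: T}|) skc x (Tm (enum_val j)).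
(* Rows are the image elements used in the spans, columns the translations of the box. The rows span
   all unit vectors, so a square invertible set of rows can be selected. *)
pose A := \matrix_(i < size s) rw (nth (0, 0) s i).2.
have Afull : row_full A.
  rewrite -sub1mx; apply/row_subP => i.
  have -> : matrix.row i 1%:M = rw (sk 1 (Tm (enum_val i))).
    apply/rowP => j; rewrite !mxE skc_sk (inj_eq (@mu_indep E)) (inj_eq enum_val_inj).
    by case: eqP.
  rewrite (Hg (enum_val i)).2.
  have -> : rw (\sum_(t <- g (enum_val i)) iota t.1 * t.2) = \sum_(t <- g (enum_val i)) t.1 *: rw t.2.
    apply/rowP => j; rewrite mxE skc_sum summxE; apply: eq_bigr => t _.
    by rewrite !mxE skc_mulL.
  rewrite big_seq; apply: (big_ind (fun x => (x <= A)%MS)) => [|x y|t Ht].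
  - exact: sub0mx.
  - exact: addmx_sub.
  apply: scalemx_sub.
  have Hs : t \in s by apply/flatten_mapP; exists (enum_val i); rewrite ?mem_enum.
  have Hi : (index t s < size s)%N by rewrite index_mem.
  by have := row_sub (Ordinal Hi) A; rewrite rowK /= nth_index.
pose f := fullrankfun Afull.
pose u (m : T) := (nth (0, 0) s (f (enum_rank m))).2.
exists u; split=> [m|a Ha m].
  have : nth (0, 0) s (f (enum_rank m)) \in s by apply: mem_nth.
  by case/flatten_mapP => m' _; apply: (Hg m').1.
pose r := \row_(i < #|{: T}|) a (enum_val i).
have r0 : r *m rowsub f A = 0.
  apply/rowP => j; rewrite !mxE.
  have := congr1 (fun x => skc x (Tm (enum_val j))) Ha; rewrite skc0 skc_sum => H0; rewrite -[RHS]H0.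
  rewrite [RHS](reindex _ (onW_bij _ (enum_val_bij _))) /=. apply: eq_bigr => i _.
  by rewrite !mxE skc_mulL /u enum_valK.
have /row_free_inj rinj : row_free (rowsub f A) by exact: fullrowsub_free.
have /rowP /(_ (enum_rank m)) : r = 0 by apply: rinj; rewrite r0 mul0mx.
by rewrite !mxE enum_rankK.
Qed.

(** The E^(N+r) products of a monomial in the y_v with an element of the translation family are
    independent over k. By integrality they lie in the span of products of the x_j with monomials of
    exponents below N, so E^(N+r) <= N^N m, while b is linear in E. *)
Theorem growth_lower_bound C : (0 < N)%N -> exists b, forall m (x : 'I_m -> SK),
  (forall w, fil b.+1 w -> exists c : 'I_m -> k, phi w = \sum_j c j *: x j) ->
  (C * b.+1 ^ (N + #|{: V'}|).-1 < m)%N.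
Proof.
move=> N0; have [c [img_Q img_E]] := image_bound.
set r := #|{: V'}|; pose c' := (c * (N + r)).+1.
(* b pays c r E for the translations and c N E for lowering exponents. As b + 1 <= c' E, a bound m
   <= C (b+1)^(N+r-1) would force E <= N^N C c'^(N+r-1), which the choice of E excludes. *)
pose E := (N ^ N * C * c' ^ (N + r).-1).+1; pose b := (c * (N + r) * E)%N.
exists b => m x Hx.
have [u [Hu u_indep]] := translation_family E img_E.
pose T := ({ffun V -> 'I_E} * {ffun V' -> 'I_E})%type.
pose T' := ({ffun V -> 'I_N} * 'I_m)%type.
pose F (t : T) : SK := iota (\prod_v y v ^+ t.1 v) * u t.2.
pose G (t : T') : SK := iota (\prod_v y v ^+ t.1 v) * x t.2.
have le : (#|{: T}| <= #|{: T'}|)%N.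
  apply: (indep_span_le_fin (u := F) (b := G)) => [[al i]|a Ha [al i]].
    pose al' : {ffun V -> nat} := [ffun v => nat_of_ord (al v)].
    have -> : F (al, i) = iota (\prod_v y v ^+ al' v) * u i.
      by congr (sk _ 0 * _); apply: eq_bigr => v _; rewrite ffunE.
    apply: (@integral_span c img_Q (fun w => exists a : T' -> k, w = \sum_j a j *: G j) b
      _ _ _ _ _ (c * (r * E))%N) => //.
    - move=> w w' [a ->] [a' ->]; exists (fun j => a j + a' j).
      by rewrite -big_split /=; apply: eq_bigr => j _; rewrite scalerDl.
    - move=> w [a ->]; exists (fun j => - a j).
      by rewrite -sumrN; apply: eq_bigr => j _; rewrite scaleNr.
    - by exists (fun=> 0); rewrite big1 // => j _; rewrite scale0r.
    - move=> be w Hbe [w' [Hw' <-]]; have [a ->] := Hx w' Hw'.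
      pose be' : {ffun V -> 'I_N} := [ffun v => Ordinal (Hbe v)].
      exists (fun j => (j.1 == be')%:R * a j.2).
      rewrite mulr_sumr -(pair_big predT predT (fun i j => ((i == be')%:R * a j) *: G (i, j))) /=.
      rewrite (bigD1 be') //= [X in _ + X]big1 ?addr0; last first.
        by move=> i' /negbTE ->; rewrite big1 // => j _; rewrite mul0r scale0r.
      apply: eq_bigr => j _; rewrite eqxx mul1r -scalerAr /G /=; congr (_ *: (sk _ 0 * _)).
      by apply: eq_bigr => v _; rewrite ffunE.
    rewrite /b -/r; have : (\sum_v al' v <= N * E)%N.
      rewrite -sum_nat_const; apply: leq_sum => v _.
      by rewrite ffunE; apply/ltnW/ltn_ord.
    by rewrite -mulnA mulnDl mulnDr addnC => H; rewrite leq_add2r leq_mul2l H orbT.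
  apply: (y_indep (c := fun al => a (al, i))).
  apply: (u_indep (fun i => \sum_al cst D (a (al, i)) * \prod_v y v ^+ al v)).
  have Ep : \sum_t a t *: F t = \sum_al \sum_i a (al, i) *: F (al, i).
    by rewrite pair_bigA; apply: eq_bigr => -[].
  rewrite -[RHS]Ha Ep exchange_big /=.
  apply: eq_bigr => j _; rewrite iota_sum mulr_suml; apply: eq_bigr => be _.
  by rewrite iotaM skZ mulrA.
move: le; rewrite !card_prod !card_ffun !card_ord -expnD -/r => le.
rewrite ltnNge; apply/negP => Hm.
have Hb : (b.+1 <= c' * E)%N by rewrite /b /c' mulSn; lia.
have : (E ^ (N + r) <= N ^ N * C * c' ^ (N + r).-1 * E ^ (N + r).-1)%N.
  apply: leq_trans le _; rewrite -!mulnA leq_mul2l; apply/orP; right.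
  apply: leq_trans Hm _; rewrite leq_mul2l; apply/orP; right.
  rewrite -expnMn; case: (N + r).-1 => // e; rewrite leq_exp2r //.
rewrite -{1}(prednK (_ : 0 < N + r)%N); last by rewrite addn_gt0 N0.
by rewrite expnS leq_mul2r expn_eq0 /= ltnn.
Qed.
End LowerBound.

(** * The homomorphism *)


Section AlgHom.
Variables (k : fieldType) (A B : algType k) (h : A -> B).
Hypothesis Hh : is_alg_hom h.

Lemma alg_homD x y : h (x + y) = h x + h y.
Proof. by case: Hh => H _ _; rewrite -[x]scale1r H !scale1r. Qed.
Lemma alg_hom0 : h 0 = 0.
Proof. by apply: (addrI (h 0)); rewrite -alg_homD !addr0. Qed.
Lemma alg_homZ c x : h (c *: x) = c *: h x.
Proof. by case: Hh => H _ _; rewrite -[c *: x]addr0 H alg_hom0 addr0. Qed.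
Lemma alg_homN x : h (- x) = - h x.
Proof. by rewrite -scaleN1r alg_homZ scaleN1r. Qed.
Lemma alg_homB x y : h (x - y) = h x - h y.
Proof. by rewrite alg_homD alg_homN. Qed.
Lemma alg_hom_sum (T : Type) (r : seq T) (P : pred T) (F : T -> A) :
  h (\sum_(i <- r | P i) F i) = \sum_(i <- r | P i) h (F i).
Proof. exact: (big_morph h alg_homD alg_hom0). Qed.
Lemma alg_homM x y : h (x * y) = h x * h y.
Proof. by case: Hh. Qed.
Lemma alg_hom1 : h 1 = 1.
Proof. by case: Hh. Qed.
Lemma alg_hom_nat m : h m%:R = m%:R.
Proof. by elim: m => [|m IH]; rewrite ?alg_hom0 // !mulrS alg_homD alg_hom1 IH. Qed.
End AlgHom.

Section AcoefMorphism.
Variables (k : fieldType) (n : nat) (p : nat -> nat) (A B : algType k) (h : A -> B).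
Hypothesis Hh : is_alg_hom h.
Variables (d : nat -> nat -> A) (d' : nat -> nat -> B).
Hypothesis hd : forall i r, (i < n)%N -> (0 < r)%N -> h (d i r) = d' i r.

Lemma acoef_morph r j : (r < n)%N -> h (acoef p d r j) = acoef p d' r j.
Proof.
move=> Hr; rewrite /acoef.
have hX (x : A) m : h (x ^+ m) = h x ^+ m.
  by elim: m => [|m IH]; rewrite ?(alg_hom1 Hh) // !exprS (alg_homM Hh) IH.
have hpmul (f g : nat -> A) (f' g' : nat -> B) : (h \o f) =1 f' -> (h \o g) =1 g' ->
    (h \o pmul f g) =1 pmul f' g'.
  move=> Hf Hg l; rewrite /= /pmul (alg_hom_sum Hh); apply: eq_bigr => i _.
  by rewrite (alg_homM Hh) -Hf -Hg.
have: all (fun i => i < n)%N (iota 0 r.+1).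
  by apply/allP => i; rewrite mem_iota; lia.
move: (iota 0 r.+1) j; elim=> [|i s IH] /= j.
  by rewrite (alg_hom_nat Hh).
move=> /andP [Hi Hs]; apply: (hpmul _ _ _ _ _ (fun l => IH l Hs)).
apply: hpmul => l /=; first by rewrite (alg_homM Hh) (alg_hom_nat Hh) hX (alg_homN Hh) (alg_hom_nat Hh).
rewrite /dshift; case: eqP => _; first by rewrite (alg_hom1 Hh).
rewrite (alg_hom_sum Hh); apply: eq_bigr => t _.
by rewrite (alg_homM Hh) (alg_hom_nat Hh) hd.
Qed.
End AcoefMorphism.

Section Phi.
Variables (k : fieldType) (n : nat) (p : nat -> nat).
Hypothesis char0 : [pchar k] =i pred0.
Hypothesis p_pos : forall i, (i < n)%N -> (0 < p i)%N.
Hypothesis p_sorted : forall i, (i.+1 < n)%N -> (p i <= p i.+1)%N.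
Variables (W : algType k) (d e f : nat -> nat -> W).
Hypothesis HW : is_W_pi n p d e f.

Local Notation D := (LM_data k n p).
Local Notation SK := (skew_alg D).
Local Notation row := (@rowv n p).
Local Notation z := (@zL k n p).
Local Notation mu := (@muL n p).

Definition gt_hom (Phi : W -> SK) : Prop :=
  [/\ is_alg_hom Phi,
      forall i r, (i < n)%N -> (0 < r)%N -> Phi (d i r) = gt_d D row z i r,
      forall i r, (i.+1 < n)%N -> (yshift p i < r)%N -> Phi (e i r) = gt_e D row z mu p i r &
      forall i r, (i.+1 < n)%N -> (0 < r)%N -> Phi (f i r) = gt_f D row z mu i r].

Lemma gt_hom_ex : exists Phi, gt_hom Phi.
Proof.
have Hrel := gt_relations (gtL n p char0) p_sorted (@card_rowv n p).
by have [Phi [HPhi _]] := HW.2 _ _ _ _ Hrel; exists Phi.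
Qed.

Variable Phi : W -> SK.
Hypothesis HPhi : gt_hom Phi.
Let Hh : is_alg_hom Phi. Proof. by case: HPhi. Qed.

Lemma gt_hom_acoef r j : (r < n)%N -> Phi (acoef p d r j) = sk (ser (gt_Q row z r r) j) 0.
Proof.
move=> Hr; case: HPhi => _ Hd _ _; rewrite (acoef_morph p Hh Hd j Hr).
exact: (acoef_gt D z (@card_rowv n p) j Hr).
Qed.
Lemma gt_hom_E i a : (i.+1 < n)%N -> Phi (e i (a + 1 + yshift p i)) = gt_E D row z mu i a.
Proof.
move=> Hi; case: HPhi => _ _ He _.
have Hr : (yshift p i < a + 1 + yshift p i)%N by lia.
rewrite (He i _ Hi Hr) /gt_e.
by have -> : (a + 1 + yshift p i - 1 - yshift p i = a)%N by lia.
Qed.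
Lemma gt_hom_F i a : (i.+1 < n)%N -> Phi (f i a.+1) = gt_F D row z mu i a.
Proof. by move=> Hi; case: HPhi => _ _ _ Hf; rewrite (Hf i a.+1 Hi isT) /gt_f subn1. Qed.

Lemma char0_neq0 m : (m.+1%:R : k) != 0.
Proof.
apply/eqP => Hm.
have [//|q] := natf0_pchar _ (introT eqP Hm).
by rewrite char0.
Qed.

Lemma muL_indep E (Q : pred (Var n p)) :
  injective (fun m : {ffun {v : Var n p | Q v} -> 'I_E} => \sum_v mu (val v) *+ m v).
Proof.
move=> m m' /ffunP H; apply/ffunP => v; apply: val_inj.
have HE (m0 : {ffun {v : Var n p | Q v} -> 'I_E}) : (\sum_v mu (val v) *+ m0 v) (val v) = - (m0 v)%:R.
  rewrite sum_ffunE (bigD1 v) //= big1 ?addr0 => [|u nu].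
    by rewrite ffunMnE ffunE eqxx mulNrn.
  by rewrite ffunMnE ffunE (inj_eq val_inj) eq_sym (negbTE nu) oppr0 mul0rn.
by have := H (val v); rewrite !HE => /oppr_inj; rewrite !natz => -[].
Qed.

Theorem gt_hom_injective w : Phi w = 0 -> w = 0.
Proof.
(* For n = 0 there are no variables and the growth bound, which asks for N > 0, does not apply; the
   algebra then consists of scalars. *)
have [n0|n0] := posnP n.
  have [c ->] : exists c : k, w = c *: 1.
    move: w; apply: (W_induction HW).
    - by exists 1; rewrite scale1r.
    - by move=> c x y [a ->] [b ->]; exists (c * a + b); rewrite scalerDl scalerA.
    - by move=> x y [a ->] [b ->]; exists (a * b); rewrite -scalerAl mul1r scalerA.
    - by move=> i r; rewrite n0.
    - by move=> i r; rewrite n0.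
    - by move=> i r; rewrite n0.
  rewrite (alg_homZ Hh) (alg_hom1 Hh) => /(congr1 (fun x => skc x 0)).
  rewrite skcZ -sk1 skc_sk skc0 eqxx mulr1 => /eqP; rewrite fmorph_eq0 => /eqP ->.
  exact: scale0r.
have two : (2%:R : k) != 0 by exact: char0_neq0.
have [Z [wt [wt0 Hcomm Hspan]]] := W_pbw HW p_sorted two.
apply: (growth_injective wt0 Hcomm Hspan) => [c x y|x w'|C].
- by rewrite (alg_homD Hh) (alg_homZ Hh).
- by move=> H; rewrite (alg_homM Hh) H mulr0.
rewrite card_sum.
apply: (growth_lower_bound (gtL n p char0) _ _ (@monomials_indep k n p) (alg_homM Hh) (alg_hom1 Hh)
  (fil := fun D w => wspan Z (fun s => wsum wt s < D)%N w)).
- by move=> v; apply: ltn_ord.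
- by move=> E; apply: muL_indep.
- by rewrite -(wprod_nil Z); apply: fspan_in; rewrite wsumE.
- by move=> a b w'; move=> Hab; apply: fspan_sub => s; lia.
- by move=> a b u w' Hu Hw; apply: wspanM Hu Hw => s t; rewrite wsumE; lia.
- exact: Hspan.
- by move=> r j Hr; exists (acoef p d r j); apply: gt_hom_acoef.
- by move=> i a Hi; exists (e i (a + 1 + yshift p i)); apply: gt_hom_E.
- by have [|||v _] := @Var_ex n p 0 0 0; rewrite ?p_pos //; apply/card_gt0P; exists v.
Qed.
End Phi.

(** * Galois invariants *)


Section SkewLists.
Variables (k : fieldType) (n : nat) (p : nat -> nat).
Local Notation L := (Lfld k n p).
Local Notation Mt := (Mt n p).
Local Notation SA := (SA k n p).
Local Notation D := (LM_data k n p).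
Local Notation SK := (skew_alg D).
Local Notation actG := (@Defs.actG k n p).
Implicit Types (x y : SA) (X Y : SK) (s : {perm Var n p}) (m : Mt).

(** Interprets formal sums in the ring [skew_alg], where equality of coefficient functions becomes
    equality and the list operations become the ring operations. *)
Definition of_SA x : SK := \sum_(a <- x) sk a.1 a.2.
Definition to_SA X : SA := [seq (skc X m, m) | m <- skc_supp X].

Lemma skc_of_SA x m : skc (of_SA x) m = coef x m.
Proof.
rewrite /of_SA /coef skc_sum [RHS]big_mkcond; apply: eq_bigr => a _.
by rewrite skc_sk.
Qed.
Lemma to_SAK X : of_SA (to_SA X) = X.
Proof. by rewrite [RHS]skewE /of_SA big_map. Qed.
Lemma saeqP x y : saeq x y <-> of_SA x = of_SA y.
Proof.
split=> [H|H m]; last by rewrite -!skc_of_SA H.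
by apply: skewP => m; rewrite !skc_of_SA H.
Qed.
Lemma of_SA_cat x y : of_SA (x ++ y) = of_SA x + of_SA y.
Proof. exact: big_cat. Qed.
Lemma of_SA_mul x y : of_SA (samul x y) = of_SA x * of_SA y.
Proof.
rewrite /of_SA /samul big_allpairs_dep mulr_suml; apply: eq_bigr => a _.
by rewrite mulr_sumr; apply: eq_bigr => b _; rewrite skM.
Qed.
Lemma of_SA_scale c x : of_SA (sascale c x) = c *: of_SA x.
Proof.
rewrite /of_SA big_map scaler_sumr; apply: eq_bigr => a _.
by rewrite skZ skM act0 add0r.
Qed.
Lemma of_SA_cst a : of_SA (sacst a) = sk a 0.
Proof. by rewrite /of_SA big_seq1. Qed.
Lemma of_SA_flatten (T : Type) (l : seq T) (F : T -> SA) :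
  of_SA (flatten [seq F t | t <- l]) = \sum_(t <- l) of_SA (F t).
Proof.
elim: l => [|t l IH]; first by rewrite big_nil /of_SA big_nil.
by rewrite big_cons /= of_SA_cat IH.
Qed.
Lemma in_LMP x : in_LM x <-> supported (@in_M n p) (of_SA x).
Proof. by split=> H m; move: (H m); rewrite skc_of_SA. Qed.
Lemma in_M0 : in_M (0 : Mt).
Proof. by move=> v _; rewrite ffunE. Qed.
Lemma in_MD m m' : in_M m -> in_M m' -> in_M (m + m').
Proof. by move=> H H' v Hv; rewrite ffunE H // H' // addr0. Qed.

Lemma conjMK s : cancel (@conjM n p s) (@conjM n p s^-1%g).
Proof. by move=> m; apply/ffunP => v; rewrite !ffunE invgK permK. Qed.
Lemma conjMKV s : cancel (@conjM n p s^-1%g) (@conjM n p s).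
Proof. by move=> m; have := conjMK s^-1%g m; rewrite invgK. Qed.
Lemma conjMD s m m' : conjM s (m + m') = conjM s m + conjM s m'.
Proof. by apply/ffunP => v; rewrite !ffunE. Qed.
Lemma coef_saG s x m : coef (saG s x) m = actG s (coef x (conjM s^-1%g m)).
Proof.
rewrite /coef /saG big_map rmorph_sum /=; apply: eq_bigl => a.
by rewrite /= (can2_eq (conjMK s) (conjMKV s)).
Qed.

Definition skG s : SK -> SK := skmap (actG s : {rmorphism L -> L}) (conjM s).

Lemma skG_act s m (x : L) : actG s (act D m x) = act D (conjM s m) (actG s x).
Proof. exact: actG_actM. Qed.
Lemma skG_D s X Y : skG s (X + Y) = skG s X + skG s Y.
Proof. exact: (skmapD (conjMK s) (conjMKV s)). Qed.
Lemma skG_M s X Y : skG s (X * Y) = skG s X * skG s Y.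
Proof. exact: (skmapM (conjMK s) (conjMKV s) (conjMD s) (skG_act s)). Qed.
Lemma skG_Z s (c : k) X : skG s (c *: X) = c *: skG s X.
Proof. exact: (skmapZ (conjMK s) (conjMKV s) (conjMD s) (skG_act s) (@actG_cst k n p s)). Qed.
Lemma skG_iota s a : skG s (sk a 0) = sk (actG s a) 0.
Proof. exact: (skmap_iota (conjMK s) (conjMKV s) (conjMD s)). Qed.
Lemma skG_sum s (T : Type) (r : seq T) (P : pred T) (F : T -> SK) :
  skG s (\sum_(t <- r | P t) F t) = \sum_(t <- r | P t) skG s (F t).
Proof. exact: (skmap_sum (conjMK s) (conjMKV s)). Qed.
Lemma of_SA_G s x : of_SA (saG s x) = skG s (of_SA x).
Proof.
apply: skewP => m; rewrite (skc_map (conjMK s) (conjMKV s)) !skc_of_SA.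
exact: coef_saG.
Qed.
Lemma inv_GP x : inv_G x <-> forall s, inG s -> skG s (of_SA x) = of_SA x.
Proof. by split=> H s Hs; [rewrite -of_SA_G; apply/saeqP/H | apply/saeqP; rewrite of_SA_G H]. Qed.

Lemma actG_zL s v : inG s -> actG s (zL k v) = zL k (s v).
Proof.
move=> Hs; rewrite !zL_tofrac actG_tofrac rmorphN rmorphD /= permL_xv Hs.
by rewrite /permL substLC.
Qed.
Lemma conjM_muL s v : conjM s (muL v) = muL (s v).
Proof. by apply/ffunP => u; rewrite !ffunE -(can2_eq (permKV s) (permK s)). Qed.
Lemma in_M_muL v : (rowv v < n.-1)%N -> in_M (muL v : Mt) /\ in_M (- muL v : Mt).
Proof.
move=> Hv; have ne u : rowv u = n.-1 -> (u == v) = false.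
  by move=> Hu; apply/eqP => E; rewrite -E Hu ltnn in Hv.
by split=> u /ne E; rewrite !ffunE E !oppr0.
Qed.
(** The sign appears because [muL v] is minus the unit vector at v; the omitted coordinates are
    those of the last row, where m vanishes. *)
Lemma in_M_sum m : in_M m -> m = \sum_(v | (rowv v < n.-1)%N) muL v *~ (- m v).
Proof.
have ffz (f : Mt) (i : int) u : (f *~ i) u = f u *~ i.
  by case: i => i; rewrite ?NegzE ?mulrNz -!pmulrn ?[in LHS]ffunE ffunMnE.
move=> Hm; apply/ffunP => u; rewrite sum_ffunE.
have E v : (muL v *~ (- m v)) u = if v == u then m u else 0.
  rewrite ffz ffunE eq_sym; case: eqP => [->|_]; last by rewrite oppr0 mul0rz.
  by rewrite mulrNz mulNrz opprK; exact: intz.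
under eq_bigr => v _ do rewrite E.
rewrite big_mkcond (bigD1 u) //= eqxx big1 => [|v /negbTE ->]; last by case: ifP.
rewrite addr0; case: ifP => // /negbT Hu; apply: Hm.
by have := ltn_ord (sval u).1.1; move: Hu; rewrite /rowv; lia.
Qed.
End SkewLists.


Lemma coef_prod_linN (L : fieldType) (V : finType) (P : pred V) (x : V -> L) j :
  ser (\prod_(v | P v) lin (- x v)) j =
  \sum_(S : {set V} | (S \subset [set v | P v]) && (#|S| == j)) \prod_(v in S) x v.
Proof.
(* Extension by zero lets the product run over all of V, so that it expands over all subsets;
   subsets leaving P then contribute zero. *)
pose a v := if P v then x v else 0.
have -> : \prod_(v | P v) lin (- x v) = \prod_v (sC (a v) * st L + 1).
  rewrite big_mkcond; apply: eq_bigr => v _; rewrite /a; case: (P v).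
    have sCN : sC (- x v) = - sC (x v) by apply: serP => -[|i]; rewrite /= ?oppr0.
    by rewrite /lin sCN mulNr opprK addrC.
  have -> : sC (0 : L) = 0 by apply: serP => -[|i].
  by rewrite mul0r add0r.
rewrite bigA_distr /= ser_sum (bigID (fun S : {set V} => (S \subset [set v | P v]) && (#|S| == j))) /=.
have E (S : {set V}) : ser (\prod_i (if i \in S then sC (a i) * st L else 1)) j =
    if #|S| == j then \prod_(v in S) a v else 0.
  rewrite -big_mkcond big_split prodr_const.
  have -> : \prod_(i in S) sC (a i) = sC (\prod_(i in S) a i).
    by rewrite (big_morph (@sC L) (@sCM L) (@sC1 L)).
  rewrite serCM -[st L ^+ _]mulr1 serXnM ser1.
  have [lt|le] := ltnP j #|S|; first by rewrite mulr0 (gtn_eqF lt).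
  have -> : (j - #|S| == 0)%N = (#|S| == j) by lia.
  by case: (#|S| == j); rewrite ?mulr1 ?mulr0.
rewrite [X in _ + X]big1 ?addr0 => [|S].
  apply: eq_bigr => S /andP [/subsetP HS Hj]; rewrite E Hj; apply: eq_bigr => v /HS.
  by rewrite inE /a => ->.
rewrite negb_and E => H; case: eqP => // Hj; move: H; rewrite Hj eqxx orbF.
case/subsetPn => v vS; rewrite inE => Pv.
by rewrite (bigD1 v) //= /a (negbTE Pv) mul0r.
Qed.

Section Invariants.
Variables (k : fieldType) (n : nat) (p : nat -> nat).
Hypothesis char0 : [pchar k] =i pred0.
Local Notation R := {mpoly k[NV n p]}.
Local Notation L := (Lfld k n p).
Local Notation D := (LM_data k n p).
Local Notation SK := (skew_alg D).
Local Notation actG := (@Defs.actG k n p).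
Implicit Types (s t : {perm Var n p}).

Lemma gt_Q_esymr r j : ser (gt_Q (@rowv n p) (@zL k n p) r r) j = (esymr k n p r j)%:F.
Proof.
have -> : gt_Q (@rowv n p) (@zL k n p) r r = \prod_(v | rowv v == r) lin (- (xv k v)%:F).
  apply: eq_bigr => v /eqP <-; congr lin.
  by rewrite /zL opprD addrAC addNr add0r.
rewrite coef_prod_linN /esymr rmorph_sum /=; apply: eq_bigr => S _.
by rewrite rmorph_prod.
Qed.

Definition row_preserving s : bool := [forall v, rowv (s v) == rowv v].
Lemma row_preservingP s : reflect (inG s) (row_preserving s).
Proof. exact: eqfunP. Qed.
Lemma row_preservingM s t : inG t -> row_preserving (s * t)%g = row_preserving s.
Proof. by move=> Ht; apply: eq_forallb => v; rewrite permM Ht. Qed.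

Lemma inK_actG (a : L) s : inK a -> inG s -> actG s a = a.
Proof. by move=> [q [r [Hq Hr _ ->]]] Hs; rewrite fmorph_div /= !actG_tofrac Hq ?Hr. Qed.

(** Replacing the denominator by the product of its conjugates makes it invariant; the new numerator
    is a polynomial equal to a product of invariants. *)
Lemma actG_inK (a : L) : (forall s, inG s -> actG s a = a) -> inK a.
Proof.
move=> Ha; have [b [c [c0 Ea]]] := frac_ex a.
pose r := \prod_(s | row_preserving s) permL s c.
pose q := b * \prod_(s | row_preserving s && (s != 1%g)) permL s c.
have Hr t : inG t -> permL t r = r.
  move=> Ht; rewrite /r rmorph_prod [RHS](reindex_inj (mulIg t)) /=.
  by apply: eq_big => [s|s _]; [rewrite row_preservingM | exact: permL_comp].
have r0 : r != 0.
  apply/prodf_neq0 => s _; apply: contra_neq c0 => H.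
  by apply: (@permL_inj k n p s); rewrite H rmorph0.
have Eq : q%:F = a * r%:F.
  have -> : r = c * \prod_(s | row_preserving s && (s != 1%g)) permL s c.
    rewrite /r (bigD1 1%g) /= ?permL1 //.
    by apply/row_preservingP => v; rewrite perm1.
  by rewrite /q !rmorphM /= mulrA Ea divfK // tofrac_eq0.
exists q, r; split => //; last by rewrite Eq mulfK // tofrac_eq0.
move=> s Hs; apply/eqP; rewrite -tofrac_eq -actG_tofrac Eq rmorphM /= Ha //.
by rewrite actG_tofrac Hr.
Qed.

Lemma card_row_preserving : (#|row_preserving|%:R : L) != 0.
Proof.
have -> : (#|row_preserving|%:R : L) = cstL n p (#|row_preserving|%:R : k) by rewrite rmorph_nat.
rewrite fmorph_eq0; have : (0 < #|row_preserving|)%N.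
  by apply/card_gt0P; exists 1%g; apply/row_preservingP => v; rewrite perm1.
by case: #|_| => // m _; apply: char0_neq0.
Qed.

Local Notation avg := (average row_preserving (fun s (a : L) => actG s a)).

Lemma average_inK a : inK (avg a).
Proof.
apply: actG_inK => t Ht; rewrite /average rmorphM /= fmorphV rmorph_nat rmorph_sum /=; congr (_ * _).
rewrite [RHS](reindex_inj (mulIg t)) /=.
by apply: eq_big => [s|s _]; [rewrite row_preservingM | exact: actG_mul].
Qed.

Variables (T : Type) (l : seq T) (a : T -> L) (u : T -> SK) (X : SK).
Hypothesis Hu : forall i s, inG s -> skG s (u i) = u i.
Hypothesis HX : forall s, inG s -> skG s X = X.

Lemma invariant_left : X = \sum_(i <- l) sk (a i) 0 * u i -> X = \sum_(i <- l) sk (avg (a i)) 0 * u i.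
Proof.
apply: (@average_left _ _ _ D _ row_preserving (fun s => skG s)).
- by move=> s I r F; apply: skG_sum.
- exact: skG_M.
- exact: skG_iota.
- exact: card_row_preserving.
- by move=> i s /row_preservingP; apply: Hu.
- by move=> s /row_preservingP; apply: HX.
Qed.
Lemma invariant_right : X = \sum_(i <- l) u i * sk (a i) 0 -> X = \sum_(i <- l) u i * sk (avg (a i)) 0.
Proof.
apply: (@average_right _ _ _ D _ row_preserving (fun s => skG s)).
- by move=> s I r F; apply: skG_sum.
- exact: skG_M.
- exact: skG_iota.
- exact: card_row_preserving.
- by move=> i s /row_preservingP; apply: Hu.
- by move=> s /row_preservingP; apply: HX.
Qed.
End Invariants.

(** * Finite generation *)


Section FiniteGeneration.
Variables (k : fieldType) (n : nat) (p : nat -> nat) (W : algType k) (d e f : nat -> nat -> W).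
Hypothesis HW : is_W_pi n p d e f.

(** Large enough for the superscripts 1 and 2 that raise degrees, for all nonzero d_1^(r), and to
    dominate every shift. *)
Let R := (2 + p 0 + \sum_(i < n) yshift p i)%N.

Definition W_gens : seq W :=
  [seq d i r | i <- iota 0 n, r <- iota 1 R] ++
  [seq e i (yshift p i).+1 | i <- iota 0 n.-1] ++ [seq f i 1%N | i <- iota 0 n.-1].

(** Bracketing with d_i^(2) raises the superscript of e_i and f_i by one, up to products of known
    terms. Then the bracket of the lowest e_i with a suitable f_i gives d_{i+1}^(r), up to row i and
    lower superscripts in row i + 1. *)
Lemma W_finitely_generated (S : W -> Prop) :
  S 1 -> (forall (c : k) x y, S x -> S y -> S (c *: x + y)) -> (forall x y, S x -> S y -> S (x * y)) ->
  (forall g, g \in W_gens -> S g) -> forall w, S w.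
Proof.
move=> S1 Slin SM Sg.
have [[h1 [h2 [h3 [h4 [h5 [h6 [h7 [h8 [h9 [h10 [h11 [h12 h13]]]]]]]]]]]] _] := HW.
have SD x y : S x -> S y -> S (x + y) by move=> Hx Hy; rewrite -[x]scale1r; apply: Slin.
have S0 : S 0 by have := Slin (-1) 1 1 S1 S1; rewrite scaleN1r addNr.
have SN x : S x -> S (- x) by move=> Hx; rewrite -scaleN1r -[_ *: _]addr0; apply: Slin.
have SB x y : S x -> S y -> S (x - y) by move=> Hx Hy; apply: SD => //; apply: SN.
have Ssum (T : Type) (r : seq T) F : (forall t, S (F t)) -> S (\sum_(t <- r) F t).
  by move=> H; apply: (big_ind S).
have Sc x y : S x -> S y -> S (comm x y) by move=> Hx Hy; apply: SB; apply: SM.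
have gd i r : (i < n)%N -> (0 < r <= R)%N -> S (d i r).
  move=> Hi Hr; apply: Sg; rewrite mem_cat; apply/orP; left.
  by apply/allpairsP; exists (i, r); rewrite !mem_iota /=; split => //; lia.
have ge i : (i.+1 < n)%N -> S (e i (yshift p i).+1).
  move=> Hi; apply: Sg; rewrite !mem_cat; apply/orP; right; apply/orP; left.
  by apply/mapP; exists i; rewrite ?mem_iota //; lia.
have gf i : (i.+1 < n)%N -> S (f i 1%N).
  move=> Hi; apply: Sg; rewrite !mem_cat; apply/orP; right; apply/orP; right.
  by apply/mapP; exists i; rewrite ?mem_iota //; lia.
have R2 : (2 <= R)%N by rewrite /R; lia.
have Hsucc i : (i == i.+1) = false by lia.
have Se i r : (i.+1 < n)%N -> (yshift p i < r)%N -> S (e i r).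
  move=> Hi; elim: r => // r IH; rewrite ltnS leq_eqVlt => /orP [/eqP <-|Hr]; first exact: ge.
  have := h3 i i 2 r (ltnW Hi) Hi isT Hr.
  rewrite eqxx Hsucc subr0 mul1r !big_ord_recr big_ord0 /= add0r /Dc /= mul1r.
  rewrite (_ : (2 + r - 1 - 0 = r.+1)%N); last lia.
  rewrite (_ : (2 + r - 1 - 1 = r)%N); last lia.
  move=> H; rewrite -(addrK (d i 1 * e i r) (e i r.+1)) -H.
  by apply: SB; [apply: Sc | apply: SM]; try apply: IH => //; apply: gd => //; apply: ltnW.
have Sf i r : (i.+1 < n)%N -> (0 < r)%N -> S (f i r).
  move=> Hi; elim: r => // r IH _; case: (posnP r) => [->|Hr]; first exact: gf.
  have := h4 i i 2 r (ltnW Hi) Hi isT Hr.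
  rewrite eqxx Hsucc sub0r mulN1r !big_ord_recr big_ord0 /= add0r /Dc /= mulr1.
  rewrite (_ : (2 + r - 1 - 0 = r.+1)%N); last lia.
  rewrite (_ : (2 + r - 1 - 1 = r)%N); last lia.
  move=> H; have -> : f i r.+1 = - comm (d i 2) (f i r) - f i r * d i 1 by rewrite H opprK addrK.
  by apply: SB; [apply/SN/Sc | apply: SM]; try apply: IH => //; apply: gd => //; apply: ltnW.
have SDc i t : (forall r, (0 < r)%N -> S (d i r)) -> S (Dc d i t).
  by move=> H; rewrite /Dc; case: posnP => // /H.
have SDinv i t : (forall r, (0 < r)%N -> S (d i r)) -> S (Dinv d i t).
  move=> H; elim/ltn_ind: t => -[|t] IH; first by rewrite Dinv0.
  rewrite DinvS; apply: SN; apply: Ssum => s; apply: SM; first exact: H.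
  by apply: IH; lia.
have Sd i : (i < n)%N -> forall r, (0 < r)%N -> S (d i r).
  elim: i => [|i IH] Hi r Hr.
    have [Hp|Hp] := ltnP (p 0) r; first by rewrite h13.
    by apply: gd; rewrite // Hr /R; lia.
  have {}IH := IH (ltnW Hi).
  elim/ltn_ind: r Hr => r IHr Hr.
  have [HR|HR] := leqP r R; first by apply: gd; rewrite ?Hr.
  have sR : (yshift p i <= R)%N.
    by rewrite /R (bigD1 (Ordinal (ltnW Hi))) /=; lia.
  have := h2 i i (yshift p i).+1 (r - yshift p i)%N Hi Hi (ltnSn _).
  rewrite (_ : ((yshift p i).+1 + (r - yshift p i) = r.+1)%N); last lia.
  rewrite eqxx big_ord_recl Dinv0 mul1r (_ : (r.+1 - 1 - ord0 = r)%N); last by rewrite /=; lia.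
  rewrite {1}/Dc gtn_eqF //; set T := \sum_(j < r) _ => H.
  have -> : d i.+1 r = - comm (e i (yshift p i).+1) (f i (r - yshift p i)) - T.
    by rewrite H ?opprK ?addrK //; lia.
  apply: SB; first by apply/SN/Sc; [exact: ge | apply: Sf; lia].
  apply: Ssum => t; apply: SM; first exact: SDinv.
  rewrite /Dc; case: posnP => // H0; apply: IHr => //.
  by rewrite /= /bump; lia.
by apply: (W_induction HW) => // i r Hi; apply: Sd.
Qed.
End FiniteGeneration.

(** * The image of W(pi) *)


Section GTImage.
Variables (k : fieldType) (n : nat) (p : nat -> nat).
Hypothesis char0 : [pchar k] =i pred0.
Variables (W : algType k) (d e f : nat -> nat -> W).
Hypothesis HW : is_W_pi n p d e f.
Local Notation L := (Lfld k n p).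
Local Notation D := (LM_data k n p).
Local Notation SK := (skew_alg D).
Variable Phi : W -> SK.
Hypothesis HPhi : gt_hom d e f Phi.
Let Hh : is_alg_hom Phi. Proof. by case: HPhi. Qed.
Local Notation gtE := (gt_E D (@rowv n p) (@zL k n p) (@muL n p)).
Local Notation gtF := (gt_F D (@rowv n p) (@zL k n p) (@muL n p)).

Lemma gt_hom_ind (S : SK -> Prop) :
  S 1 -> (forall (c : k) X Y, S X -> S Y -> S (c *: X + Y)) -> (forall X Y, S X -> S Y -> S (X * Y)) ->
  (forall i r, S (gt_d D (@rowv n p) (@zL k n p) i r)) ->
  (forall i a, (i.+1 < n)%N -> S (gtE i a)) -> (forall i a, (i.+1 < n)%N -> S (gtF i a)) ->
  forall w, S (Phi w).
Proof.
move=> S1 Slin SM Sd SE SF; case: HPhi => [[hl hm h1] hd he hf].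
apply: (W_induction HW) => [|c x y|x y|i r Hi Hr|i r Hi Hr|i r Hi Hr].
- by rewrite h1.
- by rewrite hl; apply: Slin.
- by rewrite hm; apply: SM.
- by rewrite (hd i r Hi Hr); apply: Sd.
- by rewrite (he i r Hi Hr); apply: SE.
- by rewrite (hf i r Hi Hr); apply: SF.
Qed.

Lemma gt_hom_supported w : supported (@in_M n p) (Phi w).
Proof.
have M0 := @in_M0 n p; have MD := @in_MD n p.
have Mmu i : (i.+1 < n)%N -> forall v : Var n p, rowv v = i -> in_M (muL v) /\ in_M (- muL v).
  by move=> Hi v Hv; apply: in_M_muL; lia.
move: w; apply: (@gt_hom_ind (supported (@in_M n p))).
- by rewrite -sk1; apply: supported_sk.
- by move=> c X Y HX HY; apply: supportedD HY; apply: (supportedZ M0 MD).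
- by move=> X Y HX HY; apply: (supportedM MD).
- by move=> i r; apply: supported_sk.
- by move=> i a Hi; apply: (supported_gt_E M0 MD (Mmu i Hi)).
- by move=> i a Hi; apply: (supported_gt_F M0 MD (Mmu i Hi)).
Qed.

Lemma gt_hom_invariant s w : inG s -> skG s (Phi w) = Phi w.
Proof.
move=> Hs; have Hz v : actG s (zL k v) = zL k (s v) by apply: actG_zL.
move: w; apply: (@gt_hom_ind (fun X => skG s X = X)).
- by rewrite -sk1 skG_iota rmorph1.
- by move=> c X Y HX HY; rewrite skG_D skG_Z HX HY.
- by move=> X Y HX HY; rewrite skG_M HX HY.
- move=> i r; exact: (skmap_gt_d (g := actG s) D (conjMK s) (conjMKV s) (conjMD s) Hs Hz i r).
- move=> i a _; exact: (skmap_gt_E (D := D) (g := actG s) (conjMK s) (conjMKV s) (conjMD s)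
    (@skG_act k n p s) Hs Hz (conjM_muL s) i a).
- move=> i a _; exact: (skmap_gt_F (D := D) (g := actG s) (conjMK s) (conjMKV s) (conjMD s)
    (@skG_act k n p s) Hs Hz (conjM_muL s) i a).
Qed.

Let U (X : SK) := exists w, Phi w = X.
Let U1 : U 1. Proof. by exists 1; apply: (alg_hom1 Hh). Qed.
Let UM X Y : U X -> U Y -> U (X * Y).
Proof. by move=> [w <-] [w' <-]; exists (w * w'); apply: (alg_homM Hh). Qed.
Let UE i a : (i.+1 < n)%N -> U (gtE i a).
Proof. by move=> Hi; exists (e i (a + 1 + yshift p i)); apply: (gt_hom_E HPhi). Qed.
Let UF i a : (i.+1 < n)%N -> U (gtF i a).
Proof. by move=> Hi; exists (f i a.+1); apply: (gt_hom_F HPhi). Qed.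
Let in_M_span (m : Mt n p) : in_M m ->
  exists c : Var n p -> int, m = \sum_(v | (rowv v < n.-1)%N) muL v *~ c v.
Proof. by move=> /in_M_sum Hm; exists (fun v => - m v). Qed.

Variable X : SK.
Hypothesis X_supp : supported (@in_M n p) X.
Hypothesis X_inv : forall s, inG s -> skG s X = X.

Lemma LM_invariants_left : exists l : seq (L * W), (forall t, t \in l -> inK t.1) /\
  X = \sum_(t <- l) sk t.1 0 * Phi t.2.
Proof.
have [l El] := left_combination (gtL n p char0) in_M_span U1 UM UE UF (fun X HX => HX) X_supp.
have := invariant_left char0 (fun (t : L * W) s => @gt_hom_invariant s t.2) X_inv El.
set avg := average _ _ => Eavg; exists [seq (avg t.1, t.2) | t <- l]; split.
  by move=> t /mapP [t' _ ->]; apply: average_inK.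
by rewrite big_map.
Qed.

Lemma LM_invariants_right : exists l : seq (L * W), (forall t, t \in l -> inK t.1) /\
  X = \sum_(t <- l) Phi t.2 * sk t.1 0.
Proof.
have [l El] := right_combination (gtL n p char0) in_M_span U1 UM UE UF (fun X HX => HX) X_supp.
have := invariant_right char0 (fun (t : L * W) s => @gt_hom_invariant s t.2) X_inv El.
set avg := average _ _ => Eavg; exists [seq (avg t.1, t.2) | t <- l]; split.
  by move=> t /mapP [t' _ ->]; apply: average_inK.
by rewrite big_map.
Qed.
End GTImage.

Theorem theorem3p5 (k : closedFieldType) (n : nat) (p : nat -> nat)
  (char0 : [pchar k] =i pred0)
  (p_pos : forall i, (i < n)%N -> (0 < p i)%N)
  (p_sorted : forall i, (i.+1 < n)%N -> (p i <= p i.+1)%N)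
  (W : algType k) (d e f : nat -> nat -> W)
  (HW : is_W_pi n p d e f) :
  exists phi : W -> SA k n p,
    (* phi is an injective algebra homomorphism W(pi) -> (L * M)^G *)
    [/\ forall w, in_LM (phi w) /\ inv_G (phi w),
        forall (c : k) (w w' : W), saeq (phi (c *: w + w')) (sascale c (phi w) ++ phi w'),
        forall w w' : W, saeq (phi (w * w')) (samul (phi w) (phi w')),
        saeq (phi 1) (saone k n p) &
        forall w w' : W, saeq (phi w) (phi w') -> w = w'] /\
    (* on Gamma it is the identification a_r^{(j)} |-> e_j(x_{r1}^1, ...) *)
    (forall r j, (r < n)%N -> (0 < j <= msum p r)%N ->
       saeq (phi (acoef p d r j)) (sacst (esymr k n p r j)%:F)) /\
    (* the image is a Galois algebra over Gamma *)
    [/\ (* finitely generated over Gamma *)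
        exists gens : seq W, forall S : W -> Prop,
          S 1 ->
          (forall (c : k) x y, S x -> S y -> S (c *: x + y)) ->
          (forall x y, S x -> S y -> S (x * y)) ->
          (forall r j, (r < n)%N -> (0 < j <= msum p r)%N -> S (acoef p d r j)) ->
          (forall g, g \in gens -> S g) ->
          forall w, S w,
        (* K U = (L * M)^G *)
        forall x : SA k n p, (in_LM x /\ inv_G x) <->
          exists l : seq (Lfld k n p * W), (forall a, a \in l -> inK a.1) /\
            saeq x (flatten [seq samul (sacst a.1) (phi a.2) | a <- l]) &
        (* U K = (L * M)^G *)
        forall x : SA k n p, (in_LM x /\ inv_G x) <->
          exists l : seq (Lfld k n p * W), (forall a, a \in l -> inK a.1) /\
            saeq x (flatten [seq samul (phi a.2) (sacst a.1) | a <- l])].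
Proof.
have [Phi HPhi] := gt_hom_ex char0 p_sorted HW.
have [Hh _ _ _] := HPhi.
have M0 := @in_M0 n p; have MD := @in_MD n p.
have supp := gt_hom_supported HW HPhi.
have inv s w := @gt_hom_invariant k n p W d e f HW Phi HPhi s w.
exists (fun w => to_SA (Phi w)); split; [split|split; [|split]].
- move=> w; split; first by apply/in_LMP; rewrite to_SAK; apply: supp.
  by apply/inv_GP => s Hs; rewrite to_SAK; apply: inv.
- by move=> c w w'; apply/saeqP; rewrite of_SA_cat of_SA_scale !to_SAK (alg_homD Hh) (alg_homZ Hh).
- by move=> w w'; apply/saeqP; rewrite of_SA_mul !to_SAK (alg_homM Hh).
- by apply/saeqP; rewrite to_SAK (alg_hom1 Hh) /saone -[RHS]/(of_SA (sacst 1)) of_SA_cst sk1.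
- move=> w w' /saeqP; rewrite !to_SAK => Heq; apply/eqP; rewrite -subr_eq0; apply/eqP.
  apply: (gt_hom_injective char0 p_pos p_sorted HW HPhi).
  by rewrite (alg_homB Hh) Heq subrr.
- move=> r j Hr _; apply/saeqP; rewrite to_SAK of_SA_cst (gt_hom_acoef HPhi j Hr).
  by rewrite gt_Q_esymr.
- exists (W_gens n p d e f) => S S1 Slin SM _ Sg; exact: (W_finitely_generated HW S1 Slin SM Sg).
- move=> x; split=> [[/in_LMP Hx /inv_GP Hi]|[l [Hl /saeqP Hx]]].
    have [l [Hl El]] := LM_invariants_left char0 HW HPhi Hx Hi.
    exists l; split => //; apply/saeqP; rewrite of_SA_flatten El; apply: eq_bigr => t _.
    by rewrite of_SA_mul of_SA_cst to_SAK.
  have {}Hx : of_SA x = \sum_(t <- l) sk t.1 0 * Phi t.2.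
    rewrite Hx of_SA_flatten; apply: eq_bigr => t _.
    by rewrite of_SA_mul of_SA_cst to_SAK.
  split; first apply/in_LMP; last (apply/inv_GP => s Hs); rewrite Hx.
    by apply: supported_sum => t _; apply: (supportedM MD); [apply: supported_sk | apply: supp].
  rewrite skG_sum big_seq [RHS]big_seq; apply: eq_bigr => t /Hl Ht.
  by rewrite skG_M skG_iota (inK_actG Ht Hs) inv.
- move=> x; split=> [[/in_LMP Hx /inv_GP Hi]|[l [Hl /saeqP Hx]]].
    have [l [Hl El]] := LM_invariants_right char0 HW HPhi Hx Hi.
    exists l; split => //; apply/saeqP; rewrite of_SA_flatten El; apply: eq_bigr => t _.
    by rewrite of_SA_mul of_SA_cst to_SAK.
  have {}Hx : of_SA x = \sum_(t <- l) Phi t.2 * sk t.1 0.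
    rewrite Hx of_SA_flatten; apply: eq_bigr => t _.
    by rewrite of_SA_mul of_SA_cst to_SAK.
  split; first apply/in_LMP; last (apply/inv_GP => s Hs); rewrite Hx.
    by apply: supported_sum => t _; apply: (supportedM MD); [apply: supp | apply: supported_sk].
  rewrite skG_sum big_seq [RHS]big_seq; apply: eq_bigr => t /Hl Ht.
  by rewrite skG_M skG_iota (inK_actG Ht Hs) inv.
Qed.
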